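(* Let $\Lambda$ denote the von Mangoldt function and $[t]$ the integral part of a real number $t$. For every $\varepsilon>0$, $$\sum_{n\le x} \Lambda\Big(\Big[\frac{x}{n}\Big]\Big) = x\sum_{d\ge 1}\frac{\Lambda(d)}{d(d+1)} + O_{\varepsilon}\big(x^{9/19+\varepsilon}\big)\qquad (x\to\infty),$$ where the implied constant depends only on $\varepsilon$. *)

(* Defs.v *)
From mathcomp Require Import all_boot all_order all_algebra.
From mathcomp Require Import all_classical all_reals all_analysis.

Set Implicit Arguments.
Unset Strict Implicit.
Unset Printing Implicit Defensive.

Import Order.TTheory GRing.Theory Num.Theory.
Import numFieldNormedType.Exports.

Local Open Scope ring_scope.

(* [primes n] is the duplicate-free list of prime divisors of [n]; it is a
   singleton [:: p] exactly when n = p ^ k with p prime and 0 < k, and it is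
   empty for n = 0 and n = 1.  See vonMangoldtX and vonMangoldt_eq0. *)
Definition vonMangoldt (R : realType) (n : nat) : R :=
  if primes n is [:: p] then ln p%:R else 0.

Lemma vonMangoldtX (R : realType) (p k : nat) :
  prime p -> (0 < k)%N -> vonMangoldt R (p ^ k) = ln p%:R.
Proof.
by move=> pp k0; rewrite /vonMangoldt primesX // primes_prime.
Qed.

Lemma vonMangoldt_eq0 (R : realType) (n : nat) :
  (forall p k : nat, prime p -> (0 < k)%N -> n <> (p ^ k)%N) ->
  vonMangoldt R n = 0.
Proof.
move=> npk; rewrite /vonMangoldt.
case En : (primes n) => [|p [|q s]] //.
have : p \in primes n by rewrite En mem_head.
rewrite mem_primes => /and3P[pp n0 pn].
have k0 : (0 < logn p n)%N by rewrite logn_gt0 En mem_head.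
case: (npk p (logn p n) pp k0).
rewrite [LHS](prod_prime_decomp n0) prime_decompE En big_map big_seq1.
by [].
Qed.

(* Main.v *)
(** The terms with [n <= x^(9/19)] contribute at most [x^(9/19) ln x]; for the others
    [d = [x/n]] is at most [x^(10/19)], and counting the [n] with [[x/n] = d] reduces
    the theorem to bounds for the sums of [Lambda(d) psi(x/(d + delta))], [delta = 0, 1],
    over dyadic blocks [D <= d < 2D] with [y^9 <= D <= y^10], where [y = x^(1/19)] and
    [psi] is the sawtooth function.  By monotonicity of the integral part, [psi] is
    squeezed between difference quotients, of step [y^9/D], of the periodic function
    [{t}^2 - {t}]; replacing the latter by its Fejer means leaves the sums over [d] of
    [Lambda(d) cos(2 pi h x/(d + delta) + alpha_h)], weighted by about [1/h] for [h] up to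
    [y^4].  Allowing arbitrary phases [alpha_h] makes complex exponentials unnecessary.

    Vaughan's identity with both cut-offs equal to [y^2] splits these sums.  Type I sums
    are bounded by van der Corput's second derivative test, used in the form of a test on
    second differences.  In type II sums over [d = mn] with [m >= n], Cauchy-Schwarz is
    applied after grouping the pairs [(h, n)] according to the size of [h/n], so that only
    the pairs with [|h n' - h' n| << Q], [Q = D^2/y^18], are compared.  The divisor bound
    counts them, and for each of them the sum over [m] has a phase [x (h/n - h'/n')/m] small
    enough for van der Corput's test to save the square root of [Q] altogether. *)

Require Import Defs.
From mathcomp Require Import all_boot all_order all_algebra.
From mathcomp Require Import all_classical all_reals all_analysis.
From mathcomp Require Import ring lra zify.

Set Implicit Arguments.
Unset Strict Implicit.
Unset Printing Implicit Defensive.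

Import Order.TTheory GRing.Theory Num.Theory.
Import numFieldNormedType.Exports.

Local Open Scope classical_set_scope.
Local Open Scope ring_scope.

(** * Van der Corput's second derivative test *)

Lemma abel_monotone (R : realDomainType) (S u : nat -> R) (A B : R) (n : nat) :
  0 <= B ->
  (forall i, (i <= n)%N -> `|S i| <= A) -> (forall i, (i < n)%N -> `|u i| <= B) ->
  (forall i, (i.+1 < n)%N -> u i <= u i.+1) ->
  `|\sum_(i < n) (S i.+1 - S i) * u i| <= 4 * A * B.
Proof.
move=> B0; case: n => [|n] hS hu hm.
  have A0 : 0 <= A by rewrite (le_trans (normr_ge0 _) (hS 0 (leqnn _))).
  by rewrite big_ord0 normr0 !mulr_ge0.
have A0 : 0 <= A by rewrite (le_trans (normr_ge0 _) (hS 0 (leq0n _))).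
have key m : (m <= n)%N ->
  `|\sum_(i < m.+1) (S i.+1 - S i) * u i - S m.+1 * u m| <=
     A * `|u 0| + A * (u m - u 0).
  elim: m => [|m IH] mn.
    rewrite big_ord1 subrr mulr0 addr0.
    have -> : (S 1 - S 0) * u 0 - S 1 * u 0 = - (S 0 * u 0) by ring.
    by rewrite normrN normrM ler_wpM2r// hS.
  rewrite big_ord_recr/=.
  set X := \sum_(_ < _) _ in IH *.
  have -> : X + (S m.+2 - S m.+1) * u m.+1 - S m.+2 * u m.+1 =
    (X - S m.+1 * u m) - S m.+1 * (u m.+1 - u m) by ring.
  apply: (le_trans (ler_normB _ _)).
  have um : u m <= u m.+1 by apply: hm.
  have h1 : `|S m.+1 * (u m.+1 - u m)| <= A * (u m.+1 - u m).
    rewrite normrM (ger0_norm (_ : 0 <= u m.+1 - u m)) ?subr_ge0//.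
    by rewrite ler_wpM2r ?subr_ge0// hS// ltnW.
  have h2 := IH (ltnW mn).
  have -> : A * `|u 0| + A * (u m.+1 - u 0) =
    A * `|u 0| + A * (u m - u 0) + A * (u m.+1 - u m) by ring.
  exact: lerD.
have h := key n (leqnn _).
set X := \sum_(_ < _) _ in h *.
have -> : X = (X - S n.+1 * u n) + S n.+1 * u n by ring.
apply: (le_trans (ler_normD _ _)).
have h1 : `|S n.+1 * u n| <= A * B by rewrite normrM ler_pM// ?hS ?hu.
have h2 : A * `|u 0| <= A * B by rewrite ler_wpM2l// hu.
have h3 : A * (u n - u 0) <= A * (B + B).
  rewrite ler_wpM2l//.
  apply: (le_trans (ler_norm _)); apply: (le_trans (ler_normB _ _)).
  by rewrite lerD// hu.
have := lerD (le_trans h (lerD h2 h3)) h1.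
by move/le_trans; apply; rewrite le_eqVlt; apply/orP; left; apply/eqP; ring.
Qed.


Section exponential_sums.
Context {R : realType}.
Implicit Types (t a b d l C : R) (f : nat -> R) (i j n : nat).

Lemma cos2piDn t n : cos (2 * pi * (t + n%:R)) = cos (2 * pi * t) :> R.
Proof.
have -> : 2 * pi * (t + n%:R) = 2 * pi * t + (pi *+ 2) *+ n :> R.
  by rewrite -[_ *+ n]mulr_natr -[pi *+ 2]mulr_natr; ring.
exact: (periodicn (@cosD2pi R)).
Qed.

Lemma cos2piDz t (m : int) : cos (2 * pi * (t + m%:~R)) = cos (2 * pi * t) :> R.
Proof.
case: m => n; first exact: cos2piDn.
by rewrite NegzE mulrNz -[LHS](cos2piDn _ n.+1) -pmulrn subrK.
Qed.

Lemma sin_ge_mulcos a : 0 <= a <= pi -> a * cos a <= sin a.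
Proof.
move=> /andP[a0 api].
have dh (z : R) : is_derive z 1 (fun v : R => sin v - v * cos v) (z * sin z).
  apply: is_derive_eq; rewrite /GRing.scale/=; ring.
have [->|aneq0] := eqVneq a 0; first by rewrite mul0r sin0.
have apos : 0 < a by rewrite lt_neqAle eq_sym aneq0.
have [c] : exists2 c, c \in `]0, a[%R &
    (sin a - a * cos a) - (sin 0 - 0 * cos 0) = (c * sin c) * (a - 0).
  apply: (@MVT R (fun v => sin v - v * cos v) (fun v => v * sin v)) => //.
  apply: derivable_within_continuous => z _.
  exact: (@ex_derive _ _ _ _ _ _ _ (dh z)).
rewrite in_itv/= => /andP[c0 ca].
rewrite sin0 mul0r !subr0 => e.
rewrite -subr_ge0 e mulr_ge0// mulr_ge0 ?(ltW c0)// sin_ge0_pi//.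
by rewrite ltW//= (le_trans (ltW ca)).
Qed.

Lemma sin_pi_ge a : 0 <= a <= 1 / 2 -> a <= sin (pi * a).
Proof.
move=> /andP[a0 a1].
have p0 : 0 < pi :> R := pi_gt0 R.
have p2 : 2 <= pi :> R := pi_ge2 R.
set v := pi * a / 2.
have vE : pi * a = v *+ 2 by rewrite /v mulr2n; field.
have v0 : 0 <= v by rewrite /v divr_ge0// mulr_ge0// ltW.
have v1 : v <= pi / 4 by rewrite /v; nra.
rewrite vE sin_mulr2n.
have hs : v * cos v <= sin v by apply: sin_ge_mulcos; apply/andP; split => //; nra.
have c0 : 0 <= cos v by apply: cos_ge0_pihalf; apply/andP; split; nra.
have : cos (v *+ 2) = cos v ^+2 *+ 2 - 1 := cos_mulr2n v.
have : 0 <= cos (v *+ 2).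
  by rewrite -vE; apply: cos_ge0_pihalf; apply/andP; split; nra.
rewrite !mulr2n => h1 h2.
have h3 : 1 / 2 <= cos v ^+ 2 by lra.
have h4 : a <= v by rewrite /v; nra.
have h5 : v * cos v ^+ 2 <= cos v * sin v.
  by rewrite expr2 mulrCA mulrA -mulrA ler_wpM2l.
nra.
Qed.

Lemma sin_pi_ge_dist a d : 0 <= d -> d <= a <= 1 - d -> d <= sin (pi * a).
Proof.
move=> d0 /andP[da a1].
have [h|h] := lerP a (1 / 2).
  by apply: (le_trans da); apply: sin_pi_ge; rewrite h (le_trans d0).
have -> : sin (pi * a) = sin (pi * (1 - a)) :> R.
  by rewrite mulrBr mulr1 sinB sinpi cospi; ring.
by apply: (@le_trans _ _ (1 - a)); [lra | apply: sin_pi_ge; lra].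
Qed.

Lemma sum_cos_telescope f n (c := fun i => cos (pi * (f i.+1 - f i)) / sin (pi * (f i.+1 - f i))) :
  (forall i, (i < n)%N -> sin (pi * (f i.+1 - f i)) != 0) ->
  \sum_(i < n) cos (2 * pi * f i) =
  (\sum_(i < n) (sin (2 * pi * f i.+1) - sin (2 * pi * f i)) * c i
   + (cos (2 * pi * f 0) - cos (2 * pi * f n))) / 2.
Proof.
elim: n => [|n IH] h; first by rewrite !big_ord0 subrr add0r mul0r.
rewrite big_ord_recr/= [in RHS]big_ord_recr/= IH; last first.
  by move=> i hi; apply: h; rewrite ltnS ltnW.
have := h n (ltnSn n); rewrite /c; set a := pi * _ => sa.
have -> : 2 * pi * f n.+1 = 2 * pi * f n + a *+ 2 by rewrite /a mulr2n; ring.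
rewrite sinD (cosD (2 * pi * f n)) sin_mulr2n cos_mulr2n !mulr2n.
set X := \sum_(_ < _) _.
have e := cos2Dsin2 a.
set s := sin a in sa e *; set k := cos a in e *.
set S := sin _; set Cc := cos (2 * pi * f n); set C0 := cos (2 * pi * f 0).
have e2 : k ^+ 2 = 1 - s ^+ 2 by rewrite -e addrK.
have -> : (X + (S * (k ^+ 2 + k ^+ 2 - 1) + Cc * (k * s + k * s) - S) * (k / s) +
    (C0 - (Cc * (k ^+ 2 + k ^+ 2 - 1) - S * (k * s + k * s)))) / 2 =
   (X + (C0 - Cc)) / 2 + Cc * (k ^+ 2 + s ^+ 2)
   + (1 - k ^+ 2 - s ^+ 2) * (Cc - S * k / s) by field.
by rewrite e e2; ring.
Qed.

Lemma kusmin_landau f d n (j : int) : 0 < d ->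
  (forall i, (i < n)%N -> j%:~R + d <= f i.+1 - f i <= j%:~R + 1 - d) ->
  (forall i, (i.+1 < n)%N -> f i.+1 - f i <= f i.+2 - f i.+1) ->
  `|\sum_(i < n) cos (2 * pi * f i)| <= 2 / d + 1.
Proof.
move=> d0 hf hm.
pose g i : R := f i - j%:~R * i%:R.
have -> : \sum_(i < n) cos (2 * pi * f i) = \sum_(i < n) cos (2 * pi * g i).
  apply: eq_bigr => i _; rewrite -[RHS](cos2piDz _ (j * (i : nat)%:Z)).
  by rewrite /g intrM -pmulrn subrK.
have gE i : g i.+1 - g i = f i.+1 - f i - j%:~R.
  by rewrite /g -natr1; ring.
have hg i : (i < n)%N -> d <= g i.+1 - g i <= 1 - d.
  by move=> /hf /andP[h1 h2]; rewrite gE; lra.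
have sg i : (i < n)%N -> d <= sin (pi * (g i.+1 - g i)).
  by move=> /hg; apply: sin_pi_ge_dist; rewrite ltW.
have sg0 i : (i < n)%N -> 0 < sin (pi * (g i.+1 - g i)).
  by move=> /sg; apply: lt_le_trans.
rewrite sum_cos_telescope; last by move=> i /sg0; rewrite lt0r => /andP[].
set X := \sum_(_ < _) _.
have hX : `|X| <= 4 * 1 * d^-1.
  rewrite -normrN -sumrN.
  under eq_bigr do rewrite -mulrN.
  apply: (@abel_monotone _ (fun i => sin (2 * pi * g i))
    (fun i => - (cos (pi * (g i.+1 - g i)) / sin (pi * (g i.+1 - g i))))).
  - by rewrite invr_ge0 ltW.
  - by move=> i _; exact: sin_max.
  - move=> i hi; rewrite normrN normrM normfV (gtr0_norm (sg0 _ hi)).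
    rewrite -[leRHS]mul1r ler_pM ?invr_ge0 ?(ltW (sg0 _ hi)) ?cos_max//.
    by rewrite lef_pV2 ?posrE ?sg ?sg0.
  - move=> i hi; have hi' := ltnW hi.
    rewrite lerN2 ler_pdivrMr ?sg0// mulrAC ler_pdivlMr ?sg0//.
    rewrite -subr_ge0.
    set a := pi * (g i.+1 - g i); set b := pi * (g i.+2 - g i.+1).
    have -> : cos a * sin b - cos b * sin a = sin (b - a) by rewrite sinB; ring.
    apply: sin_ge0_pi; rewrite /a /b -mulrBr.
    have p0 : 0 < pi :> R := pi_gt0 R.
    have := hm i hi; have := hg _ hi; have := hg _ hi'; rewrite !gE => h1 h2 h3.
    move: h1 h2 => /andP[? ?] /andP[? ?]; apply/andP; split.
      by rewrite pmulr_rge0//; lra.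
    by rewrite -[leRHS]mulr1 ler_pM2l//; lra.
have := cos_max (2 * pi * g 0); have := cos_max (2 * pi * g n).
move: hX; rewrite mulr1 !ler_norml => /andP[h1 h2] /andP[h3 h4] /andP[h5 h6].
by apply/andP; split; lra.
Qed.

Lemma monotone_split (th : nat -> R) n t :
  (forall i, (i.+1 < n)%N -> th i <= th i.+1) ->
  exists2 k, (k <= n)%N & (forall i, (i < k)%N -> th i < t) /\
    (forall i, (k <= i < n)%N -> t <= th i).
Proof.
elim: n => [|n IH] h; first by exists 0%N => //; split=> // i; rewrite ltn0 andbF.
have [i hi|k kn [h1 h2]] := IH; first by apply: h; rewrite ltnW.
have [hk|hk] := lerP t (th n).
  exists k; first exact: leqW.
  by split=> // i /andP[ki]; rewrite ltnS leq_eqVlt => /predU1P[->//|ilt];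
    apply: h2; rewrite ki.
exists n.+1 => //; split; last by move=> i /andP[/leq_ltn_trans H /H]; rewrite ltnn.
have mono i : (i <= n)%N -> th i <= th n.
  move=> le_in; elim: {-2}n (leqnn n) le_in => [|m IHm] hmn.
    by rewrite leqn0 => /eqP ->.
  rewrite leq_eqVlt => /predU1P[->//|]; rewrite ltnS => him.
  by apply: (le_trans (IHm (ltnW hmn) him)); apply: h.
by move=> i; rewrite ltnS => /mono /le_lt_trans; apply.
Qed.

Lemma big_ord_split (F : nat -> R) n k : (k <= n)%N ->
  \sum_(i < n) F i = \sum_(i < k) F i + \sum_(i < n - k) F (k + i)%N.
Proof. by move=> kn; rewrite -[in LHS](subnKC kn) big_split_ord. Qed.

Lemma ler_sum_cos f n : `|\sum_(i < n) cos (2 * pi * f i)| <= n%:R.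
Proof.
apply: (le_trans (ler_norm_sum _ _ _)).
rewrite -[X in _ <= X%:R]card_ord -sumr_const; apply: ler_sum => i _.
exact: cos_max.
Qed.

Lemma increments_length (th : nat -> R) n l a b : 0 < l -> a <= b ->
  (forall i, (i.+1 < n)%N -> th i + l <= th i.+1) ->
  (forall i, (i < n)%N -> a <= th i <= b) -> n%:R <= (b - a) / l + 1.
Proof.
move=> l0 ab hm hab; case: n hm hab => [|n] hm hab.
  by rewrite addr_ge0// divr_ge0 ?subr_ge0// ltW.
have key m : (m <= n)%N -> th 0 + m%:R * l <= th m.
  elim: m => [|m IH] mn; first by rewrite mul0r addr0.
  apply: le_trans (hm m mn); rewrite -natr1 mulrDl mul1r addrA lerD2r.
  exact/IH/ltnW.
have := key n (leqnn n); have /andP[h1 _] := hab 0 isT.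
have /andP[_ h2] := hab n (ltnSn n) => h3.
rewrite -natr1 lerD2r ler_pdivlMr//; lra.
Qed.

Lemma vdc_block f n l (j : int) : 0 < l < 1 ->
  (forall i, (i.+1 < n)%N -> f i.+1 - f i + l <= f i.+2 - f i.+1) ->
  (forall i, (i < n)%N -> j%:~R <= f i.+1 - f i < j%:~R + 1) ->
  `|\sum_(i < n) cos (2 * pi * f i)| <= 8 / Num.sqrt l.
Proof.
move=> /andP[l0 l1] hm hj.
set s := Num.sqrt l.
have s0 : 0 < s by rewrite sqrtr_gt0.
have sl : s * s = l by rewrite -expr2 sqr_sqrtr// ltW.
have s1 : s < 1 by rewrite -sqrtr1 ltr_sqrt.
have sV : 1 <= s^-1 by rewrite invf_ge1// ltW.
pose th i := f i.+1 - f i.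
have thm i : (i.+1 < n)%N -> th i <= th i.+1.
  by move=> /hm; rewrite /th; lra.
have [k kn [hk1 hk2]] := monotone_split (j%:~R + s / 2) thm.
pose g i := f (k + i)%N.
have thm2 i : (i.+1 < n - k)%N -> th (k + i)%N <= th (k + i.+1)%N.
  by rewrite addnS => hi; apply: thm; lia.
have [p pn [hp1 hp2]] := monotone_split (j%:~R + 1 - s / 2) thm2.
rewrite (big_ord_split (fun i => cos (2 * pi * f i)) kn)
  (big_ord_split (fun i => cos (2 * pi * f (k + i)%N)) pn).
have dl : (s / 2) / l = s^-1 / 2 by rewrite -sl; field; rewrite gt_eqF.
have b1 : `|\sum_(i < k) cos (2 * pi * f i)| <= s^-1 / 2 + 1.
  apply: (le_trans (ler_sum_cos _ _)).
  have := @increments_length th k l j%:~R (j%:~R + s / 2) l0.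
  rewrite addrAC subrr add0r dl; apply; first by lra.
    by move=> i hi; apply: hm; lia.
  by move=> i hi; rewrite (ltW (hk1 i hi)) andbT; have /andP[] := hj i (leq_trans hi kn).
have b3 : `|\sum_(i < n - k - p) cos (2 * pi * f (k + (p + i))%N)| <= s^-1 / 2 + 1.
  apply: (le_trans (ler_sum_cos (fun i => f (k + (p + i))%N) _)).
  have := @increments_length (fun i => th (k + (p + i))%N) (n - k - p) l
    (j%:~R + 1 - s / 2) (j%:~R + 1) l0.
  have -> : j%:~R + 1 - (j%:~R + 1 - s / 2) = s / 2 by ring.
  rewrite dl; apply; first by lra.
    by move=> i hi; rewrite !addnS; apply: hm; lia.
  move=> i hi; rewrite hp2/=; last by lia.
  by have /andP[_ /ltW] := hj (k + (p + i))%N ltac:(lia).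
have b2 : `|\sum_(i < p) cos (2 * pi * f (k + i)%N)| <= 4 * s^-1 + 1.
  have -> : 4 * s^-1 = 2 / (s / 2) by field; rewrite gt_eqF.
  apply: (@kusmin_landau (fun i => f (k + i)%N) _ _ j); first by lra.
    move=> i hi; rewrite addnS -/(th (k + i)%N) hk2 ?(ltW (hp1 i hi))//; lia.
  by move=> i hi; rewrite !addnS; apply: thm; lia.
have := ler_normD (\sum_(i < p) cos (2 * pi * f (k + i)%N))
  (\sum_(i < n - k - p) cos (2 * pi * f (k + (p + i))%N)).
set X2 := \sum_(i < p) _ in b2 *; set X3 := \sum_(i < n - k - p) _ in b3 *.
set X1 := \sum_(i < k) _ in b1 *; have := ler_normD X1 (X2 + X3).
lra.
Qed.

Lemma vdc_unit_intervals l (J : nat) : forall (j : int) (f : nat -> R) (n : nat), 0 < l < 1 ->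
  (forall i, (i.+1 < n)%N -> f i.+1 - f i + l <= f i.+2 - f i.+1) ->
  (forall i, (i < n)%N -> j%:~R <= f i.+1 - f i < j%:~R + J%:R) ->
  `|\sum_(i < n) cos (2 * pi * f i)| <= J%:R * (8 / Num.sqrt l).
Proof.
elim: J => [|J IH] j f n hl hm hj.
  case: n hm hj => [|n] hm hj; first by rewrite big_ord0 normr0 mul0r.
  by have := hj 0 isT; rewrite addr0 => /andP[/le_lt_trans h /h]; rewrite ltxx.
have thm i : (i.+1 < n)%N -> f i.+1 - f i <= f i.+2 - f i.+1.
  by move: hl => /andP[l0 _] /hm; lra.
have [k kn [h1 h2]] := monotone_split (th := fun i => f i.+1 - f i) (j%:~R + 1) thm.
rewrite (big_ord_split (fun i => cos (2 * pi * f i)) kn).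
have -> : J.+1%:R * (8 / Num.sqrt l) = 8 / Num.sqrt l + J%:R * (8 / Num.sqrt l).
  by rewrite -[J.+1]addn1 natrD; ring.
apply: (le_trans (ler_normD _ _)); apply: lerD; last first.
  apply: (IH (j + 1) (fun i => f (k + i)%N)) => //.
    by move=> i hi; rewrite !addnS; apply: hm; lia.
  move=> i hi; rewrite addnS intrD h2/=; last by lia.
  have /andP[_] := hj (k + i)%N ltac:(lia); rewrite -natr1; lra.
apply: (vdc_block (j := j)) => // i hi; first by apply: hm; lia.
by rewrite h1// andbT; have /andP[] := hj i ltac:(lia).
Qed.

Lemma vdc_second_difference f n l C : 0 < l -> 1 <= C ->
  (forall i, (i < n)%N -> l <= f i.+2 - f i.+1 - (f i.+1 - f i) <= C * l) ->
  `|\sum_(i < n) cos (2 * pi * f i)| <=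
    8 * C * n%:R * Num.sqrt l + 16 / Num.sqrt l.
Proof.
move=> l0 C1 hf; set s := Num.sqrt l.
have s0 : 0 < s by rewrite sqrtr_gt0.
have sl : s * s = l by rewrite -expr2 sqr_sqrtr// ltW.
have n0 : 0 <= n%:R :> R by [].
have [l1|l1] := lerP 1 l.
  apply: (le_trans (ler_sum_cos _ _)).
  have s1 : 1 <= s by rewrite -[1]sqrtr1; exact: ler_wsqrtr.
  have h1 : n%:R * 1 <= n%:R * (C * s) by apply: ler_wpM2l => //; nra.
  have h2 : 0 <= 16 / s by rewrite divr_ge0// ltW.
  have -> : 8 * C * n%:R * s = 8 * (n%:R * (C * s)) by ring.
  by rewrite mulr1 in h1; lra.
have [->|n_gt0] := posnP n.
  by rewrite big_ord0 normr0 mulr0 mul0r add0r divr_ge0// ltW.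
pose j := Num.floor (f 1 - f 0).
pose J := (Num.truncn (C * l * n%:R) + 2)%N.
have Cl0 : 0 <= C * l * n%:R by rewrite !mulr_ge0// ltW// (lt_le_trans ltr01).
have hJ : `|\sum_(i < n) cos (2 * pi * f i)| <= J%:R * (8 / s).
  apply: (@vdc_unit_intervals l J j f n); first by rewrite l0.
    by move=> i hi; have := hf i (ltnW hi); lra.
  have key i : (i < n)%N -> f 1 - f 0 <= f i.+1 - f i <= f 1 - f 0 + i%:R * (C * l).
    elim: i => [|i IH] hi; first by rewrite mul0r addr0 lexx.
    have := IH (ltnW hi); have := hf i (ltnW hi).
    by rewrite -natr1 mulrDl mul1r => /andP[? ?] /andP[? ?]; apply/andP; split; lra.
  move=> i hi; have /andP[h1 h2] := key i hi.
  have f1 := floor_le (f 1 - f 0); have f2 := floorD1_gt (f 1 - f 0).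
  have t1 : C * l * n%:R < (Num.truncn (C * l * n%:R))%:R + 1.
    by rewrite natr1; apply: truncnS_gt.
  have h3 : i%:R * (C * l) <= C * l * n%:R.
    by rewrite mulrC ler_wpM2l ?ler_nat 1?ltnW// mulr_ge0// ltW// (lt_le_trans ltr01).
  apply/andP; split; first exact: le_trans h1.
  have -> : J%:R = (Num.truncn (C * l * n%:R))%:R + 2 :> R by rewrite /J natrD.
  by move: f2; rewrite intrD -/j; lra.
apply: (le_trans hJ).
have : J%:R <= C * l * n%:R + 2.
  by rewrite /J natrD lerD2r truncn_le//.
move=> hJ2; apply: (@le_trans _ _ ((C * l * n%:R + 2) * (8 / s))).
  by rewrite ler_wpM2r// divr_ge0// ltW.
by rewrite le_eqVlt; apply/orP; left; apply/eqP; rewrite -sl; field; rewrite gt_eqF.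
Qed.

End exponential_sums.

Section vdc_interval.
Context {R : realType}.

Lemma vdc_interval (f : nat -> R) (lo hi : nat) (l C : R) : 0 < l -> 1 <= C ->
  (forall m, (lo <= m < hi)%N -> l <= f m.+2 - f m.+1 - (f m.+1 - f m) <= C * l) \/
  (forall m, (lo <= m < hi)%N -> l <= - (f m.+2 - f m.+1 - (f m.+1 - f m)) <= C * l) ->
  `|\sum_(lo <= m < hi) cos (2 * pi * f m)| <=
    8 * C * (hi - lo)%:R * Num.sqrt l + 16 / Num.sqrt l.
Proof.
move=> l0 C1; rewrite -[X in \sum_(X <= _ < _) _]add0n big_addn big_mkord => -[] hf.
  under eq_bigr do rewrite addnC.
  apply: (@vdc_second_difference _ (fun i => f (lo + i)%N)) => // i hi'.
  by rewrite !addnS; apply: hf; lia.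
have -> : \sum_(i < hi - lo) cos (2 * pi * f (i + lo)%N) =
   \sum_(i < hi - lo) cos (2 * pi * - f (lo + i)%N).
  by apply: eq_bigr => i _; rewrite mulrN cosN addnC.
apply: (@vdc_second_difference _ (fun i => - f (lo + i)%N)) => // i hi'.
have := hf (lo + i)%N ltac:(lia); rewrite !addnS.
by move=> /andP[h1 h2]; apply/andP; split; lra.
Qed.

End vdc_interval.

(** * Trigonometric approximation of the sawtooth function *)

Section sawtooth.
Context {R : realType}.
Implicit Types (t a b eta k z u : R).

Definition frac t : R := t - (Num.floor t)%:~R.
Definition saw t : R := frac t - 1 / 2.
Definition bern t : R := frac t ^+ 2 - frac t.

Lemma frac_itv t : 0 <= frac t < 1.
Proof.
have h1 := floor_le t; have h2 := floorD1_gt t.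
by rewrite intrD in h2; rewrite /frac; apply/andP; split; lra.
Qed.

Lemma fracE t a (m : int) : 0 <= a < 1 -> t = a + m%:~R -> frac t = a.
Proof.
move=> /andP[a0 a1] te; rewrite /frac.
have -> : Num.floor t = m; last by rewrite te addrK.
by apply: floor_def; rewrite te intrD; apply/andP; split; lra.
Qed.

Lemma frac_floorE t : t = frac t + (Num.floor t)%:~R.
Proof. by rewrite /frac subrK. Qed.

Lemma saw_le t eta : 0 < eta <= 1 ->
  2 * eta * saw t <= bern t - bern (t - eta) + eta ^+ 2.
Proof.
move=> /andP[e0 e1]; rewrite /saw /bern; have := frac_floorE t.
have := frac_itv t; set u := frac t; set m := Num.floor t => /andP[u0 u1] tE; clearbody u m.
have [h|h] := lerP eta u.
  rewrite (@fracE (t - eta) (u - eta) m); [| lra | by rewrite tE; ring].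
  by rewrite le_eqVlt; apply/orP; left; apply/eqP; field.
rewrite (@fracE (t - eta) (u - eta + 1) (m - 1)); [| lra | by rewrite tE intrB; ring].
rewrite -subr_ge0.
have -> : u ^+ 2 - u - ((u - eta + 1) ^+ 2 - (u - eta + 1)) + eta ^+ 2 -
  2 * eta * (u - 1 / 2) = 2 * (eta - u) by field.
by rewrite mulr_ge0// subr_ge0 ltW.
Qed.

Lemma saw_ge t eta : 0 < eta <= 1 ->
  bern (t + eta) - bern t - eta ^+ 2 <= 2 * eta * saw t.
Proof.
move=> /andP[e0 e1]; rewrite /saw /bern; have := frac_floorE t.
have := frac_itv t; set u := frac t; set m := Num.floor t => /andP[u0 u1] tE; clearbody u m.
have [h|h] := ltrP (u + eta) 1.
  rewrite (@fracE (t + eta) (u + eta) m); [| lra | by rewrite tE; ring].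
  by rewrite le_eqVlt; apply/orP; left; apply/eqP; field.
rewrite (@fracE (t + eta) (u + eta - 1) (m + 1)); [| lra | by rewrite tE intrD; ring].
rewrite -subr_ge0.
have -> : 2 * eta * (u - 1 / 2) - ((u + eta - 1) ^+ 2 - (u + eta - 1) -
    (u ^+ 2 - u) - eta ^+ 2) = 2 * (u + eta - 1) by field.
by rewrite mulr_ge0// subr_ge0.
Qed.

Lemma fejer_kernel n t :
  (n.+1%:R + 2 * \sum_(i < n) (n.+1%:R - i.+1%:R) * cos (2 * pi * (i.+1%:R * t)))
    * sin (pi * t) ^+ 2 = sin (pi * (n.+1%:R * t)) ^+ 2.
Proof.
have dirichlet m : (1 + 2 * \sum_(i < m) cos (2 * pi * (i.+1%:R * t))) * sin (pi * t)
    = sin (pi * ((2 * m%:R + 1) * t)).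
  elim: m => [|m IH]; first by rewrite big_ord0 !mulr0 addr0 add0r !mul1r.
  rewrite big_ord_recr/= mulrDr addrA mulrDl IH.
  rewrite -[m.+1]addn1 natrD.
  set a := pi * t; set b := 2 * pi * ((m%:R + 1) * t).
  have -> : pi * ((2 * m%:R + 1) * t) = b - a by rewrite /a /b; ring.
  have -> : pi * ((2 * (m%:R + 1) + 1) * t) = b + a by rewrite /a /b; ring.
  by rewrite sinB sinD; ring.
elim: n => [|n IH]; first by rewrite big_ord0 mulr0 addr0 !mul1r.
have -> : n.+2%:R + 2 * (\sum_(i < n.+1) (n.+2%:R - i.+1%:R) * cos (2 * pi * (i.+1%:R * t)))
 = (n.+1%:R + 2 * \sum_(i < n) (n.+1%:R - i.+1%:R) * cos (2 * pi * (i.+1%:R * t)))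
   + (1 + 2 * \sum_(i < n.+1) cos (2 * pi * (i.+1%:R * t))).
  have -> : \sum_(i < n.+1) (n.+2%:R - i.+1%:R) * cos (2 * pi * (i.+1%:R * t)) =
    \sum_(i < n.+1) (n.+1%:R - i.+1%:R) * cos (2 * pi * (i.+1%:R * t)) +
    \sum_(i < n.+1) cos (2 * pi * (i.+1%:R * t)) :> R.
    rewrite -big_split/=; apply: eq_bigr => i _.
    by rewrite -[n.+2]addn1 natrD; ring.
  rewrite big_ord_recr/= subrr mul0r addr0 -[n.+2]addn1 natrD; ring.
rewrite mulrDl IH expr2 [X in _ + X]mulrA dirichlet.
rewrite -[n.+2]addn1 natrD -[n.+1]addn1 natrD.
set a := pi * t; set b := pi * ((n%:R + 1) * t).
have -> : pi * ((2 * (n%:R + 1) + 1) * t) = b *+ 2 + a by rewrite /a /b mulr2n; ring.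
have -> : pi * ((n%:R + 1 + 1) * t) = b + a by rewrite /a /b; ring.
rewrite (sinD (b *+ 2) a) (sinD b a) sin_mulr2n cos_mulr2n !mulr2n.
have := cos2Dsin2 a; have := cos2Dsin2 b.
set sa := sin a; set ca := cos a; set sb := sin b; set cb := cos b => e1 e2.
have c1 : cb ^+ 2 = 1 - sb ^+ 2 by rewrite -e1 addrK.
have -> : sb ^+ 2 + ((cb * sb + cb * sb) * ca + (cb ^+ 2 + cb ^+ 2 - 1) * sa) * sa
  = (sb * ca + cb * sa) ^+ 2 + sb ^+ 2 * (1 - (ca ^+ 2 + sa ^+ 2)) 
    + (cb ^+ 2 + sb ^+ 2 - 1) * sa ^+ 2 by ring.
by rewrite e1 e2 !subrr mulr0 mul0r !addr0.
Qed.

Lemma mvt_exists (f df : R -> R) a b : a < b ->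
  (forall z, a <= z <= b -> is_derive z 1 f (df z)) ->
  exists2 c, a < c < b & f b - f a = df c * (b - a).
Proof.
move=> ab hd; have [z|z|c hc e] := @MVT R f df a b ab.
- by rewrite in_itv/= => /andP[z1 z2]; apply: hd; rewrite !ltW.
- apply: derivable_within_continuous => y; rewrite in_itv/= => hy.
  exact: (@ex_derive _ _ _ _ _ _ _ (hd y hy)).
- by exists c => //; move: hc; rewrite in_itv.
Qed.

Lemma is_derive_cosl k z : is_derive z 1 (fun t => cos (k * t)) (- k * sin (k * z)).
Proof.
have h : is_derive z 1 (fun t => k * t) k.
  by apply: is_derive_eq; rewrite /GRing.scale/= mulr1.
have := @is_derive1_comp R cos (fun t => k * t) z _ _ (is_derive_cos _) h.
by rewrite mulNr mulrC -mulNr.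
Qed.

Lemma is_derive_sinl k z : is_derive z 1 (fun t => sin (k * t)) (k * cos (k * z)).
Proof.
have h : is_derive z 1 (fun t => k * t) k.
  by apply: is_derive_eq; rewrite /GRing.scale/= mulr1.
have := @is_derive1_comp R sin (fun t => k * t) z _ _ (is_derive_sin _) h.
by rewrite mulrC.
Qed.

Lemma is_derive_bigsum n (F dF : 'I_n -> R -> R) z :
  (forall i, is_derive z 1 (F i) (dF i z)) ->
  is_derive z 1 (fun t => \sum_(i < n) F i t) (\sum_(i < n) dF i z).
Proof.
move=> h; have := is_derive_sum h.
by have -> : \sum_(i < n) F i = (fun t => \sum_(i < n) F i t)
  by apply/funext => t; rewrite fct_sumE.
Qed.

(* The Fejer mean of the Fourier series of [bern], up to an additive constant. *)
Definition bern_poly n t : R :=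
  \sum_(i < n) (1 - i.+1%:R / n.+1%:R) / (pi ^+ 2 * i.+1%:R ^+ 2) * cos (2 * pi * i.+1%:R * t).

Let P1 n t : R :=
  \sum_(i < n) (1 - i.+1%:R / n.+1%:R) * - 2 / (pi * i.+1%:R) * sin (2 * pi * i.+1%:R * t).

Let P2 n t : R :=
  \sum_(i < n) (1 - i.+1%:R / n.+1%:R) * - 4 * cos (2 * pi * i.+1%:R * t).

Let dP n z : is_derive z 1 (bern_poly n) (P1 n z).
Proof.
apply: (is_derive_bigsum (dF := fun (i : 'I_n) z =>
  (1 - i.+1%:R / n.+1%:R) * - 2 / (pi * i.+1%:R) * sin (2 * pi * i.+1%:R * z))) => i.
have h := is_derive_cosl (2 * pi * i.+1%:R) z.
have p0 : pi != 0 :> R by rewrite gt_eqF// pi_gt0.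
have a0 : i.+1%:R != 0 :> R by rewrite pnatr_eq0.
have b0 : n.+1%:R != 0 :> R by rewrite pnatr_eq0.
apply: is_derive_eq; rewrite /GRing.scale/=; clear h.
move: (i.+1%:R) (n.+1%:R) (pi : R) a0 b0 p0 => a b p a0 b0 p0.
by field; rewrite ?a0 ?b0 ?p0.
Qed.

Let dP1 n z : is_derive z 1 (P1 n) (P2 n z).
Proof.
apply: (is_derive_bigsum (dF := fun (i : 'I_n) z =>
  (1 - i.+1%:R / n.+1%:R) * - 4 * cos (2 * pi * i.+1%:R * z))) => i.
have h := is_derive_sinl (2 * pi * i.+1%:R) z.
have p0 : pi != 0 :> R by rewrite gt_eqF// pi_gt0.
have a0 : i.+1%:R != 0 :> R by rewrite pnatr_eq0.
have b0 : n.+1%:R != 0 :> R by rewrite pnatr_eq0.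
apply: is_derive_eq; rewrite /GRing.scale/=; clear h.
move: (i.+1%:R) (n.+1%:R) (pi : R) a0 b0 p0 => a b p a0 b0 p0.
by field; rewrite ?a0 ?b0 ?p0.
Qed.

Let G n t := t ^+ 2 - t - bern_poly n t.
Let G1 n t := 2 * t - 1 - P1 n t.
Let G2 n t := 2 - P2 n t.

Let dG n z : is_derive z 1 (G n) (G1 n z).
Proof.
have h := dP n z.
by apply: is_derive_eq; rewrite /GRing.scale/= /G1; ring.
Qed.

Let dG1 n z : is_derive z 1 (G1 n) (G2 n z).
Proof.
have h := dP1 n z.
by apply: is_derive_eq; rewrite /GRing.scale/= /G2; ring.
Qed.

Let G2E n t : n.+1%:R * sin (pi * t) ^+ 2 * G2 n t = 2 * sin (pi * (n.+1%:R * t)) ^+ 2.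
Proof.
rewrite -fejer_kernel mulrAC [RHS]mulrA; congr (_ * _).
have n0 : n.+1%:R != 0 :> R by rewrite pnatr_eq0.
rewrite /G2 /P2.
have -> : \sum_(i < n) (1 - i.+1%:R / n.+1%:R) * -4 * cos (2 * pi * i.+1%:R * t) =
  (- 4 / n.+1%:R) * \sum_(i < n) (n.+1%:R - i.+1%:R) * cos (2 * pi * (i.+1%:R * t)).
  rewrite mulr_sumr; apply: eq_bigr => i _; rewrite -[2 * pi * i.+1%:R * t]mulrA.
  set b := cos _; set a := n.+1%:R in n0 *; set c := i.+1%:R; clearbody a b c; by field.
by set b := \sum_(_ < _) _; set a := n.+1%:R in n0 *; clearbody a b; field.
Qed.

Let G2_ge0 n t : 0 < t < 1 / 2 -> 0 <= G2 n t.
Proof.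
move=> /andP[t0 t1].
have ts : t <= sin (pi * t) by apply: sin_pi_ge; rewrite (ltW t0) (ltW t1).
have s0 : 0 < sin (pi * t) by apply: lt_le_trans ts.
have q0 : 0 < n.+1%:R * sin (pi * t) ^+ 2 by rewrite mulr_gt0 ?ltr0n ?exprn_gt0.
by rewrite -(pmulr_rge0 _ q0) G2E mulr_ge0// sqr_ge0.
Qed.

Let G2_le n t : 0 < t < 1 / 2 -> G2 n t <= 2 / n.+1%:R / t ^+ 2.
Proof.
move=> /andP[t0 t1].
have ts : t <= sin (pi * t) by apply: sin_pi_ge; rewrite (ltW t0) (ltW t1).
have s0 : 0 < sin (pi * t) by apply: lt_le_trans ts.
have q0 : 0 < n.+1%:R * sin (pi * t) ^+ 2 by rewrite mulr_gt0 ?ltr0n ?exprn_gt0.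
rewrite -(ler_pM2l q0) G2E.
have -> : n.+1%:R * sin (pi * t) ^+ 2 * (2 / n.+1%:R / t ^+ 2) =
  2 * (sin (pi * t) / t) ^+ 2.
  have n0 : n.+1%:R != 0 :> R by rewrite pnatr_eq0.
  have tn0 : t != 0 by rewrite gt_eqF.
  by set a := n.+1%:R in n0 *; set b := sin _; clearbody a b; field; rewrite ?n0 ?tn0.
rewrite ler_pM2l//; apply: (@le_trans _ _ 1).
  by have := cos2Dsin2 (pi * (n.+1%:R * t)); have := sqr_ge0 (cos (pi * (n.+1%:R * t))); lra.
by apply: exprn_ege1; rewrite ler_pdivlMr// mul1r.
Qed.

Let G1_half n : G1 n (1 / 2) = 0.
Proof.
rewrite /G1 /P1 big1 ?subr0; first by field.
move=> i _; have -> : 2 * pi * i.+1%:R * (1 / 2) = 0 + pi *+ i.+1 :> R.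
  by rewrite add0r -[RHS]mulr_natr; field.
by rewrite (alternatingn (@sinDpi R)) sin0 !mulr0.
Qed.

Let G1_0 n : G1 n 0 = - 1.
Proof.
rewrite /G1 /P1 big1 ?subr0 ?mulr0 ?sub0r// => i _.
by rewrite mulr0 sin0 mulr0.
Qed.

Let G1_le0 n u : 0 < u < 1 / 2 -> G1 n u <= 0.
Proof.
move=> /andP[u0 u1].
have [c hc e] := @mvt_exists (G1 n) (G2 n) u (1 / 2) u1 (fun z _ => dG1 n z).
have : 0 <= G2 n c by apply: G2_ge0; lra.
by rewrite G1_half in e; nra.
Qed.

Let G1_geN1 n u : 0 < u < 1 / 2 -> - 1 <= G1 n u.
Proof.
move=> /andP[u0 u1].
have [c hc e] := @mvt_exists (G1 n) (G2 n) 0 u u0 (fun z _ => dG1 n z).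
have : 0 <= G2 n c by apply: G2_ge0; lra.
by rewrite G1_0 in e; nra.
Qed.

(* By [G2_le] the function [t |-> G1 n t + (2 / n.+1) / t] is nonincreasing. *)
Let G1_ge n u : 0 < u < 1 / 2 -> - (2 / n.+1%:R / u) <= G1 n u.
Proof.
move=> /andP[u0 u1]; set k := 2 / n.+1%:R.
have k0 : 0 <= k by rewrite divr_ge0.
have [z hz|c hc e] := @mvt_exists (fun t => G1 n t + k * t^-1)
    (fun t => G2 n t + k * - t ^- 2) u (1 / 2) u1.
  have h := dG1 n z; have z0 : z != 0 by rewrite gt_eqF//; lra.
  have h2 : is_derive z 1 (fun t : R => t^-1) (- z ^- 2).
    by have := @is_deriveV R id z 1 1 z0 (is_derive_id _ _); rewrite /GRing.scale/= mulr1.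
  by apply: is_derive_eq; rewrite /GRing.scale.
have h1 : G2 n c <= k / c ^+ 2 by apply: G2_le; lra.
rewrite /= G1_half add0r in e.
have h2 : (G2 n c + k * - c ^- 2) * (1 / 2 - u) <= 0.
  by apply: mulr_le0_ge0; lra.
have h3 : 0 <= k * (1 / 2)^-1 by rewrite mulr_ge0// invr_ge0; lra.
by rewrite -mulrA in h1 *; lra.
Qed.

Let G_half n u : 0 <= u <= 1 / 2 -> `|G n u - G n (1 / 2)| <= 3 / Num.sqrt n.+1%:R.
Proof.
move=> /andP[u0 u1]; set s := Num.sqrt _.
have s1 : 1 <= s by rewrite -sqrtr1; apply: ler_wsqrtr; rewrite ler1n.
have ss : s * s = n.+1%:R by rewrite -expr2 sqr_sqrtr.
have s0 : 0 < s by lra.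
pose t0 := s^-1 / 2.
have t00 : 0 < t0 by rewrite divr_gt0 ?invr_gt0.
have t01 : t0 <= 1 / 2 by rewrite /t0 ler_pM2r// invf_le1.
have far v : t0 <= v <= 1 / 2 -> `|G n v - G n (1 / 2)| <= 2 / s.
  move=> /andP[v0 v1].
  have [->|vn] := eqVneq v (1 / 2); first by rewrite subrr normr0 divr_ge0// ltW.
  have v2 : v < 1 / 2 by rewrite lt_neqAle vn.
  have [c /andP[c1 c2] e] := @mvt_exists (G n) (G1 n) v (1 / 2) v2 (fun z _ => dG n z).
  have h1 : G1 n c <= 0 by apply: G1_le0; lra.
  have h2 : - (2 / n.+1%:R / c) <= G1 n c by apply: G1_ge; lra.
  have h3 : 2 / n.+1%:R / c <= 4 / s.
    have -> : 4 / s = 2 / n.+1%:R / t0.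
      by rewrite -ss /t0; field; rewrite gt_eqF.
    by rewrite ler_pM2l ?divr_gt0// lef_pV2 ?posrE; lra.
  rewrite distrC e normrM.
  have -> : 2 / s = 4 / s * (1 / 2) by field; rewrite gt_eqF.
  have q0 : 0 <= 4 / s by rewrite divr_ge0// ltW.
  have h4 : - (4 / s) <= G1 n c by apply: le_trans h2; rewrite lerN2.
  apply: ler_pM => //; rewrite ler_norml; apply/andP; split; try lra.
have [tu|ut] := lerP t0 u.
  apply: le_trans (far u _) _; first by rewrite tu.
  have sV : 0 < s^-1 by rewrite invr_gt0.
  lra.
have [c /andP[c1 c2] e] := @mvt_exists (G n) (G1 n) u t0 ut (fun z _ => dG n z).
have h1 : G1 n c <= 0 by apply: G1_le0; lra.
have h2 : - 1 <= G1 n c by apply: G1_geN1; lra.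
have h3 := far t0; rewrite lexx t01 in h3; have {}h3 := h3 isT.
have -> : G n u - G n (1 / 2) = (G n t0 - G n (1 / 2)) - (G n t0 - G n u) by ring.
apply: (le_trans (ler_normB _ _)).
have h4 : `|G n t0 - G n u| <= 1 * t0.
  by rewrite e normrM; apply: ler_pM => //; rewrite ler_norml; apply/andP; split; lra.
have sV : 0 < s^-1 by rewrite invr_gt0.
have t0E : t0 = s^-1 / 2 by [].
by apply: le_trans (lerD h3 h4) _; rewrite t0E; lra.
Qed.

Let bern_poly_frac n t : bern_poly n t = bern_poly n (frac t).
Proof.
apply: eq_bigr => i _; congr (_ * _).
rewrite -[2 * pi * i.+1%:R * frac t]mulrA -(cos2piDz _ (i.+1%:Z * Num.floor t)).
by rewrite intrM -pmulrn /frac; congr cos; ring.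
Qed.

Let bern_poly_sym n t : bern_poly n (1 - t) = bern_poly n t.
Proof.
apply: eq_bigr => i _; congr (_ * _).
have -> : 2 * pi * i.+1%:R * (1 - t) = - (2 * pi * (i.+1%:R * t + (- i.+1%:Z)%:~R)) :> R.
  by rewrite mulrNz -pmulrn; ring.
by rewrite cosN cos2piDz; congr cos; ring.
Qed.

(* The difference [G n] of [bern] and its Fejer mean has second derivative twice the
   Fejer kernel: it is convex on [0, 1], with slope [0] at [1 / 2] and [-1] at [0]. *)
Lemma bern_approx n t (c := (1 / 2) ^+ 2 - 1 / 2 - bern_poly n (1 / 2)) :
  `|bern t - bern_poly n t - c| <= 3 / Num.sqrt n.+1%:R.
Proof.
rewrite /bern bern_poly_frac; have /andP[] := frac_itv t.
set u := frac t => u0 u1.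
have [h|h] := lerP u (1 / 2); first by apply: (@G_half n u); rewrite u0.
have := @G_half n (1 - u) ltac:(apply/andP; split; lra).
rewrite /G bern_poly_sym.
by have -> : (1 - u) ^+ 2 - (1 - u) = u ^+ 2 - u by ring.
Qed.

End sawtooth.

Section saw_sum.
Context {R : realType}.
Implicit Types (t eta s a : R) (w y : nat -> R) (r : seq nat) (n : nat).

Lemma sin_le t : 0 <= t -> sin t <= t.
Proof.
move=> t0; have [->|tn0] := eqVneq t 0; first by rewrite sin0.
have tp : 0 < t by rewrite lt_neqAle eq_sym tn0.
have [c _] := @mvt_exists R sin cos 0 t tp (fun z _ => is_derive_sin z).
rewrite sin0 !subr0 => ->; rewrite -[leRHS]mul1r ler_wpM2r//; exact: cos_le1.
Qed.

Definition saw_weight eta (h : nat) : R := Num.min h%:R^-1 (eta * h%:R ^+ 2)^-1.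

Lemma norm_sin_saw_weight eta (h : nat) : 0 < eta -> (0 < h)%N ->
  `|sin (pi * h%:R * eta)| / (pi ^+ 2 * h%:R ^+ 2) <= eta * saw_weight eta h.
Proof.
move=> e0 h0; have hp : 0 < h%:R :> R by rewrite ltr0n.
have p2 : 2 <= pi :> R := pi_ge2 R.
have p0 : 0 < pi :> R := pi_gt0 R.
rewrite /saw_weight minr_pMr ?(ltW e0)// le_min ler_pdivrMr ?mulr_gt0 ?exprn_gt0//.
rewrite ler_pdivrMr ?mulr_gt0 ?exprn_gt0//.
apply/andP; split; last first.
  have -> : eta * (eta * h%:R ^+ 2)^-1 * (pi ^+ 2 * h%:R ^+ 2) = pi ^+ 2.
    by move: (pi : R) => p; field; rewrite !gt_eqF.
  by apply: (le_trans (sin_max _)); rewrite expr2; nra.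
have -> : eta / h%:R * (pi ^+ 2 * h%:R ^+ 2) = pi * (pi * h%:R * eta).
  by move: (pi : R) => p; field; rewrite !gt_eqF.
have t0 : 0 <= pi * h%:R * eta by rewrite !mulr_ge0// ltW.
apply: (@le_trans _ _ (pi * h%:R * eta)); last by nra.
rewrite ler_norml sin_le// andbT lerNl -sinN.
have [h1|h1] := lerP (pi * h%:R * eta) pi.
  have : 0 <= sin (pi * h%:R * eta) by apply: sin_ge0_pi; rewrite t0.
  by rewrite sinN; lra.
by apply: (le_trans (sin_le1 _)); lra.
Qed.

Lemma bern_poly_shift_sum w y r n eta s (B : R) : 0 < eta ->
  (forall al : nat -> R, \sum_(i < n) saw_weight eta i.+1 *
     `|\sum_(d <- r) w d * cos (2 * pi * i.+1%:R * y d + al i.+1)| <= B) ->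
  `|\sum_(d <- r) w d * (bern_poly n (y d + s + eta) - bern_poly n (y d + s))|
    <= 2 * eta * B.
Proof.
move=> e0 hB.
pose al (h : nat) : R := 2 * pi * h%:R * s + pi * h%:R * eta - pi / 2.
pose ka (i : nat) : R := (1 - i.+1%:R / n.+1%:R) / (pi ^+ 2 * i.+1%:R ^+ 2).
have -> : \sum_(d <- r) w d * (bern_poly n (y d + s + eta) - bern_poly n (y d + s)) =
   \sum_(i < n) - (2 * ka i * sin (pi * i.+1%:R * eta)) *
     \sum_(d <- r) w d * cos (2 * pi * i.+1%:R * y d + al i.+1).
  under [RHS]eq_bigr do rewrite mulr_sumr.
  rewrite exchange_big/=; apply: eq_bigr => d _.
  rewrite /bern_poly -sumrB mulr_sumr; apply: eq_bigr => i _.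
  rewrite -/(ka i) /al addrA cosBpihalf.
  set a := pi * i.+1%:R * eta.
  set b := 2 * pi * i.+1%:R * y d + _.
  have -> : 2 * pi * i.+1%:R * (y d + s + eta) = b + a by rewrite /b /a; ring.
  have -> : 2 * pi * i.+1%:R * (y d + s) = b - a by rewrite /b /a; ring.
  by rewrite cosD cosB; ring.
apply: (le_trans (ler_norm_sum _ _ _)).
apply: (@le_trans _ _ (2 * eta * \sum_(i < n) saw_weight eta i.+1 *
     `|\sum_(d <- r) w d * cos (2 * pi * i.+1%:R * y d + al i.+1)|)); last first.
  by rewrite ler_wpM2l ?mulr_ge0 ?(ltW e0).
rewrite mulr_sumr; apply: ler_sum => i _.
rewrite normrM mulrA ler_wpM2r// normrN.
have p0 : 0 < pi ^+ 2 * i.+1%:R ^+ 2 :> R.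
  by rewrite mulr_gt0// exprn_gt0// ?pi_gt0.
have k0 : 0 <= 1 - (i.+1%:R / n.+1%:R : R) <= 1.
  rewrite subr_ge0 gerBl ?divr_ge0// andbT ler_pdivrMr// mul1r ler_nat.
  exact: leqW.
rewrite -[leRHS]mulrA -[2 * ka i * _]mulrA normrM ger0_norm// ler_wpM2l//.
apply: le_trans (norm_sin_saw_weight e0 _) => //.
rewrite normrM /ka normrM (ger0_norm (_ : 0 <= 1 - _)); last by case/andP: k0.
rewrite gtr0_norm ?invr_gt0// [leRHS]mulrC -mulrA -[leRHS]mul1r.
by apply: ler_wpM2r; [rewrite mulr_ge0// invr_ge0 ltW | case/andP: k0].
Qed.

Lemma saw_sum w y r n eta (B : R) : 0 < eta <= 1 -> (forall d, 0 <= w d) ->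
  (forall al : nat -> R, \sum_(i < n) saw_weight eta i.+1 *
     `|\sum_(d <- r) w d * cos (2 * pi * i.+1%:R * y d + al i.+1)| <= B) ->
  `|\sum_(d <- r) w d * saw (y d)| <=
     (eta / 2 + 3 / (eta * Num.sqrt n.+1%:R)) * (\sum_(d <- r) w d) + B.
Proof.
move=> /andP[e0 e1] w0 hB.
pose c : R := (1 / 2) ^+ 2 - 1 / 2 - bern_poly n (1 / 2).
set s := Num.sqrt _.
have s0 : 0 < s by rewrite sqrtr_gt0.
have ba (t : R) : `|bern t - bern_poly n t - c| <= 3 / s := bern_approx n t.
have diff (t u : R) : bern t - bern u <= bern_poly n t - bern_poly n u + 6 / s.
  have := ba t; have := ba u; rewrite !ler_norml => /andP[h1 h2] /andP[h3 h4]; lra.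
set W := \sum_(d <- r) w d.
have e2 : 0 < 2 * eta by rewrite mulr_gt0.
have up : 2 * eta * \sum_(d <- r) w d * saw (y d) <=
   2 * eta * B + (6 / s + eta ^+ 2) * W.
  have := @bern_poly_shift_sum w y r n eta (- eta) B e0 hB.
  rewrite ler_norml => /andP[_ h]; apply: le_trans (lerD h (lexx _)).
  rewrite /W !mulr_sumr -big_split/=; apply: ler_sum => d _.
  rewrite mulrCA [(6 / s + _) * _]mulrC -mulrDr ler_wpM2l//.
  have := @saw_le R (y d) eta; rewrite e0 e1 => /(_ isT).
  by have := diff (y d) (y d - eta); rewrite subrK; lra.
have dn : - (2 * eta * B + (6 / s + eta ^+ 2) * W) <=
   2 * eta * \sum_(d <- r) w d * saw (y d).
  have := @bern_poly_shift_sum w y r n eta 0 B e0 hB.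
  rewrite ler_norml lerNl => /andP[h _].
  rewrite lerNl; apply: le_trans (lerD h (lexx _)).
  rewrite /W !mulr_sumr -!sumrN -big_split/=; apply: ler_sum => d _.
  rewrite mulrCA [(6 / s + _) * _]mulrC -!mulrN -mulrDr ler_wpM2l//.
  have := @saw_ge R (y d) eta; rewrite e0 e1 => /(_ isT).
  by have := diff (y d) (y d + eta); rewrite addr0; lra.
have -> : (eta / 2 + 3 / (eta * s)) * W + B =
   (2 * eta * B + (6 / s + eta ^+ 2) * W) / (2 * eta).
  by field; rewrite !gt_eqF.
rewrite ler_norml -mulNr ler_pdivrMr// ler_pdivlMr//.
by rewrite [_ * (2 * eta)]mulrC up dn.
Qed.

End saw_sum.

(** * Divisor functions and Vaughan's identity *)

Section divisor_count.
Local Open Scope nat_scope.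

Definition tau (n : nat) : nat := size (divisors n).

Lemma tau_prime_mul p m : prime p -> 0 < m -> tau (p * m) <= 2 * tau m.
Proof.
move=> pp m0; have p0 := prime_gt0 pp.
rewrite /tau mul2n -addnn -{2}(size_map (muln p) (divisors m)) -size_cat.
apply: uniq_leq_size; first exact: divisors_uniq.
move=> d; rewrite -dvdn_divisors ?muln_gt0 ?p0// mem_cat -dvdn_divisors// => dn.
have [pd|npd] := boolP (p %| d).
  apply/orP; right; apply/mapP; exists (d %/ p); last by rewrite mulnC divnK.
  by rewrite -dvdn_divisors// -(dvdn_pmul2l p0) mulnC divnK.
by rewrite -(Gauss_dvdr m (_ : coprime d p)) ?dn// coprime_sym prime_coprime.
Qed.

Lemma tau_primepow_mul p e m : prime p -> 0 < m -> ~~ (p %| m) ->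
  tau (p ^ e * m) <= e.+1 * tau m.
Proof.
move=> pp m0 pm; have p0 := prime_gt0 pp.
rewrite /tau -[e.+1](size_iota 0) -(size_allpairs (fun i d => p ^ i * d)).
apply: uniq_leq_size; first exact: divisors_uniq.
have n0 : 0 < p ^ e * m by rewrite muln_gt0 expn_gt0 p0.
move=> d; rewrite -dvdn_divisors// => dn.
have d0 : 0 < d := dvdn_gt0 n0 dn.
have [q cpq dE] := pfactor_coprime pp d0.
have pmc : coprime m (p ^ logn p d) by rewrite coprime_sym coprimeXl// prime_coprime.
apply/allpairsP; exists (logn p d, q); split; last by rewrite /= mulnC.
- rewrite -[(_, _).1]/(logn p d) mem_iota add0n ltnS.
  have := dvdn_leq_log p n0 dn; rewrite lognM ?expn_gt0 ?p0// pfactorK//.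
  by rewrite (lognE p m) (negPf pm) !andbF addn0.
- rewrite -dvdn_divisors//=.
  have : q %| p ^ e * m by apply: dvdn_trans dn; rewrite [X in _ %| X]dE dvdn_mulr.
  by rewrite Gauss_dvdr// coprime_sym coprimeXl.
Qed.

Lemma tau_rough k n : 0 < n -> (forall p, prime p -> p %| n -> 2 ^ k <= p) ->
  tau n ^ k <= n.
Proof.
elim/ltn_ind: n => n IH n0 hp.
have [n1|n1] := leqP n 1; first by have -> : n = 1 by [lia]; rewrite (_ : tau 1 = 1) ?exp1n.
have pp := pdiv_prime n1; set p := pdiv n in pp.
have pn : p %| n by apply: pdiv_dvd.
have nE : n = p * (n %/ p) by rewrite mulnC divnK.
have m0 : 0 < n %/ p by rewrite divn_gt0 ?prime_gt0// dvdn_leq.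
have mn : n %/ p < n by rewrite ltn_Pdiv ?prime_gt1.
have h : tau (n %/ p) ^ k <= n %/ p.
  apply: IH => // q qp qm; apply: hp => //; rewrite nE; exact: dvdn_mull.
rewrite nE; apply: (@leq_trans ((2 * tau (n %/ p)) ^ k)).
  by case: (k) => // k'; rewrite leq_exp2r// tau_prime_mul.
by rewrite expnMn leq_mul// hp.
Qed.

(* Primes [p >= 2 ^ k] at most double [tau], which costs [2 ^ k <= p] in [tau n ^ k <= n];
   each of the primes below [2 ^ k] contributes a factor at most [L]. *)
Lemma tau_bound_aux k L j n : 0 < n -> n < 2 ^ L ->
  (forall p, prime p -> p %| n -> 2 ^ k <= p + j) ->
  tau n ^ k <= (L ^ j) ^ k * n.
Proof.
elim: j n => [|j IH] n n0 nL hp.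
  rewrite expn0 exp1n mul1n; apply: tau_rough => // p pp pn.
  by have := hp p pp pn; rewrite addn0.
have L0 : 0 < L by case: (L) nL => //; rewrite expn0; lia.
have Lk : (L ^ j) ^ k <= (L ^ j.+1) ^ k.
  by case: (k) => // k'; rewrite leq_exp2r// leq_pexp2l.
pose q := 2 ^ k - j.+1.
have other p : prime p -> p %| n -> p != q -> 2 ^ k <= p + j.
  move=> pp pn pq; have := hp p pp pn; have := prime_gt0 pp.
  move: pq; rewrite /q; lia.
have [/andP[pq qn]|hq] := boolP (prime q && (q %| n)); last first.
  apply: (@leq_trans ((L ^ j) ^ k * n)); last by rewrite leq_mul2r Lk orbT.
  apply: IH => // p pp pn; apply: other => //.
  by apply: contra hq => /eqP <-; rewrite pp.
have [m cqm nE] := pfactor_coprime pq n0.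
set e := logn q n in nE.
have m0 : 0 < m by move: n0; rewrite nE muln_gt0 => /andP[].
have qe : 0 < q ^ e by rewrite expn_gt0 prime_gt0.
have mn : m <= n by rewrite nE leq_pmulr.
have eL : e.+1 <= L.
  have : 2 ^ e < 2 ^ L.
    apply: leq_ltn_trans nL; apply: (@leq_trans (q ^ e)).
      by case: (e) => // e'; rewrite leq_exp2r// prime_gt1.
    by rewrite nE leq_pmull.
  by rewrite ltn_exp2l.
have h1 : tau n <= L * tau m.
  rewrite {1}nE mulnC; apply: (@leq_trans (e.+1 * tau m)).
    by apply: tau_primepow_mul => //; rewrite -prime_coprime.
  by rewrite leq_mul2r eL orbT.
have h2 : tau m ^ k <= (L ^ j) ^ k * m.
  apply: IH => //; first exact: leq_ltn_trans nL.
  move=> p pp pm; apply: other => //; first by rewrite nE dvdn_mulr.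
  apply: contraTneq pm => ->.
  by rewrite -prime_coprime.
apply: (@leq_trans ((L * tau m) ^ k)).
  by case: (k) => // k'; rewrite leq_exp2r.
rewrite expnMn expnS expnMn -mulnA leq_mul2l; apply/orP; right.
by apply: leq_trans h2 _; rewrite leq_mul2l mn orbT.
Qed.

Lemma tau_bound k L n : 0 < n -> n < 2 ^ L -> tau n ^ k <= (L ^ (2 ^ k)) ^ k * n.
Proof. by move=> n0 nL; apply: tau_bound_aux => // p _ _; rewrite leq_addl. Qed.

End divisor_count.

Section divisor_sums.
Context {R : realType}.
Implicit Types (n p m d : nat) (F u : nat -> R).

Definition moebius n : R :=
  if all (fun p => logn p n == 1%N) (primes n) then (-1) ^+ size (primes n) else 0.

Lemma norm_moebius_le1 n : `|moebius n| <= 1.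
Proof. by rewrite /moebius; case: ifP; rewrite ?normrX ?normrN1 ?expr1n ?normr0. Qed.

Lemma moebius_prime_mul p m : prime p -> (0 < m)%N ->
  moebius (p * m) = if (p %| m)%N then 0 else - moebius m.
Proof.
move=> pp m0; have p0 := prime_gt0 pp.
have lE q : prime q -> logn q (p * m) = ((q == p) + logn q m)%N.
  by move=> qp; rewrite lognM// (logn_prime q pp) eq_sym.
case: ifPn => pm.
  rewrite /moebius ifF//; apply/negP => /allP /(_ p).
  rewrite primesM// !mem_primes pp m0 pm orbT => /(_ isT).
  rewrite lE// eqxx; have : (0 < logn p m)%N by rewrite logn_gt0 mem_primes pp m0.
  by case: (logn p m).
have pr : perm_eq (primes (p * m)) (p :: primes m).
  apply: uniq_perm; rewrite ?primes_uniq//=.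
    by rewrite primes_uniq mem_primes (negPf pm) !andbF.
  by move=> q; rewrite primesM// in_cons primes_prime// inE.
rewrite /moebius (perm_all _ pr) (perm_size pr) /= exprS mulN1r.
rewrite lE// eqxx (lognE p m) (negPf pm) !andbF addn0 eqxx/=.
rewrite (_ : all _ (primes m) = all (fun q => logn q m == 1%N) (primes m)).
  by case: ifP => //; rewrite oppr0.
apply: eq_in_all => q; rewrite mem_primes => /and3P[qp _ qm].
by rewrite lE//; case: (eqVneq q p) qm => // ->; rewrite (negPf pm).
Qed.

Lemma sum_moebius n : (0 < n)%N ->
  \sum_(d <- divisors n) moebius d = (n == 1)%:R :> R.
Proof.
move=> n0; have [->|n1] := eqVneq n 1%N.
  by rewrite big_cons big_nil addr0 /moebius/=.
have n2 : (1 < n)%N by lia.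
have pp := pdiv_prime n2; set p := pdiv n in pp.
have p0 := prime_gt0 pp.
have pn : (p %| n)%N by apply: pdiv_dvd.
pose m := (n %/ p)%N; have nE : n = (p * m)%N by rewrite mulnC divnK.
have m0 : (0 < m)%N by rewrite divn_gt0// dvdn_leq.
rewrite (bigID (fun d => p %| d)%N)/=.
have -> : \sum_(d <- divisors n | (p %| d)%N) moebius d =
    \sum_(d <- divisors m) moebius (p * d).
  rewrite -big_filter -(big_map (muln p) xpredT moebius).
  apply: perm_big; apply: uniq_perm.
  - by rewrite filter_uniq// divisors_uniq.
  - by rewrite map_inj_uniq ?divisors_uniq// => a b /eqP; rewrite eqn_pmul2l// => /eqP.
  move=> d; rewrite mem_filter -dvdn_divisors//; apply/andP/mapP => [[pd dn]|[e em ->]].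
    exists (d %/ p)%N; last by rewrite mulnC divnK.
    by rewrite -dvdn_divisors// -(dvdn_pmul2l p0) -nE mulnC divnK.
  by move: em; rewrite -dvdn_divisors// dvdn_mulr// nE dvdn_pmul2l.
have -> : \sum_(d <- divisors n | ~~ (p %| d)%N) moebius d =
    \sum_(d <- divisors m | ~~ (p %| d)%N) moebius d.
  rewrite -[LHS]big_filter -[RHS]big_filter; apply: perm_big; apply: uniq_perm;
    rewrite ?filter_uniq ?divisors_uniq// => d.
  rewrite !mem_filter -!dvdn_divisors//; case: (boolP (p %| d)%N) => //= pd.
  by rewrite nE Gauss_dvdr// coprime_sym prime_coprime.
rewrite [X in _ + X]big_mkcond/= -big_split/= big_seq big1// => d.
rewrite -dvdn_divisors// => dm; rewrite moebius_prime_mul//; last exact: dvdn_gt0 dm.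
by case: (p %| d)%N => /=; rewrite ?addr0 ?addNr.
Qed.

Lemma sum_vonMangoldt n : (0 < n)%N ->
  \sum_(d <- divisors n) vonMangoldt R d = ln n%:R.
Proof.
elim/ltn_ind: n => n IH n0; have [->|n1] := eqVneq n 1%N.
  by rewrite big_cons big_nil addr0 /vonMangoldt/= ln1.
have n2 : (1 < n)%N by lia.
have pp := pdiv_prime n2; set p := pdiv n in pp.
have p0 := prime_gt0 pp.
have pn : (p %| n)%N by apply: pdiv_dvd.
pose m := (n %/ p)%N; have nE : n = (p * m)%N by rewrite mulnC divnK.
have m0 : (0 < m)%N by rewrite divn_gt0// dvdn_leq.
have mn : (m < n)%N by rewrite ltn_Pdiv ?prime_gt1.
rewrite (bigID (fun d => d %| m)%N)/=.
have -> : \sum_(d <- divisors n | (d %| m)%N) vonMangoldt R d = ln m%:R.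
  rewrite -IH// -big_filter; apply: perm_big; apply: uniq_perm;
    rewrite ?filter_uniq ?divisors_uniq// => d.
  rewrite mem_filter -!dvdn_divisors//; case: (boolP (d %| m)%N) => //= dm.
  by rewrite nE dvdn_mull.
pose e := logn p n.
have e0 : (0 < e)%N by rewrite /e logn_gt0 mem_primes pp n0.
have em : logn p m = e.-1.
  have -> : e = logn p (p * m) by rewrite -nE.
  by rewrite lognM// (logn_prime p pp) eqxx.
have pen : (p ^ e %| n)%N by rewrite pfactor_dvdnn.
have pem : ~~ (p ^ e %| m)%N by rewrite pfactor_dvdn// em; lia.
have -> : \sum_(d <- divisors n | ~~ (d %| m)%N) vonMangoldt R d =
   \sum_(d <- divisors n | d == (p ^ e)%N) ln p%:R.
  rewrite [LHS]big_mkcond [RHS]big_mkcond/= [LHS]big_seq [RHS]big_seq.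
  apply: eq_bigr => d.
  rewrite -dvdn_divisors// => dn; have d0 := dvdn_gt0 n0 dn.
  case: eqP => [->|dpe]; first by rewrite pem vonMangoldtX.
  case: ifPn => // dm; apply: vonMangoldt_eq0 => q k qp k0 dE.
  have [qe|qp'] := eqVneq q p; last first.
    move: dm; rewrite -(Gauss_dvdr m (_ : coprime d p)) -?nE ?dn//.
    by rewrite dE coprimeXl// prime_coprime// dvdn_prime2.
  move: dm dn dpe; rewrite dE qe !pfactor_dvdn// em -/e => h1 h2 h3.
  by have : k = e by [lia]; move/(congr1 (expn p)).
rewrite big_const_seq count_uniq_mem ?divisors_uniq// -dvdn_divisors// pen/= addr0.
rewrite nE natrM lnM ?posrE ?ltr0n//; exact: addrC.
Qed.

Lemma sum_mul_divisors F u X : (forall n, (X <= n)%N -> F n = 0) ->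
  \sum_(1 <= a < X) \sum_(1 <= b < X) u a * F (a * b)%N =
  \sum_(1 <= n < X) (\sum_(d <- divisors n) u d) * F n.
Proof.
move=> F0.
have inner a : (0 < a)%N ->
    \sum_(1 <= b < X) F (a * b)%N = \sum_(1 <= n < X | (a %| n)%N) F n.
  move=> a0.
  have -> : \sum_(1 <= b < X) F (a * b)%N =
    \sum_(1 <= b < X) \sum_(1 <= n < X | n == (a * b)%N) F n.
    rewrite !big_seq; apply: eq_bigr => b; rewrite mem_index_iota => /andP[b0 bX].
    have [h|h] := ltnP (a * b) X; last first.
      rewrite F0// big1_seq// => n /andP[/eqP ->]; rewrite mem_index_iota; lia.
    rewrite -big_filter (_ : [seq _ <- _ | _] = [:: (a * b)%N]) ?big_seq1//.
    rewrite (filter_pred1_uniq (iota_uniq _ _))//.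
    by rewrite mem_index_iota muln_gt0 a0 b0.
  rewrite [RHS]big_mkcond/=.
  under eq_bigr do rewrite big_mkcond/=.
  rewrite exchange_big/= !big_seq; apply: eq_bigr => n; rewrite mem_index_iota => /andP[n0 nX].
  rewrite -big_mkcond/=; case: ifPn => an.
    rewrite -big_filter (_ : [seq _ <- _ | _] = [:: (n %/ a)%N]) ?big_seq1//.
    rewrite -(@filter_pred1_uniq _ (index_iota 1 X) (n %/ a)%N) ?iota_uniq//.
      apply: eq_filter => b /=; rewrite -{1}(divnK an) mulnC eqn_pmul2l// eq_sym//.
    rewrite mem_index_iota divn_gt0// dvdn_leq//=.
    by apply: leq_ltn_trans nX; exact: leq_div.
  by rewrite big1// => b /eqP e; move: an; rewrite e dvdn_mulr.
have -> : \sum_(1 <= a < X) \sum_(1 <= b < X) u a * F (a * b)%N =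
   \sum_(1 <= a < X) \sum_(1 <= n < X) (if (a %| n)%N then u a * F n else 0).
  rewrite !big_seq; apply: eq_bigr => a; rewrite mem_index_iota => /andP[a0 _].
  by rewrite -mulr_sumr inner// -big_mkcond/= mulr_sumr.
rewrite exchange_big/= !big_seq; apply: eq_bigr => n; rewrite mem_index_iota => /andP[n0 nX].
rewrite -big_mkcond/= mulr_suml -big_filter; apply: perm_big; apply: uniq_perm;
  rewrite ?filter_uniq ?divisors_uniq ?iota_uniq// => d.
rewrite mem_filter mem_index_iota -dvdn_divisors//; case: (boolP (d %| n)%N) => //= dn.
by rewrite (dvdn_gt0 n0 dn)/=; apply: leq_ltn_trans nX; exact: dvdn_leq.
Qed.

End divisor_sums.

Section vaughan.
Context {R : realType}.
Implicit Types (F : nat -> R) (U V X : nat).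

Definition moebius_le V (a : nat) : R := if (a <= V)%N then moebius a else 0.
Definition moebius_gt V (a : nat) : R := if (V < a)%N then moebius a else 0.
Definition moebius_tail V (m : nat) : R := \sum_(d <- divisors m) moebius_gt V d.

Lemma moebius_split V a : moebius a = moebius_le V a + moebius_gt V a.
Proof. by rewrite /moebius_le /moebius_gt; case: ltnP; rewrite ?addr0 ?add0r. Qed.

Lemma norm_moebius_tail V m : `|moebius_tail V m| <= (tau m)%:R.
Proof.
apply: (le_trans (ler_norm_sum _ _ _)).
rewrite /tau -sum1_size natr_sum; apply: ler_sum => d _.
by rewrite /moebius_gt; case: ifP; rewrite ?normr0// norm_moebius_le1.
Qed.

(* Expand [vonMangoldt] as [moebius * 1 * vonMangoldt], the sum over [n = a * b * c] with
   [moebius] at [a], and split according to [a <= V] and [c <= U]. *)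
Lemma vaughan F U V X : (forall n, (X <= n)%N -> F n = 0) ->
  (forall n, (n <= U)%N -> F n = 0) ->
  \sum_(1 <= n < X) vonMangoldt R n * F n =
    \sum_(1 <= a < X) moebius_le V a * (\sum_(1 <= b < X) ln b%:R * F (a * b)%N)
  - \sum_(1 <= c < X | (c <= U)%N) vonMangoldt R c *
      (\sum_(1 <= a < X) moebius_le V a * \sum_(1 <= b < X) F (c * (a * b))%N)
  + \sum_(1 <= c < X | (U < c)%N) vonMangoldt R c *
      (\sum_(1 <= m < X) moebius_tail V m * F (c * m)%N).
Proof.
move=> FX FU.
have FcX c n : (0 < c)%N -> (X <= n)%N -> F (c * n)%N = 0.
  by move=> c0 nX; apply: FX; apply: leq_trans nX _; exact: leq_pmull.
have SmuE c : (0 < c < X)%N ->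
    F c = \sum_(1 <= a < X) \sum_(1 <= b < X) moebius a * F (c * (a * b))%N.
  move=> /andP[c0 cX].
  rewrite (@sum_mul_divisors _ (fun n => F (c * n)%N) moebius X); last first.
    by move=> n; exact: FcX.
  rewrite big_ltn; last by lia.
  rewrite sum_moebius// eqxx mul1r muln1 big_seq big1 ?addr0// => n.
  rewrite mem_index_iota => /andP[n2 nX]; rewrite sum_moebius; last by lia.
  by rewrite (_ : n == 1%N = false) ?mul0r//; lia.
pose S V' c : R := \sum_(1 <= a < X) moebius_le V' a * \sum_(1 <= b < X) F (c * (a * b))%N.
have tailE c : (0 < c < X)%N -> \sum_(1 <= m < X) moebius_tail V m * F (c * m)%N = F c - S V c.
  move=> c0; rewrite -(@sum_mul_divisors _ (fun n => F (c * n)%N) (moebius_gt V) X); last first.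
    by move=> n; apply: FcX; case/andP: c0.
  rewrite (SmuE c c0) /S -sumrB; apply: eq_bigr => a _.
  rewrite mulr_sumr -sumrB; apply: eq_bigr => b _.
  by rewrite (moebius_split V a); ring.
have logE a : (0 < a)%N -> \sum_(1 <= b < X) ln b%:R * F (a * b)%N =
    \sum_(1 <= c < X) \sum_(1 <= b < X) vonMangoldt R c * F (c * (a * b))%N.
  move=> a0.
  transitivity (\sum_(1 <= b < X) (\sum_(d <- divisors b) vonMangoldt R d) * F (a * b)%N).
    by apply: eq_big_nat => b /andP[b0 _]; rewrite sum_vonMangoldt.
  rewrite -(@sum_mul_divisors _ (fun n => F (a * n)%N) (vonMangoldt R) X); last first.
    by move=> n; exact: FcX.
  by apply: eq_bigr => c _; apply: eq_bigr => b _; rewrite mulnCA.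
have -> : \sum_(1 <= a < X) moebius_le V a * (\sum_(1 <= b < X) ln b%:R * F (a * b)%N) =
    \sum_(1 <= c < X) vonMangoldt R c * S V c.
  transitivity (\sum_(1 <= a < X) \sum_(1 <= c < X) \sum_(1 <= b < X)
     moebius_le V a * (vonMangoldt R c * F (c * (a * b))%N)).
    apply: eq_big_nat => a /andP[a0 _].
    rewrite logE// mulr_sumr; apply: eq_bigr => c _; exact: mulr_sumr.
  rewrite exchange_big/=; apply: eq_bigr => c _; rewrite /S mulr_sumr.
  apply: eq_bigr => a _; rewrite mulrCA !mulr_sumr; apply: eq_bigr => b _.
  by rewrite mulrCA.
rewrite [X in _ - X]big_mkcond [X in _ + X]big_mkcond -sumrB -big_split/=.
apply: eq_big_nat => c c0; rewrite tailE// -/(S V c).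
by case: (leqP c U) => cU; rewrite ?(FU c cU); ring.
Qed.

End vaughan.

(** * Type I sums *)

Section type_one.
Context {R : realType}.

Lemma second_difference_inv (u q : R) : 0 < u -> 0 <= q ->
  (u + 2 * q)^-1 - (u + q)^-1 - ((u + q)^-1 - u^-1) =
  2 * q ^+ 2 / (u * (u + q) * (u + 2 * q)).
Proof.
move=> u0 q0; field; rewrite !gt_eqF//; lra.
Qed.

Lemma interval_length (D : R) (q lo hi : nat) : q%:R <= D ->
  (forall b, (lo <= b < hi)%N -> D <= q%:R * b%:R < 2 * D) ->
  (hi - lo)%:R * q%:R <= 2 * D.
Proof.
move=> qD hb; have D0 : 0 <= D by apply: le_trans qD.
have [hl|hl] := leqP hi lo.
  by rewrite (eqP (hl : hi - lo == 0)%N) mul0r mulr_ge0.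
have /andP[h1 _] := hb lo ltac:(lia).
have /andP[_ h2] := hb hi.-1 ltac:(lia).
have -> : (hi - lo)%:R = hi.-1%:R - lo%:R + 1 :> R.
  by rewrite -natrB; [rewrite natr1; congr (_%:R); lia | lia].
nra.
Qed.

Lemma type_one_inner (T D dl al : R) (q lo hi : nat)
    (s := Num.sqrt (2 * T / (5 ^+ 3 * D ^+ 3))) :
  0 < T -> 1 <= D -> (0 < q)%N -> q%:R <= D -> 0 <= dl <= 1 ->
  (forall b, (lo <= b < hi)%N -> D <= q%:R * b%:R < 2 * D) ->
  `|\sum_(lo <= b < hi) cos (2 * pi * (T / (q%:R * b%:R + dl)) + al)| <=
    16 * 5 ^+ 3 * (D * s) + 16 / (q%:R * s).
Proof.
move=> T0 D1 q0 qD /andP[dl0 dl1] hb.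
have p0 : 0 < pi :> R := pi_gt0 R.
have D0 : 0 < D by lra.
have qr0 : 0 < q%:R :> R by rewrite ltr0n.
set l0 := 2 * T / (5 ^+ 3 * D ^+ 3) in s *.
have l00 : 0 < l0.
  apply: divr_gt0; first by rewrite mulr_gt0.
  by rewrite mulr_gt0// exprn_gt0.
have s0 : 0 < s by rewrite sqrtr_gt0.
have rhs0 : 0 <= 16 * 5 ^+ 3 * (D * s) + 16 / (q%:R * s).
  apply: addr_ge0; first by rewrite !mulr_ge0// ltW.
  by apply: divr_ge0; [exact: ler0n | rewrite mulr_ge0// ltW].
have [hl|hl] := leqP hi lo; first by rewrite (big_geq hl) normr0; exact: rhs0.
pose f (b : nat) : R := T / (q%:R * b%:R + dl) + al / (2 * pi).
have -> : \sum_(lo <= b < hi) cos (2 * pi * (T / (q%:R * b%:R + dl)) + al) =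
    \sum_(lo <= b < hi) cos (2 * pi * f b).
  apply: eq_bigr => b _; congr cos; rewrite /f [RHS]mulrDr.
  rewrite [X in _ = _ + X](_ : _ = al)//.
  by move: (pi : R) p0 => p p0; field; rewrite gt_eqF.
have sq : Num.sqrt (q%:R ^+ 2 * l0) = q%:R * s.
  by rewrite sqrtrM ?sqr_ge0// sqrtr_sqr ger0_norm// ltW.
have len := interval_length qD hb.
have := @vdc_interval R f lo hi (q%:R ^+ 2 * l0) (5 ^+ 3); rewrite sq.
move=> /(_ _ _ _)/le_trans; apply.
- by rewrite mulr_gt0 ?exprn_gt0.
- by apply: exprn_ege1; rewrite ler1n.
- left => b /hb /andP[b1 b2].
  set u := q%:R * b%:R + dl.
  have u1 : D <= u by rewrite /u; lra.
  have u5 : u + 2 * q%:R <= 5 * D by rewrite /u; lra.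
  have -> : f b.+2 - f b.+1 - (f b.+1 - f b) =
      T * ((u + 2 * q%:R)^-1 - (u + q%:R)^-1 - ((u + q%:R)^-1 - u^-1)).
    rewrite /f -[b.+2]addn2 -[b.+1]addn1 !natrD.
    have -> : q%:R * (b%:R + 2) + dl = u + 2 * q%:R by rewrite /u; ring.
    have -> : q%:R * (b%:R + 1) + dl = u + q%:R by rewrite /u; ring.
    by rewrite -/u; ring.
  have u0 : 0 < u by lra.
  have u0' : 0 < u + q%:R by lra.
  have u0'' : 0 < u + 2 * q%:R by lra.
  rewrite (second_difference_inv u0 (ltW qr0)).
  have P0 : 0 < u * (u + q%:R) * (u + 2 * q%:R) by rewrite !mulr_gt0.
  have Plo : D ^+ 3 <= u * (u + q%:R) * (u + 2 * q%:R).
    by rewrite !exprS expr0 mulr1 mulrA !ler_pM ?mulr_ge0 ?(ltW D0)//; lra.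
  have Phi : u * (u + q%:R) * (u + 2 * q%:R) <= 5 ^+ 3 * D ^+ 3.
    have -> : 5 ^+ 3 * D ^+ 3 = (5 * D) * (5 * D) * (5 * D) by ring.
    by rewrite !ler_pM ?mulr_ge0 ?(ltW u0) ?(ltW u0') ?(ltW u0'')//; lra.
  have TQ : 0 < T * (2 * q%:R ^+ 2) by rewrite !mulr_gt0 ?exprn_gt0.
  rewrite [T * _]mulrA; apply/andP; split.
    have -> : q%:R ^+ 2 * l0 = T * (2 * q%:R ^+ 2) / (5 ^+ 3 * D ^+ 3).
      by rewrite /l0; ring.
    by rewrite ler_pM2l// lef_pV2// posrE mulr_gt0// exprn_gt0.
  have -> : 5 ^+ 3 * (q%:R ^+ 2 * l0) = T * (2 * q%:R ^+ 2) / D ^+ 3.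
    by rewrite /l0; move: (q%:R : R) => z; field; rewrite gt_eqF.
  by rewrite ler_pM2l// lef_pV2// posrE exprn_gt0.
- rewrite lerD2r.
  have -> : 8 * 5 ^+ 3 * (hi - lo)%:R * (q%:R * s) = 8 * 5 ^+ 3 * ((hi - lo)%:R * q%:R * s) by ring.
  have -> : 16 * 5 ^+ 3 * (D * s) = 8 * 5 ^+ 3 * (2 * D * s) by ring.
  by rewrite ler_wpM2l// ler_wpM2r// ltW.
Qed.

End type_one.

Section mangoldt_bounds.
Context {R : realType}.

Lemma vonMangoldt_ge0 n : 0 <= vonMangoldt R n.
Proof.
rewrite /vonMangoldt; case En : (primes n) => [|p [|q s]] //.
have : p \in primes n by rewrite En mem_head.
by rewrite mem_primes => /andP[pp _]; rewrite ln_ge0// ler1n prime_gt0.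
Qed.

Lemma vonMangoldt_le n : (0 < n)%N -> vonMangoldt R n <= ln n%:R.
Proof.
move=> n0; rewrite /vonMangoldt; case En : (primes n) => [|p [|q s]];
  rewrite ?ln_ge0 ?ler1n//.
have : p \in primes n by rewrite En mem_head.
rewrite mem_primes => /and3P[pp _ pn].
have p0 := prime_gt0 pp.
by rewrite ler_ln ?posrE ?ltr0n// ler_nat dvdn_leq.
Qed.

Lemma ler_ln_nat (m n : nat) : (0 < m)%N -> (m <= n)%N -> ln m%:R <= ln n%:R :> R.
Proof.
move=> m0 mn; have n0 := leq_trans m0 mn.
by rewrite ler_ln ?posrE ?ltr0n// ler_nat.
Qed.

Lemma harmonic_le n : (0 < n)%N -> \sum_(1 <= a < n.+1) a%:R^-1 <= 1 + ln n%:R :> R.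
Proof.
elim: n => // -[_ _|n IH _]; first by rewrite big_nat1 invr1 ln1 addr0.
rewrite big_nat_recr//= addrC.
have n0 : 0 < n.+2%:R :> R by [].
have : ln (1 + - n.+2%:R^-1) <= - n.+2%:R^-1 :> R.
  by apply: le_ln1Dx; rewrite ltrN2 invf_lt1// ltr1n.
have -> : 1 + - n.+2%:R^-1 = n.+1%:R / n.+2%:R :> R.
  have -> : n.+1%:R = n.+2%:R - 1 :> R by rewrite -[n.+2]addn1 natrD addrK.
  by rewrite mulrBl divff ?lt0r_neq0// mul1r.
rewrite ln_div ?posrE// => h1; have h2 := IH isT.
have h3 : \sum_(1 <= a < n.+2) a%:R^-1 + n.+2%:R^-1 <= 1 + ln n.+2%:R :> R.
  move: h1 h2; move: (n.+2%:R^-1) (ln _) (ln _) => w a b; lra.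
by rewrite addrC.
Qed.

Lemma big_nat_multiples (g : nat -> R) (D E q : nat) : (0 < q)%N -> (0 < D)%N ->
  \sum_(1 <= b < E) (if (D <= q * b < E)%N then g b else 0) =
  \sum_((D.-1 %/ q).+1 <= b < (E.-1 %/ q).+1) g b.
Proof.
move=> q0 D0; case: E => [|E]; first by rewrite div0n !big_geq.
rewrite -big_mkcond/= [RHS](big_nat_widen _ _ E.+1); last by rewrite ltnS leq_div.
rewrite [RHS](big_nat_widenl _ 1)//=.
apply: eq_bigl => b; rewrite !ltnS mulnC andbC; congr (_ && _).
  by rewrite leq_divRL.
by rewrite ltn_divLR//; case: (D) D0.
Qed.

End mangoldt_bounds.

Section type_one_sums.
Context {R : realType}.
Variables (T dl al A : R) (D E U V : nat).
Hypotheses (T0 : 0 < T) (dl01 : 0 <= dl <= 1) (D0 : (0 < D)%N) (E2 : (E <= 2 * D)%N).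
Hypotheses (U0 : (0 < U)%N) (V0 : (0 < V)%N) (UVD : (U * V <= D)%N) (A1 : 1 <= A)
  (lnA : forall b : nat, (0 < b < 2 * D)%N -> ln b%:R <= A).

Definition phase (d : nat) : R :=
  if (D <= d < E)%N then cos (2 * pi * (T / (d%:R + dl)) + al) else 0.

Let s : R := Num.sqrt (2 * T / (5 ^+ 3 * D%:R ^+ 3)).
Let K : R := 16 * 5 ^+ 3.
Let B (q : nat) : R := K * (D%:R * s) + 16 / (q%:R * s).

Let s0 : 0 < s.
Proof. by rewrite sqrtr_gt0 divr_gt0 ?mulr_gt0 ?exprn_gt0 ?ltr0n. Qed.

Let type_one_segment (q lo hi : nat) : (0 < q)%N -> (q <= D)%N ->
  (forall b, (lo <= b < hi)%N -> (D <= q * b < E)%N) ->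
  `|\sum_(lo <= b < hi) cos (2 * pi * (T / ((q * b)%:R + dl)) + al)| <= B q.
Proof.
move=> q0 qD h; under eq_bigr do rewrite natrM.
apply: type_one_inner => //; rewrite ?ler1n ?ler_nat// => b /h /andP[h1 h2].
by rewrite -!natrM ler_nat ltr_nat h1/= (leq_trans h2).
Qed.

Let segmentP (q b : nat) : (0 < q)%N ->
  ((D.-1 %/ q).+1 <= b < (E.-1 %/ q).+1)%N -> (D <= q * b < E)%N.
Proof.
move=> q0; rewrite ltnS ltn_divLR// leq_divRL// mulnC.
move: (D) D0 => [//|d] _ /andP[h1 h2]; rewrite h1/=.
by case: (E) h2 h1 => [|e] //=; rewrite leqn0 => /eqP ->.
Qed.

Let type_one_plain q : (0 < q)%N -> (q <= D)%N ->
  `|\sum_(1 <= b < E) phase (q * b)| <= B q.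
Proof.
move=> q0 qD; rewrite /phase.
rewrite (big_nat_multiples (fun b => cos (2 * pi * (T / ((q * b)%:R + dl)) + al)))//.
by apply: type_one_segment => // b; exact: segmentP.
Qed.

Let type_one_log q : (0 < q)%N -> (q <= D)%N ->
  `|\sum_(1 <= b < E) ln b%:R * phase (q * b)| <= 4 * B q * A.
Proof.
move=> q0 qD; rewrite /phase.
have -> : \sum_(1 <= b < E) ln b%:R *
    (if (D <= q * b < E)%N then cos (2 * pi * (T / ((q * b)%:R + dl)) + al) else 0) =
  \sum_(1 <= b < E) (if (D <= q * b < E)%N then
     ln b%:R * cos (2 * pi * (T / ((q * b)%:R + dl)) + al) else 0).
  by apply: eq_bigr => b _; case: ifP; rewrite ?mulr0.
rewrite (big_nat_multiples (fun b => ln b%:R * cos (2 * pi * (T / ((q * b)%:R + dl)) + al)))//.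
set lo := (D.-1 %/ q).+1; set hi := (E.-1 %/ q).+1.
pose S i := \sum_(lo <= b < lo + i) cos (2 * pi * (T / ((q * b)%:R + dl)) + al).
have hseg i b : (i <= hi - lo)%N -> (lo <= b < lo + i)%N -> (D <= q * b < E)%N.
  move=> hi1 hb; apply: segmentP => //; rewrite -/lo -/hi; lia.
have -> : \sum_(lo <= b < hi) ln b%:R * cos (2 * pi * (T / ((q * b)%:R + dl)) + al) =
    \sum_(i < hi - lo) (S i.+1 - S i) * ln (lo + i)%:R.
  rewrite -[X in \sum_(X <= _ < _) _]add0n big_addn big_mkord.
  apply: eq_bigr => i _; rewrite /S addnS big_nat_recr ?leq_addr//=.
  by rewrite addrAC subrr add0r mulrC addnC.
have lo_i i : (i < hi - lo)%N -> (0 < lo + i < 2 * D)%N.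
  move=> hi1; have := hseg (hi - lo)%N (lo + i)%N (leqnn _).
  rewrite leq_addr ltn_add2l hi1 => /(_ isT) /andP[_ h]; rewrite addSn/=.
  apply: leq_trans E2; apply: leq_trans h; rewrite ltnS; exact: leq_pmull.
apply: (@abel_monotone R S (fun i => ln (lo + i)%:R)).
- by apply: le_trans A1.
- move=> i hi1; apply: type_one_segment => // b; exact: hseg.
- move=> i hi1; rewrite ger0_norm; first exact/lnA/lo_i.
  by rewrite ln_ge0// ler1n.
- by move=> i hi1; apply: ler_ln_nat; rewrite ?leq_add2l.
Qed.

Let harmonicA n : (0 < n < 2 * D)%N -> \sum_(1 <= a < n.+1) a%:R^-1 <= 2 * A.
Proof.
move=> hn; have h1 := lnA hn; have h2 := A1.
by apply: (le_trans (harmonic_le _)); [case/andP: hn|rewrite mulr_natl mulr2n lerD].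
Qed.

Let VD : (V <= D)%N. Proof. by apply: leq_trans UVD; exact: leq_pmull. Qed.
Let UD : (U <= D)%N. Proof. by apply: leq_trans UVD; exact: leq_pmulr. Qed.
Let Ds0 : 0 <= D%:R * s. Proof. by rewrite mulr_ge0// ltW. Qed.

Let sum_moebius_le (G g : nat -> R) :
  (forall a, (0 < a <= V)%N -> `|G a| <= g a) ->
  `|\sum_(1 <= a < E) moebius_le V a * G a| <= \sum_(1 <= a < V.+1) g a.
Proof.
move=> hG; have g0 a : (0 < a <= V)%N -> 0 <= g a.
  by move=> /hG; apply: le_trans.
apply: (le_trans (ler_norm_sum _ _ _)).
apply: (@le_trans _ _ (\sum_(1 <= a < E | (a < V.+1)%N) g a)).
  rewrite [leRHS]big_mkcond/=; apply: ler_sum_nat => a /andP[a0 _].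
  rewrite normrM /moebius_le ltnS; case: ifP => aV; last by rewrite normr0 mul0r.
  rewrite -[leRHS]mul1r ler_pM//; first exact: norm_moebius_le1.
  by apply: hG; rewrite a0.
have [h|h] := leqP E V.+1; last first.
  by rewrite [leRHS](big_nat_widen _ _ E) ?(ltnW h).
rewrite [leLHS](big_nat_widen _ _ V.+1)// [leLHS]big_mkcond/=.
by apply: ler_sum_nat => a ha; case: ifP => // _; apply: g0; lia.
Qed.

Lemma type_one_log_sum :
  `|\sum_(1 <= a < E) moebius_le V a * (\sum_(1 <= b < E) ln b%:R * phase (a * b))|
   <= 4 * A * (K * (V%:R * (D%:R * s)) + 32 * A / s).
Proof.
apply: (le_trans (@sum_moebius_le _ (fun a => 4 * B a * A) _)).
  by move=> a /andP[a0 aV]; apply: type_one_log => //; exact: leq_trans VD.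
have -> : \sum_(1 <= a < V.+1) 4 * B a * A = 4 * A * (K * (V%:R * (D%:R * s)) +
    16 / s * \sum_(1 <= a < V.+1) a%:R^-1).
  rewrite mulr_sumr.
  have -> : K * (V%:R * (D%:R * s)) = \sum_(1 <= a < V.+1) K * (D%:R * s).
    by rewrite sumr_const_nat subn1/= -mulr_natr; ring.
  rewrite -big_split/= mulr_sumr; apply: eq_bigr => a _.
  by rewrite /B invfM; ring.
have A0 : 0 <= 4 * A by rewrite mulr_ge0// (le_trans ler01).
rewrite ler_wpM2l// lerD2l.
have -> : 32 * A / s = 16 / s * (2 * A) by ring.
apply: ler_wpM2l; first by rewrite divr_ge0// ltW.
by apply: harmonicA; rewrite V0/=; lia.
Qed.

Lemma type_one_mangoldt_sum :
  `|\sum_(1 <= c < E | (c <= U)%N) vonMangoldt R c *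
      (\sum_(1 <= a < E) moebius_le V a * \sum_(1 <= b < E) phase (c * (a * b)))|
   <= A * (K * ((U * V)%:R * (D%:R * s)) + 64 * A ^+ 2 / s).
Proof.
have A0 : 0 <= A by apply: le_trans A1.
have inner c : (0 < c <= U)%N ->
    `|\sum_(1 <= a < E) moebius_le V a * \sum_(1 <= b < E) phase (c * (a * b))| <=
    K * (V%:R * (D%:R * s)) + 32 * A / s * c%:R^-1.
  move=> /andP[c0 cU].
  apply: (le_trans (@sum_moebius_le _ (fun a => B (c * a)) _)).
    move=> a /andP[a0 aV]; under eq_bigr do rewrite mulnA.
    apply: type_one_plain; first by rewrite muln_gt0 c0.
    by apply: leq_trans UVD; exact: leq_mul.
  have -> : \sum_(1 <= a < V.+1) B (c * a) = K * (V%:R * (D%:R * s)) +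
     16 / s * c%:R^-1 * \sum_(1 <= a < V.+1) a%:R^-1.
    rewrite mulr_sumr.
    have -> : K * (V%:R * (D%:R * s)) = \sum_(1 <= a < V.+1) K * (D%:R * s).
      by rewrite sumr_const_nat subn1/= -mulr_natr; ring.
    rewrite -big_split/=; apply: eq_bigr => a _.
    by rewrite /B natrM !invfM; ring.
  have -> : 32 * A / s * c%:R^-1 = 16 / s * c%:R^-1 * (2 * A) by ring.
  rewrite lerD2l ler_wpM2l ?harmonicA ?V0//=; last by lia.
  by rewrite mulr_ge0 ?invr_ge0// divr_ge0// ltW.
apply: (le_trans (ler_norm_sum _ _ _)).
apply: (@le_trans _ _ (\sum_(1 <= c < U.+1)
    A * (K * (V%:R * (D%:R * s)) + 32 * A / s * c%:R^-1))).
  have g0 c : (0 < c <= U)%N ->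
     0 <= A * (K * (V%:R * (D%:R * s)) + 32 * A / s * c%:R^-1).
    by move=> hc; rewrite mulr_ge0//; apply: le_trans (inner c hc).
  apply: (@le_trans _ _ (\sum_(1 <= c < E | (c < U.+1)%N)
     A * (K * (V%:R * (D%:R * s)) + 32 * A / s * c%:R^-1))).
    rewrite [leLHS]big_mkcond [leRHS]big_mkcond/=.
    apply: ler_sum_nat => c /andP[c0 _]; rewrite ltnS; case: ifP => // cU.
    rewrite normrM ler_pM// ?inner ?c0//.
    rewrite ger0_norm ?vonMangoldt_ge0//; apply: le_trans (vonMangoldt_le c0) _.
    by apply: lnA; rewrite c0/=; lia.
  have [h|h] := leqP E U.+1; last first.
  by rewrite [leRHS](big_nat_widen _ _ E) ?(ltnW h).
  rewrite [leLHS](big_nat_widen _ _ U.+1)// [leLHS]big_mkcond/=.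
  by apply: ler_sum_nat => a ha; case: ifP => // _; apply: g0; lia.
rewrite -mulr_sumr ler_wpM2l// big_split/= sumr_const_nat subn1/= -mulr_sumr.
have -> : K * (V%:R * (D%:R * s)) *+ U = K * ((U * V)%:R * (D%:R * s)).
  by rewrite natrM -mulr_natr; ring.
rewrite lerD2l.
have -> : 64 * A ^+ 2 / s = 32 * A / s * (2 * A) by ring.
apply: ler_wpM2l; first by rewrite divr_ge0 ?mulr_ge0// ltW.
by apply: harmonicA; rewrite U0/=; lia.
Qed.

End type_one_sums.

(** * Type II sums *)

Section bilinear.
Context {R : realType}.

Lemma cauchy_schwarz_sum (I : Type) (r : seq I) (u v : I -> R) :
  (\sum_(i <- r) u i * v i) ^+ 2 <= (\sum_(i <- r) u i ^+ 2) * (\sum_(i <- r) v i ^+ 2).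
Proof.
set S := \sum_(i <- r) u i * v i; set X := \sum_(i <- r) u i ^+ 2; set Y := \sum_(i <- r) v i ^+ 2.
have : 0 <= \sum_(i <- r) \sum_(j <- r) (u i * v j - u j * v i) ^+ 2.
  by apply: sumr_ge0 => i _; apply: sumr_ge0 => j _; exact: sqr_ge0.
have -> : \sum_(i <- r) \sum_(j <- r) (u i * v j - u j * v i) ^+ 2 =
    \sum_(i <- r) (u i ^+ 2 * Y - 2 * (u i * v i) * S + v i ^+ 2 * X).
  apply: eq_bigr => i _; rewrite /Y /S /X !mulr_sumr -sumrB -big_split/=.
  by apply: eq_bigr => j _; ring.
rewrite big_split/= sumrB -!mulr_suml -mulr_sumr -/S -/X -/Y.
have -> : X * Y - 2 * S * S + Y * X = 2 * (X * Y - S ^+ 2) by ring.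
by rewrite pmulr_rge0// subr_ge0.
Qed.

Lemma sum_cos_sqr_le (I : Type) (r : seq I) (w th : I -> R) :
  (\sum_(p <- r) w p * cos (th p)) ^+ 2 <=
  \sum_(p <- r) \sum_(q <- r) w p * w q * cos (th p - th q).
Proof.
have -> : \sum_(p <- r) \sum_(q <- r) w p * w q * cos (th p - th q) =
   (\sum_(p <- r) w p * cos (th p)) ^+ 2 + (\sum_(p <- r) w p * sin (th p)) ^+ 2.
  rewrite !expr2 !mulr_suml -big_split/=; apply: eq_bigr => p _.
  rewrite !mulr_sumr -big_split/=; apply: eq_bigr => q _.
  by rewrite cosB; ring.
by rewrite lerDl sqr_ge0.
Qed.

(* Splitting the pairs into [G] classes before applying Cauchy-Schwarz keeps only
   the off-diagonal terms [p, q] of the same class. *)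
Lemma bilinear_class_bound (P : Type) (r : seq P) (w : P -> R) (ch : P -> nat -> bool)
    (ph : P -> nat -> R) (g : P -> nat) (G M : nat) (a : nat -> R) :
  (forall p, (g p < G)%N) ->
  (\sum_(m < M) a m * \sum_(p <- r) w p * (if ch p m then cos (ph p m) else 0)) ^+ 2 <=
  (G%:R * \sum_(m < M) a m ^+ 2) *
  \sum_(p <- r) \sum_(q <- r | g p == g q) `|w p| * `|w q| *
     `|\sum_(m < M | ch p m && ch q m) cos (ph p m - ph q m)|.
Proof.
move=> gG.
pose v (i : nat * nat) : R :=
  \sum_(p <- r | g p == i.2) w p * (if ch p i.1 then cos (ph p i.1) else 0).
pose rr := [seq (m, j) | m <- iota 0 M, j <- iota 0 G].
have sumrr (F : nat * nat -> R) :
    \sum_(i <- rr) F i = \sum_(m < M) \sum_(j < G) F (m : nat, j : nat).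
  rewrite /rr big_allpairs_dep/= -(big_mkord xpredT (fun m => \sum_(j < G) F (m, j : nat))).
  rewrite /index_iota subn0; apply: eq_bigr => m _.
  by rewrite -(big_mkord xpredT (fun j => F (m, j))) /index_iota subn0.
have -> : \sum_(m < M) a m * \sum_(p <- r) w p * (if ch p m then cos (ph p m) else 0) =
   \sum_(i <- rr) a i.1 * v i.
  rewrite sumrr; apply: eq_bigr => m _; rewrite /= -mulr_sumr; congr (_ * _).
  rewrite /v/= (exchange_big_dep xpredT)//=; apply: eq_bigr => p _.
  by rewrite (big_pred1 (Ordinal (gG p))).
apply: (le_trans (cauchy_schwarz_sum _ _ _)).
have -> : \sum_(i <- rr) a i.1 ^+ 2 = G%:R * \sum_(m < M) a m ^+ 2.
  rewrite sumrr mulr_sumr; apply: eq_bigr => m _ /=.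
  by rewrite sumr_const card_ord mulr_natl.
apply: ler_wpM2l; first by rewrite mulr_ge0// sumr_ge0// => m _; exact: sqr_ge0.
rewrite sumrr.
apply: (@le_trans _ _ (\sum_(m < M) \sum_(j < G) \sum_(p <- r | g p == j) \sum_(q <- r | g q == j)
   (if ch p m && ch q m then w p * w q * cos (ph p m - ph q m) else 0))).
  apply: ler_sum => m _; apply: ler_sum => j _; rewrite /v/=.
  pose w' p := if ch p m then w p else 0.
  have -> : \sum_(p <- r | g p == j) w p * (if ch p m then cos (ph p m) else 0) =
     \sum_(p <- [seq p <- r | g p == j]) w' p * cos (ph p m).
    by rewrite big_filter; apply: eq_bigr => p _; rewrite /w'; case: ifP; rewrite ?mulr0 ?mul0r.
  apply: (le_trans (sum_cos_sqr_le _ _ _)); rewrite big_filter.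
  apply: ler_sum => p _; rewrite big_filter; apply: ler_sum => q _.
  by rewrite /w'; case: (ch p m); case: (ch q m); rewrite ?mulr0 ?mul0r.
have -> : \sum_(m < M) \sum_(j < G) \sum_(p <- r | g p == j) \sum_(q <- r | g q == j)
    (if ch p m && ch q m then w p * w q * cos (ph p m - ph q m) else 0) =
  \sum_(p <- r) \sum_(q <- r | g p == g q) w p * w q *
     \sum_(m < M | ch p m && ch q m) cos (ph p m - ph q m).
  transitivity (\sum_(m < M) \sum_(p <- r) \sum_(q <- r | g p == g q)
    (if ch p m && ch q m then w p * w q * cos (ph p m - ph q m) else 0)).
    apply: eq_bigr => m _; rewrite (exchange_big_dep xpredT)//=; apply: eq_bigr => p _.
    by rewrite (big_pred1 (Ordinal (gG p)))//=; apply: eq_bigl => q; exact: eq_sym.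
  rewrite exchange_big/=; apply: eq_bigr => p _.
  rewrite exchange_big/=; apply: eq_bigr => q _.
  by rewrite -big_mkcond/= mulr_sumr.
apply: ler_sum => p _; apply: ler_sum => q _.
by apply: (le_trans (ler_norm _)); rewrite !normrM.
Qed.

Lemma count_products (L N v : nat) : (0 < v)%N -> (0 < N)%N ->
  (\sum_(L <= h < 2 * L) \sum_(N <= n < 2 * N) (h * n == v) <= tau v)%N.
Proof.
move=> v0 N0; rewrite exchange_big/=.
apply: (@leq_trans (\sum_(N <= n < 2 * N) (n %| v))).
  rewrite big_seq [leqRHS]big_seq; apply: leq_sum => n; rewrite mem_index_iota => /andP[n0 _].
  have {}n0 : (0 < n)%N by apply: leq_trans n0.
  case: (boolP (n %| v)%N) => nv; last first.
    rewrite big1// => h _; case: eqP => // e.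
    by move: nv; rewrite -e dvdn_mull.
  apply: (@leq_trans (count (pred1 (v %/ n)%N) (index_iota L (2 * L)))).
    rewrite -sum1_count [leqRHS]big_mkcond/=; apply: leq_sum => h _.
    case: eqP => // e; rewrite -e mulnK// eqxx//.
  by rewrite count_uniq_mem ?iota_uniq//; case: (_ \in _).
rewrite -big_mkcond/= sum1_count -size_filter /tau.
apply: uniq_leq_size; first by rewrite filter_uniq// iota_uniq.
by move=> d; rewrite mem_filter -dvdn_divisors// => /andP[].
Qed.

Lemma count_close_products (L N v1 K : nat) (A : R) : (0 < N)%N -> (0 < L)%N ->
  (forall v, (0 < v < 4 * (L * N))%N -> (tau v)%:R <= A) -> 0 <= A ->
  \sum_(L <= h < 2 * L) \sum_(N <= n < 2 * N)
     ((v1 <= h * n + K)%N && (h * n <= v1 + K)%N)%:R <= (2 * K + 1)%:R * A.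
Proof.
move=> N0 L0 hA A0.
apply: (@le_trans _ _ (\sum_(v1 - K <= v < v1 + K + 1) \sum_(L <= h < 2 * L)
   \sum_(N <= n < 2 * N) (h * n == v)%:R)).
  rewrite [leRHS]exchange_big/=; apply: ler_sum => h _.
  rewrite [leRHS]exchange_big/=; apply: ler_sum => n _.
  case: (boolP (_ && _)) => [hh|_]; last by rewrite sumr_ge0.
  rewrite (big_rem (h * n)%N)/=; last by rewrite mem_index_iota; lia.
  by rewrite eqxx lerDl sumr_ge0.
apply: (@le_trans _ _ (\sum_(v1 - K <= v < v1 + K + 1) A)); last first.
  rewrite sumr_const_nat -[leLHS]mulr_natl ler_wpM2r// ler_nat; lia.
apply: ler_sum => v _.
have [v0|v0] := posnP v.
  rewrite big_nat_cond big1 ?A0// => h /andP[/andP[h1 _] _].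
  rewrite big_nat_cond big1// => n /andP[/andP[n1 _] _].
  by rewrite v0 (_ : (h * n == 0)%N = false)//; nia.
have [v4|v4] := leqP (4 * (L * N)) v.
  rewrite big_nat_cond big1 ?A0// => h /andP[/andP[h1 h2] _].
  rewrite big_nat_cond big1// => n /andP[/andP[n1 n2] _].
  by rewrite (_ : (h * n == v)%N = false)//; nia.
apply: le_trans (hA v _); last by rewrite v0.
under eq_bigr do rewrite -natr_sum.
by rewrite -natr_sum ler_nat count_products.
Qed.

End bilinear.

Section close_pairs.
Context {R : realType}.

Let cubic (s : R) := s * (s + 1) * (s + 2).

Lemma phase_second_difference (x h n m dl : R) : 0 < n -> 0 < m -> 0 <= dl ->
  x * h / (n * (m + 2) + dl) - x * h / (n * (m + 1) + dl)
    - (x * h / (n * (m + 1) + dl) - x * h / (n * m + dl)) =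
  2 * x * (h / n / cubic (m + dl / n)).
Proof.
move=> n0 m0 d0; have u0 : 0 < n * m + dl by rewrite ltr_wpDr// mulr_gt0.
have := second_difference_inv u0 (ltW n0).
have -> : n * m + dl + 2 * n = n * (m + 2) + dl by ring.
have -> : n * m + dl + n = n * (m + 1) + dl by ring.
set a := _^-1; set b := _^-1; set c := _^-1 => e.
have -> : x * h * a - x * h * b - (x * h * b - x * h * c) = x * h * (a - b - (b - c)) by ring.
rewrite e /cubic {a b c e}.
have s0 : 0 < m + dl / n by rewrite ltr_wpDr// divr_ge0// ltW.
have -> : n * m + dl = n * (m + dl / n) by rewrite mulrDr; congr (_ + _); field; rewrite gt_eqF.
have -> : n * (m + 1) + dl = n * (m + dl / n + 1) by field; rewrite gt_eqF.
have -> : n * (m + 2) + dl = n * (m + dl / n + 2) by field; rewrite gt_eqF.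
move: (m + dl / n) s0 => s s0.
by field; rewrite !gt_eqF//; lra.
Qed.

Lemma cubic_difference (m t1 t2 : R) : 1 <= m -> 0 <= t1 <= 1 -> 0 <= t2 <= 1 ->
  `|cubic (m + t2) - cubic (m + t1)| <= `|t2 - t1| * (3 * (m + 3) ^+ 2).
Proof.
move=> m1 /andP[t10 t11] /andP[t20 t21]; rewrite /cubic.
set s1 := m + t1; set s2 := m + t2.
have -> : s2 * (s2 + 1) * (s2 + 2) - s1 * (s1 + 1) * (s1 + 2) =
  (t2 - t1) * (s2 ^+ 2 + s1 * s2 + s1 ^+ 2 + 3 * (s1 + s2) + 2) by rewrite /s1 /s2; ring.
rewrite normrM; apply: ler_wpM2l => //.
have a1 : 0 <= s1 <= m + 1 by rewrite /s1; apply/andP; split; lra.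
have a2 : 0 <= s2 <= m + 1 by rewrite /s2; apply/andP; split; lra.
clearbody s1 s2; move: a1 a2 => /andP[a1 a1'] /andP[a2 a2'].
rewrite ger0_norm; last by rewrite !addr_ge0 ?mulr_ge0 ?sqr_ge0 ?addr_ge0.
have h1 : s1 ^+ 2 <= (m + 1) ^+ 2 by rewrite !expr2; apply: ler_pM.
have h2 : s2 ^+ 2 <= (m + 1) ^+ 2 by rewrite !expr2; apply: ler_pM.
have h3 : s1 * s2 <= (m + 1) ^+ 2 by rewrite !expr2; apply: ler_pM.
nra.
Qed.

Lemma cubic_bounds (m t : R) : 0 < m -> 0 <= t <= 1 ->
  m ^+ 3 <= cubic (m + t) <= (m + 3) ^+ 3.
Proof.
move=> m0 /andP[t0 t1]; rewrite /cubic !exprS !expr0 !mulr1 !mulrA.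
by apply/andP; split; apply: ler_pM; rewrite ?mulr_ge0//; try lra; apply: ler_pM; lra.
Qed.

Lemma pair_second_difference (x h1 h2 n1 n2 m dl L N k : R) :
  0 <= x -> 0 < h1 -> 0 < h2 <= 2 * L -> 0 < N -> N <= n1 <= 2 * N -> N <= n2 <= 2 * N ->
  0 <= dl <= 1 -> 1 <= L -> 1 <= N -> 48 * L <= m ->
  k = h1 * n2 - h2 * n1 -> 1 <= k ->
  x * (k / (n1 * n2)) / (m + 3) ^+ 3 <=
  2 * x * (h1 / n1 / cubic (m + dl / n1)) - 2 * x * (h2 / n2 / cubic (m + dl / n2))
  <= 3 * x * (k / (n1 * n2)) / m ^+ 3.
Proof.
move=> x0 h10 /andP[h20 h2L] N0 /andP[n1N n1N2] /andP[n2N n2N2] /andP[d0 d1] L1 N1 mL kE k1.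
have n10 : 0 < n1 by lra.
have n20 : 0 < n2 by lra.
have m0 : 48 <= m by lra.
set t1 := dl / n1; set t2 := dl / n2.
have ht1 : 0 <= t1 <= 1.
  by rewrite divr_ge0 ?(ltW n10)// ler_pdivrMr// mul1r; lra.
have ht2 : 0 <= t2 <= 1.
  by rewrite divr_ge0 ?(ltW n20)// ler_pdivrMr// mul1r; lra.
have hBA := cubic_difference (ltac:(lra) : 1 <= m) ht1 ht2.
have ht : `|t2 - t1| * (n1 * n2) <= N.
  have -> : t2 - t1 = dl * (n1 - n2) / (n1 * n2) by rewrite /t1 /t2; field; rewrite !gt_eqF.
  have P0 : 0 < n1 * n2 by rewrite mulr_gt0.
  rewrite normrM normfV (gtr0_norm P0) divfK ?gt_eqF// normrM (ger0_norm d0).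
  have : `|n1 - n2| <= N by rewrite ler_norml; apply/andP; split; lra.
  by have := normr_ge0 (n1 - n2); nra.
set A := cubic (m + t1) in hBA *; set B := cubic (m + t2) in hBA *.
have /andP[A1 A2] := cubic_bounds (ltac:(lra) : 0 < m) ht1.
have /andP[B1 _] := cubic_bounds (ltac:(lra) : 0 < m) ht2.
rewrite -/A in A1 A2; rewrite -/B in B1.
have m3 : 0 < m ^+ 3 by rewrite exprn_gt0//; lra.
have A0 : 0 < A := lt_le_trans m3 A1.
have B0 : 0 < B := lt_le_trans m3 B1.
clearbody A B t1 t2.
have n12 : 0 < n1 * n2 by rewrite mulr_gt0.
set ka := k / (n1 * n2).
have ka0 : 0 < ka by rewrite divr_gt0//; lra.
have eE : h1 / n1 / A - h2 / n2 / B = ka / A + (h2 / n2) * (B - A) / (A * B).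
  by rewrite /ka kE; field; rewrite !gt_eqF.
have key : `|(h2 / n2) * (B - A) / (A * B)| <= ka / A / 2.
  have AB0 : 0 < A * B by rewrite mulr_gt0.
  rewrite normrM normfV (gtr0_norm AB0) ler_pdivrMr//.
  have -> : ka / A / 2 * (A * B) = ka * (B / 2) by field; rewrite gt_eqF.
  rewrite normrM gtr0_norm ?divr_gt0//.
  rewrite -(ler_pM2r n12).
  have -> : ka * (B / 2) * (n1 * n2) = k * (B / 2) by rewrite /ka; field; rewrite !gt_eqF.
  apply: (@le_trans _ _ (h2 / n2 * (`|t2 - t1| * (3 * (m + 3) ^+ 2)) * (n1 * n2))).
    by rewrite ler_wpM2r ?(ltW n12)// ler_wpM2l// divr_ge0 ?ltW.
  apply: (@le_trans _ _ (2 * L * (3 * (m + 3) ^+ 2))).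
    have -> : h2 / n2 * (`|t2 - t1| * (3 * (m + 3) ^+ 2)) * (n1 * n2) =
      (h2 / n2) * (`|t2 - t1| * (n1 * n2)) * (3 * (m + 3) ^+ 2) by ring.
    apply: ler_wpM2r; first by rewrite mulr_ge0// sqr_ge0.
    apply: (@le_trans _ _ (h2 / n2 * N)).
      by rewrite ler_wpM2l// divr_ge0 ?ltW.
    rewrite mulrAC ler_pdivrMr//; nra.
  apply: (@le_trans _ _ (m ^+ 3 / 2)).
    have q1 : (m + 3) ^+ 2 <= 4 * m ^+ 2 by nra.
    have q2 : 2 * L * (3 * (m + 3) ^+ 2) <= 2 * L * (3 * (4 * m ^+ 2)).
      by rewrite !ler_wpM2l//; lra.
    have m20 : 0 <= m ^+ 2 := sqr_ge0 m.
    apply: (le_trans q2); rewrite exprS.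
    have : 48 * L * m ^+ 2 <= m * m ^+ 2 by rewrite ler_wpM2r.
    lra.
  apply: (@le_trans _ _ (B / 2)); first by lra.
  by rewrite -[leLHS]mul1r ler_wpM2r//; lra.
have -> : 2 * x * (h1 / n1 / A) - 2 * x * (h2 / n2 / B) =
  2 * x * (h1 / n1 / A - h2 / n2 / B) by ring.
move: key; rewrite eE ler_norml => /andP[k2 k3].
set e := h2 / n2 * (B - A) / (A * B) in k2 k3 *; clearbody e.
have m30 : 0 < m ^+ 3 by rewrite exprn_gt0//; lra.
have m30' : 0 < (m + 3) ^+ 3 by rewrite exprn_gt0//; lra.
have b1 : ka / (m + 3) ^+ 3 <= ka / A by rewrite ler_pM2l// lef_pV2.
have b2 : ka / A <= ka / m ^+ 3 by rewrite ler_pM2l// lef_pV2.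
have -> : x * ka / (m + 3) ^+ 3 = x * (ka / (m + 3) ^+ 3) by rewrite mulrA.
have -> : 3 * x * ka / m ^+ 3 = 3 * x * (ka / m ^+ 3) by rewrite !mulrA.
move: b1 b2 k2 k3; move: (ka / A) (ka / (m + 3) ^+ 3) (ka / m ^+ 3) => w w1 w2 b1 b2 k2 k3.
clear -x0 b1 b2 k2 k3.
by apply/andP; split; nra.
Qed.

Lemma close_pair_sum (x D Q dl al1 al2 : R) (L N h1 h2 n1 n2 lo hi : nat)
    (l1 := x * N%:R / (4 ^+ 4 * D ^+ 3)) :
  0 < x -> 1 <= D -> 0 <= dl <= 1 -> (0 < L)%N -> (0 < N)%N -> 2 * N%:R <= D ->
  (0 < h1)%N -> (0 < h2 < 2 * L)%N -> (N <= n1 < 2 * N)%N -> (N <= n2 < 2 * N)%N ->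
  (forall m, (lo <= m < hi)%N -> D <= n1%:R * m%:R < 2 * D) ->
  (forall m, (lo <= m < hi)%N -> D <= n2%:R * m%:R < 2 * D) ->
  (forall m, (lo <= m < hi)%N -> (48 * L <= m)%N) ->
  (h2 * n1 < h1 * n2)%N -> (h1 * n2)%:R - (h2 * n1)%:R <= 4 * Q ->
  `|\sum_(lo <= m < hi) cos ((2 * pi * (x * h1%:R / (n1%:R * m%:R + dl)) + al1) -
     (2 * pi * (x * h2%:R / (n2%:R * m%:R + dl)) + al2))| <=
    16 * (24 * 4 ^+ 4) * (D / N%:R) * Num.sqrt (4 * Q * l1) + 16 / Num.sqrt l1.
Proof.
move=> x0 D1 dl01 L0 N0 ND h10 /andP[h20 h2L] /andP[n1N n1N2] /andP[n2N n2N2] hn1 hn2 hm hk kQ.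
have D0 : 0 < D by lra.
have Nr0 : 0 < N%:R :> R by rewrite ltr0n.
have Nr1 : 1 <= N%:R :> R by rewrite ler1n.
have n1r : N%:R <= (n1%:R : R) <= 2 * N%:R.
  by rewrite -natrM !ler_nat n1N ltnW.
have n2r : N%:R <= (n2%:R : R) <= 2 * N%:R.
  by rewrite -natrM !ler_nat n2N ltnW.
pose k : R := h1%:R * n2%:R - h2%:R * n1%:R.
have kE : k = (h1 * n2 - h2 * n1)%:R.
  by rewrite /k natrB ?(ltnW hk)// !natrM.
have k1 : 1 <= k by rewrite kE ler1n subn_gt0.
have k0 : 0 < k by lra.
have k4 : k <= 4 * Q by move: kQ; rewrite /k !natrM.
have l10 : 0 < l1 by rewrite /l1 divr_gt0 ?mulr_gt0 ?exprn_gt0.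
pose f (m : nat) : R := (x * h1%:R / (n1%:R * m%:R + dl) + al1 / (2 * pi)) -
   (x * h2%:R / (n2%:R * m%:R + dl) + al2 / (2 * pi)).
have p0 : 2 * pi != 0 :> R by rewrite mulf_neq0 ?pnatr_eq0// gt_eqF// pi_gt0.
have -> : \sum_(lo <= m < hi) cos ((2 * pi * (x * h1%:R / (n1%:R * m%:R + dl)) + al1) -
     (2 * pi * (x * h2%:R / (n2%:R * m%:R + dl)) + al2)) =
  \sum_(lo <= m < hi) cos (2 * pi * f m).
  apply: eq_bigr => m _; rewrite /f mulrBr !(mulrDr (2 * pi)).
  by rewrite ![2 * pi * (_ / (2 * pi))]mulrCA !mulfV// !mulr1.
have sl0 : 0 < Num.sqrt l1 by rewrite sqrtr_gt0.
have kl0 : 0 < k * l1 by rewrite mulr_gt0.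
have C1 : 1 <= 24 * 4 ^+ 4 :> R.
  by rewrite -[leLHS]mulr1 ler_pM// ?ler1n//; apply: exprn_ege1; rewrite ler1n.
have len : (hi - lo)%:R <= 2 * (D / N%:R).
  have n1D : n1%:R <= D by move: n1r => /andP[_ ?]; lra.
  rewrite mulrA ler_pdivlMr//; apply: le_trans (interval_length n1D hn1).
  by rewrite ler_wpM2l//; case/andP: n1r.
have := @vdc_interval R f lo hi (k * l1) (24 * 4 ^+ 4) kl0 C1.
move=> /(_ _)/le_trans; apply.
  left => m hm'.
  have := hn1 m hm'; have := hn2 m hm'; have := hm m hm' => m48 /andP[a1 a2] /andP[a3 a4].
  have m48r : 48 * L%:R <= m%:R :> R by rewrite -natrM ler_nat.
  have L1 : 1 <= L%:R :> R by rewrite ler1n.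
  have m0 : 0 < m%:R :> R by lra.
  have -> : f m.+2 - f m.+1 - (f m.+1 - f m) =
     (x * h1%:R / (n1%:R * (m%:R + 2) + dl) - x * h1%:R / (n1%:R * (m%:R + 1) + dl)
    - (x * h1%:R / (n1%:R * (m%:R + 1) + dl) - x * h1%:R / (n1%:R * m%:R + dl))) -
     (x * h2%:R / (n2%:R * (m%:R + 2) + dl) - x * h2%:R / (n2%:R * (m%:R + 1) + dl)
    - (x * h2%:R / (n2%:R * (m%:R + 1) + dl) - x * h2%:R / (n2%:R * m%:R + dl))).
    by rewrite /f -[m.+2]addn2 -[m.+1]addn1 !natrD; ring.
  have n1r0 : 0 < n1%:R :> R by case/andP: n1r => ? _; lra.
  have n2r0 : 0 < n2%:R :> R by case/andP: n2r => ? _; lra.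
  have dl0 : 0 <= dl by case/andP: dl01.
  rewrite !phase_second_difference//.
  have h1r0 : 0 < h1%:R :> R by rewrite ltr0n.
  have h2r : 0 < (h2%:R : R) <= 2 * L%:R by rewrite ltr0n h20 -natrM ler_nat ltnW.
  have := @pair_second_difference x h1%:R h2%:R n1%:R n2%:R m%:R dl L%:R N%:R k
    (ltW x0) h1r0 h2r Nr0 n1r n2r dl01 L1 Nr1 m48r erefl k1.
  move=> /andP[b1 b2]; apply/andP; split.
    apply: le_trans b1.
    have m3 : (m%:R + 3) * N%:R <= 4 * D.
      have : m%:R * N%:R <= n1%:R * m%:R :> R.
        by rewrite mulrC; apply: ler_wpM2r; [exact: ltW | case/andP: n1r].
      nra.
    have P : (m%:R + 3) ^+ 3 * N%:R ^+ 3 <= (4 * D) ^+ 3.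
      by rewrite -exprMn lerXn2r ?nnegrE ?mulr_ge0 ?addr_ge0 ?(ltW m0) ?(ltW Nr0) ?(ltW D0).
    have n12 : n1%:R * n2%:R <= 4 * N%:R ^+ 2 :> R.
      by move: n1r n2r => /andP[? ?] /andP[? ?]; rewrite expr2; nra.
    have -> : x * (k / (n1%:R * n2%:R)) / (m%:R + 3) ^+ 3 =
       x * k / ((n1%:R * n2%:R) * (m%:R + 3) ^+ 3).
      by field; rewrite !gt_eqF ?ltr_wpDr.
    have -> : k * l1 = x * k / (4 * N%:R ^+ 2 * ((4 * D) ^+ 3 / N%:R ^+ 3)).
      by rewrite /l1; field; rewrite !gt_eqF.
    have P1 : 0 < n1%:R * n2%:R * (m%:R + 3) ^+ 3 :> R.
      by rewrite !mulr_gt0 ?exprn_gt0 ?ltr_wpDr.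
    have P2 : 0 < 4 * N%:R ^+ 2 * ((4 * D) ^+ 3 / N%:R ^+ 3).
      by apply: mulr_gt0; [rewrite mulr_gt0 ?exprn_gt0 | rewrite divr_gt0 ?exprn_gt0 ?mulr_gt0].
    rewrite ler_pM2l ?mulr_gt0// lef_pV2 ?posrE//.
    apply: ler_pM => //; rewrite ?mulr_ge0 ?exprn_ge0 ?addr_ge0 ?(ltW m0) ?(ltW n1r0) ?(ltW n2r0)//.
    by rewrite ler_pdivlMr ?exprn_gt0.
  apply: (le_trans b2).
  have m2 : D <= 2 * N%:R * m%:R.
    by apply: (le_trans a3); rewrite ler_wpM2r ?(ltW m0)//; case/andP: n1r.
  have P : D ^+ 3 <= (2 * N%:R) ^+ 3 * m%:R ^+ 3.
    by rewrite -exprMn lerXn2r ?nnegrE ?mulr_ge0 ?(ltW m0) ?(ltW Nr0) ?(ltW D0).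
  have n12 : N%:R ^+ 2 <= n1%:R * n2%:R :> R.
    by move: n1r n2r => /andP[? ?] /andP[? ?]; rewrite expr2; apply: ler_pM => //; exact: ltW.
  have -> : 3 * x * (k / (n1%:R * n2%:R)) / m%:R ^+ 3 =
       3 * x * k / ((n1%:R * n2%:R) * m%:R ^+ 3).
    by field; rewrite !gt_eqF.
  have -> : 24 * 4 ^+ 4 * (k * l1) = 3 * x * k / (N%:R ^+ 2 * (D ^+ 3 / (2 * N%:R) ^+ 3)).
    by rewrite /l1; field; rewrite !gt_eqF.
  have P1 : 0 < n1%:R * n2%:R * m%:R ^+ 3 :> R by rewrite !mulr_gt0 ?exprn_gt0.
  have P2 : 0 < N%:R ^+ 2 * (D ^+ 3 / (2 * N%:R) ^+ 3).
    by apply: mulr_gt0; [rewrite exprn_gt0 | rewrite divr_gt0 ?exprn_gt0 ?mulr_gt0].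
  rewrite ler_pM2l ?mulr_gt0// lef_pV2 ?posrE//.
  apply: ler_pM => //; rewrite ?exprn_ge0 ?divr_ge0 ?exprn_ge0 ?mulr_ge0 ?(ltW Nr0) ?(ltW D0)//.
  by rewrite ler_pdivrMr ?exprn_gt0 ?mulr_gt0// mulrC.
apply: lerD; last first.
  rewrite ler_pM2l// lef_pV2 ?posrE ?sqrtr_gt0//.
  by apply: ler_wsqrtr; rewrite -[leLHS]mul1r ler_wpM2r// ltW.
have -> : 16 * (24 * 4 ^+ 4) * (D / N%:R) * Num.sqrt (4 * Q * l1) =
  8 * (24 * 4 ^+ 4) * (2 * (D / N%:R)) * Num.sqrt (4 * Q * l1) by ring.
have c0 : 0 <= 8 * (24 * 4 ^+ 4) :> R by rewrite !mulr_ge0// exprn_ge0.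
apply: ler_pM; rewrite ?sqrtr_ge0 ?mulr_ge0//; first by rewrite ler_wpM2l.
by apply: ler_wsqrtr; rewrite ler_wpM2r// ltW.
Qed.

End close_pairs.

Lemma square_range (n1 n2 N : nat) : (n1 < 2 * N)%N -> (n2 < 2 * N)%N ->
  (n1 * n2 <= 4 * N ^ 2)%N.
Proof.
move=> h1 h2; apply: leq_trans (leq_mul (ltnW h1) (ltnW h2)) _.
by rewrite mulnACA mulnn leqnn.
Qed.

Lemma factor_range (n m D : nat) : (0 < D)%N -> (D <= n * m)%N -> (n * m < 2 * D)%N ->
  (0 < m < 2 * D)%N.
Proof.
move=> D0 h1 h2; have : (0 < n * m)%N := leq_trans D0 h1.
rewrite muln_gt0 => /andP[n0 m0]; rewrite m0/=.
by apply: leq_ltn_trans h2; exact: leq_pmull.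
Qed.

Lemma interval_hi_le (lo hi M : nat) : (forall m, (lo <= m < hi)%N -> (m < M)%N) ->
  (lo < hi)%N -> (hi <= M)%N.
Proof.
by case: hi => // hi h hl; apply: h; rewrite leqnn andbT -ltnS.
Qed.

Lemma quotient_mul_le (D N : nat) : (2 * N <= D)%N -> ((2 * D %/ N).+1 * N <= 3 * D)%N.
Proof. by have := leq_divM (2 * D) N; lia. Qed.

Section type_two.
Context {R : realType}.

Lemma big_ord_interval (F : nat -> R) (M lo hi : nat) :
  \sum_(m < M | (lo <= m < hi)%N) F m = \sum_(lo <= m < minn hi M) F m.
Proof.
rewrite -(big_mkord (fun m => (lo <= m < hi)%N)).
rewrite [RHS](big_nat_widen _ _ M) ?geq_minr// [RHS](big_nat_widenl _ 0)//=.
rewrite big_nat_cond [RHS]big_nat_cond; apply: eq_bigl => m /=.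
by rewrite leq_min; case: (m < M)%N; rewrite ?andbF//= !andbT andbC.
Qed.

Lemma product_distance (h1 n1 h2 n2 N : nat) (Q : R) (T := N%:R ^+ 2 / Q) :
  0 < Q -> (0 < N)%N -> (N <= n1 < 2 * N)%N -> (N <= n2 < 2 * N)%N ->
  Num.truncn (T * (h1%:R / n1%:R)) = Num.truncn (T * (h2%:R / n2%:R)) ->
  (h1 * n2 <= h2 * n1 + Num.truncn (4 * Q))%N.
Proof.
move=> Q0 N0 /andP[n1N n1N2] /andP[n2N n2N2] eT.
have Nr : 0 < N%:R :> R by rewrite ltr0n.
have T0 : 0 < T by rewrite divr_gt0// exprn_gt0.
have n10 : 0 < n1%:R :> R by rewrite ltr0n (leq_trans N0).
have n20 : 0 < n2%:R :> R by rewrite ltr0n (leq_trans N0).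
have [h|h] := leqP (h1 * n2) (h2 * n1); first by rewrite (leq_trans h)// leq_addr.
rewrite -leq_subLR truncn_ge_nat ?mulr_ge0 ?(ltW Q0)// natrB 1?ltnW//.
have x1 : 0 <= T * (h1%:R / n1%:R) by rewrite mulr_ge0 ?(ltW T0)// divr_ge0.
have x2 : 0 <= T * (h2%:R / n2%:R) by rewrite mulr_ge0 ?(ltW T0)// divr_ge0.
have /andP[_ a1] := truncn_itv x1; have /andP[a2 _] := truncn_itv x2.
rewrite eT in a1.
have d : T * (h1%:R / n1%:R) - T * (h2%:R / n2%:R) < 1.
  by move: a1 a2; rewrite -natr1; lra.
have dE : T * (h1%:R / n1%:R) - T * (h2%:R / n2%:R) =
  T * ((h1 * n2)%:R - (h2 * n1)%:R) / (n1%:R * n2%:R).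
  by rewrite !natrM; field; rewrite !gt_eqF.
have n12 : 0 < n1%:R * n2%:R :> R by rewrite mulr_gt0.
rewrite dE ltr_pdivrMr// mul1r in d.
have n12' : n1%:R * n2%:R <= 4 * N%:R ^+ 2 :> R.
  by rewrite -natrM -natrX -natrM ler_nat; exact: square_range.
have : T * ((h1 * n2)%:R - (h2 * n1)%:R) < T * (4 * Q).
  apply: (lt_le_trans d); apply: (le_trans n12').
  by rewrite [leRHS](_ : _ = 4 * N%:R ^+ 2)// /T; field; rewrite gt_eqF.
by rewrite ltr_pM2l// => /ltW.
Qed.

(* Van der Corput's bound when the second differences lie between multiples of
   [x N / D ^ 3] and of [Q x N / D ^ 3]. *)
Definition close_bound (x D Q : R) (N : nat) : R :=
  16 * (24 * 4 ^+ 4) * (D / N%:R) * Num.sqrt (4 * Q * (x * N%:R / (4 ^+ 4 * D ^+ 3)))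
  + 16 / Num.sqrt (x * N%:R / (4 ^+ 4 * D ^+ 3)).

Lemma close_bound_ge0 x D Q N : 0 <= D -> 0 <= close_bound x D Q N.
Proof.
move=> D0; have a0 : 0 <= 16 * (24 * 4 ^+ 4) :> R by rewrite !mulr_ge0// exprn_ge0.
by rewrite addr_ge0 ?divr_ge0 ?sqrtr_ge0 ?mulr_ge0 ?sqrtr_ge0// ?divr_ge0.
Qed.

Section block.
Variables (x Q dl A : R) (D L N : nat) (lo hi : nat -> nat) (al sg a b : nat -> R).
Hypotheses (x0 : 0 < x) (D0 : (0 < D)%N) (dl01 : 0 <= dl <= 1) (L0 : (0 < L)%N)
  (N0 : (0 < N)%N) (ND : (2 * N <= D)%N) (A1 : 1 <= A) (Q1 : 1 <= Q) (QN : Q <= 2 * N%:R).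
Hypothesis seg : forall n m, (N <= n < 2 * N)%N -> (lo n <= m < hi n)%N ->
  (D <= n * m < 2 * D)%N /\ (48 * L <= m)%N.
Hypotheses (sg1 : forall h, `|sg h| <= 1)
  (bA : forall n, (N <= n < 2 * N)%N -> `|b n| <= A)
  (aA : forall m, (0 < m < 2 * D)%N -> `|a m| <= A)
  (tauA : forall v, (0 < v < 4 * (L * N))%N -> (tau v)%:R <= A).

Let M := (2 * D %/ N).+1.
Let phi (p : nat * nat) (m : nat) : R :=
  2 * pi * (x * p.1%:R / (p.2%:R * m%:R + dl)) + al p.1.
Let ch (p : nat * nat) (m : nat) := (lo p.2 <= m < hi p.2)%N.
Let r := [seq (h, n) | h <- index_iota L (2 * L), n <- index_iota N (2 * N)].
Let w (p : nat * nat) := sg p.1 * b p.2.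
(* Pairs [(h, n)] and [(h', n')] with the same integer part of [T * h / n] satisfy
   [|h n' - h' n| <= 4 Q]. *)
Let T : R := N%:R ^+ 2 / Q.
Let G := (Num.truncn (2 * (L * N)%:R / Q)).+1.
Let g (p : nat * nat) := (Num.truncn (T * (p.1%:R / p.2%:R)) %% G)%N.
Let a' m := if (0 < m < 2 * D)%N then a m else 0.
Let V p q := \sum_(m < M | ch p m && ch q m) cos (phi p m - phi q m).
Let B1 := close_bound x D%:R Q N.
Let K0 := Num.truncn (4 * Q).
Let close K (p q : nat * nat) : R :=
  ((p.1 * q.2 <= q.1 * p.2 + K)%N && (q.1 * p.2 <= p.1 * q.2 + K)%N)%:R.

Let A0 : 0 <= A. Proof. by apply: le_trans A1. Qed.
Let Q0 : 0 < Q. Proof. by apply: lt_le_trans Q1. Qed.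

Let rP p : p \in r -> (L <= p.1 < 2 * L)%N /\ (N <= p.2 < 2 * N)%N.
Proof. by move=> /allpairsP[[h n]] /= []; rewrite !mem_index_iota => ? ? ->. Qed.

Let sum_r (F : nat * nat -> R) :
  \sum_(p <- r) F p = \sum_(L <= h < 2 * L) \sum_(N <= n < 2 * N) F (h, n).
Proof. exact: big_allpairs_dep. Qed.

Let inner_le_M n m : (N <= n < 2 * N)%N -> (lo n <= m < hi n)%N -> (m < M)%N.
Proof.
move=> hn hm; have [/andP[_ h] _] := seg hn hm.
rewrite ltnS leq_divRL//; case/andP: hn => hn _.
by rewrite (leq_trans _ (ltnW h))// mulnC leq_mul2r hn orbT.
Qed.

Let sum_swap :
  \sum_(L <= h < 2 * L) sg h * \sum_(N <= n < 2 * N) b n *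
    \sum_(lo n <= m < hi n) a m * cos (2 * pi * (x * h%:R / (n%:R * m%:R + dl)) + al h) =
  \sum_(m < M) a' m * \sum_(p <- r) w p * (if ch p m then cos (phi p m) else 0).
Proof.
transitivity (\sum_(p <- r) \sum_(m < M) a' m * (w p * (if ch p m then cos (phi p m) else 0))).
  rewrite sum_r; apply: eq_bigr => h _; rewrite mulr_sumr.
  apply: eq_big_nat => n hn; rewrite mulrA mulr_sumr.
  have -> : \sum_(m < M) a' m * (w (h, n) * (if ch (h, n) m then cos (phi (h, n) m) else 0)) =
    \sum_(m < M | (lo n <= m < hi n)%N) sg h * b n * (a m *
       cos (2 * pi * (x * h%:R / (n%:R * m%:R + dl)) + al h)).
    rewrite [RHS]big_mkcond/=; apply: eq_bigr => m _; rewrite /ch /w /phi /=.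
    case: ifPn => hm; last by rewrite !mulr0.
    have [/andP[h1 h2] _] := seg hn hm; rewrite /a' ifT; first by ring.
    exact: factor_range h1 h2.
  rewrite (big_ord_interval (fun m => sg h * b n * (a m *
       cos (2 * pi * (x * h%:R / (n%:R * m%:R + dl)) + al h)))).
  have [h1|h1] := leqP (hi n) (lo n).
    by rewrite !big_geq// geq_min h1.
  rewrite (minn_idPl _)//.
  by apply: interval_hi_le h1 => m; exact: inner_le_M.
rewrite exchange_big/=; apply: eq_bigr => m _; by rewrite mulr_sumr.
Qed.

Let g_lt p : (g p < G)%N. Proof. exact: ltn_pmod. Qed.

Let gE p : p \in r -> g p = Num.truncn (T * (p.1%:R / p.2%:R)).
Proof.
move=> /rP[/andP[h1 h2] /andP[n1 n2]]; rewrite /g modn_small// ltnS.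
rewrite le_truncn// /T.
have nr : 0 < p.2%:R :> R by rewrite ltr0n (leq_trans N0).
have Nr : 0 < N%:R :> R by rewrite ltr0n.
have -> : 2 * (L * N)%:R / Q = N%:R ^+ 2 / Q * ((2 * L)%:R / N%:R).
  by rewrite !natrM; field; rewrite !gt_eqF.
apply: ler_wpM2l; first by rewrite divr_ge0 ?exprn_ge0// ltW.
rewrite ler_pM ?invr_ge0 ?ler_nat 1?ltnW//.
by rewrite lef_pV2 ?posrE// ler_nat.
Qed.

Let V_le_M p q : `|V p q| <= M%:R.
Proof.
apply: (le_trans (ler_norm_sum _ _ _)).
rewrite -[X in _ <= X%:R]card_ord -sumr_const big_mkcond/=; apply: ler_sum => m _.
by case: ifP => _ //; exact: cos_max.
Qed.

Let V_sym p q : V p q = V q p.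
Proof.
rewrite /V; apply: eq_big => m; first by rewrite andbC.
by move=> _; rewrite -cosN opprB.
Qed.

Let V_close p q : p \in r -> q \in r -> g p = g q ->
  (q.1 * p.2 < p.1 * q.2)%N -> `|V p q| <= B1.
Proof.
move=> pr qr; rewrite !gE// => gpq hk.
have [ph pn] := rP pr; have [qh qn] := rP qr.
have hK := product_distance Q0 N0 pn qn gpq.
have -> : V p q = \sum_(maxn (lo p.2) (lo q.2) <= m < minn (minn (hi p.2) (hi q.2)) M)
    cos (phi p m - phi q m).
  rewrite -(big_ord_interval (fun m => cos (phi p m - phi q m))) /V /ch.
  by apply: eq_bigl => m; rewrite geq_max leq_min andbACA.
have segr n m : n = p.2 \/ n = q.2 ->
    (maxn (lo p.2) (lo q.2) <= m < minn (minn (hi p.2) (hi q.2)) M)%N ->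
    D%:R <= (n%:R : R) * m%:R < 2 * D%:R /\ (48 * L <= m)%N.
  rewrite geq_max !leq_min => hn /andP[/andP[m1 m2] /andP[/andP[m3 m4] _]].
  have nN : (N <= n < 2 * N)%N by case: hn => ->.
  have hm : (lo n <= m < hi n)%N by case: hn => ->; apply/andP.
  have [/andP[h1 h2] h3] := seg nN hm.
  by split=> //; rewrite -!natrM ler_nat ltr_nat h1.
have kQ : (p.1 * q.2)%:R - (q.1 * p.2)%:R <= 4 * Q.
  rewrite -natrB 1?ltnW//; apply: (@le_trans _ _ K0%:R).
    by rewrite ler_nat leq_subLR.
  by rewrite truncn_le mulr_ge0// ltW.
rewrite /phi.
have pos (u : nat) : (L <= u < 2 * L)%N -> (0 < u < 2 * L)%N.
  by move=> /andP[u1 ->]; rewrite (leq_trans L0).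
apply: (@close_pair_sum R x D%:R Q dl (al p.1) (al q.1) L N) => //.
- by rewrite ler1n.
- by rewrite -natrM ler_nat.
- by case/andP: (pos _ ph).
- exact: pos.
- by move=> m hm; have [] := segr p.2 m (or_introl erefl) hm.
- by move=> m hm; have [] := segr q.2 m (or_intror erefl) hm.
- by move=> m hm; have [] := segr q.2 m (or_intror erefl) hm.
Qed.

Let V_bound p q : p \in r -> q \in r -> g p = g q ->
  `|V p q| <= M%:R * close 0 p q + B1 * close K0 p q.
Proof.
move=> pr qr gpq; have gpq' := gpq; rewrite !gE// in gpq'.
have [_ pn] := rP pr; have [_ qn] := rP qr.
have B10 : 0 <= B1 by apply: close_bound_ge0.
have -> : close K0 p q = 1.
  rewrite /close (product_distance Q0 N0 pn qn gpq').
  by rewrite (product_distance Q0 N0 qn pn (esym gpq')).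
rewrite mulr1.
have [h|h|h] := ltngtP (p.1 * q.2)%N (q.1 * p.2)%N.
- rewrite V_sym; apply: (le_trans (V_close qr pr (esym gpq) _)) => //.
  by rewrite lerDr mulr_ge0// /close ler0n.
- apply: (le_trans (V_close pr qr gpq h)).
  by rewrite lerDr mulr_ge0// /close ler0n.
- rewrite /close h addn0 leqnn/= mulr1; apply: (le_trans (V_le_M p q)).
  by rewrite lerDl.
Qed.

Let w_le p : p \in r -> `|w p| <= A.
Proof.
move=> /rP[_ hn]; rewrite /w normrM -[leRHS]mul1r.
by apply: ler_pM; rewrite ?normr_ge0 ?sg1 ?bA.
Qed.

Let sum_close K : \sum_(p <- r) \sum_(q <- r) close K p q <=
  (L * N)%:R * ((2 * K + 1)%:R * A).
Proof.
have -> : \sum_(p <- r) \sum_(q <- r) close K p q =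
  \sum_(L <= h1 < 2 * L) \sum_(N <= n2 < 2 * N) \sum_(L <= h2 < 2 * L) \sum_(N <= n1 < 2 * N)
   ((h1 * n2 <= h2 * n1 + K)%N && (h2 * n1 <= h1 * n2 + K)%N)%:R.
  rewrite sum_r; apply: eq_bigr => h1 _.
  under eq_bigr do rewrite sum_r.
  transitivity (\sum_(N <= n1 < 2 * N) \sum_(N <= n2 < 2 * N) \sum_(L <= h2 < 2 * L)
    close K (h1, n1) (h2, n2)).
    by apply: eq_bigr => n1 _; exact: exchange_big.
  rewrite exchange_big/=; apply: eq_bigr => n2 _; exact: exchange_big.
apply: (@le_trans _ _ (\sum_(L <= h1 < 2 * L) \sum_(N <= n2 < 2 * N) ((2 * K + 1)%:R * A))).
  apply: ler_sum => h1 _; apply: ler_sum => n2 _.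
  exact: count_close_products.
rewrite !sumr_const_nat -[leLHS]mulr_natl -[X in _ * X <= _]mulr_natl mulrA -natrM.
rewrite !mulrA -!natrM; apply: ler_wpM2r => //.
by rewrite ler_nat !mul2n -!addnn !addnK mulnA leqnn.
Qed.

Let pair_sum_bound :
  \sum_(p <- r) \sum_(q <- r | g p == g q) `|w p| * `|w q| * `|V p q| <=
  A ^+ 3 * (L * N)%:R * (M%:R + (2 * K0 + 1)%:R * B1).
Proof.
have B10 : 0 <= B1 by apply: close_bound_ge0.
apply: (@le_trans _ _ (\sum_(p <- r) \sum_(q <- r)
   A ^+ 2 * (M%:R * close 0 p q + B1 * close K0 p q))).
  rewrite big_seq [leRHS]big_seq; apply: ler_sum => p pr.
  rewrite big_mkcond big_seq [leRHS]big_seq; apply: ler_sum => q qr.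
  case: eqP => [gpq|_].
    by rewrite ler_pM ?V_bound// expr2 ler_pM ?w_le.
  by rewrite mulr_ge0 ?sqr_ge0// addr_ge0// mulr_ge0// /close ler0n.
have -> : \sum_(p <- r) \sum_(q <- r) A ^+ 2 * (M%:R * close 0 p q + B1 * close K0 p q) =
  A ^+ 2 * (M%:R * (\sum_(p <- r) \sum_(q <- r) close 0 p q) +
    B1 * (\sum_(p <- r) \sum_(q <- r) close K0 p q)).
  rewrite !mulr_sumr -big_split/= mulr_sumr; apply: eq_bigr => p _.
  by rewrite !mulr_sumr -big_split/= mulr_sumr; apply: eq_bigr => q _.
have -> : A ^+ 3 * (L * N)%:R * (M%:R + (2 * K0 + 1)%:R * B1) =
  A ^+ 2 * (M%:R * ((L * N)%:R * ((2 * 0 + 1)%:R * A)) + B1 * ((L * N)%:R * ((2 * K0 + 1)%:R * A))).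
  by rewrite muln0 add0n; ring.
by rewrite ler_wpM2l ?sqr_ge0// lerD// ler_wpM2l// sum_close.
Qed.

Let sum_a' : \sum_(m < M) a' m ^+ 2 <= M%:R * A ^+ 2.
Proof.
rewrite -[X in _ <= X%:R * _]card_ord mulr_natl -sumr_const; apply: ler_sum => m _.
rewrite /a'; case: ifP => hm; last by rewrite expr0n/= sqr_ge0.
by rewrite -real_normK ?num_real// !expr2 ler_pM// aA.
Qed.

Lemma type_two_block :
  (\sum_(L <= h < 2 * L) sg h * \sum_(N <= n < 2 * N) b n *
    \sum_(lo n <= m < hi n) a m * cos (2 * pi * (x * h%:R / (n%:R * m%:R + dl)) + al h)) ^+ 2 <=
  A ^+ 5 * L%:R ^+ 2 * (36 * (D%:R ^+ 2 / Q) + 108 * (D%:R * N%:R * B1)).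
Proof.
have B10 : 0 <= B1 by apply: close_bound_ge0.
have Nr : 0 < N%:R :> R by rewrite ltr0n.
have Lr : 1 <= L%:R :> R by rewrite ler1n.
rewrite sum_swap.
apply: (le_trans (bilinear_class_bound r w ch phi M a' g_lt)).
apply: (@le_trans _ _ ((G%:R * (M%:R * A ^+ 2)) *
   (A ^+ 3 * (L * N)%:R * (M%:R + (2 * K0 + 1)%:R * B1)))).
  apply: ler_pM.
  - by rewrite mulr_ge0// sumr_ge0// => m _; exact: sqr_ge0.
  - apply: sumr_ge0 => p _; apply: sumr_ge0 => q _; exact: mulr_ge0.
  - by rewrite ler_wpM2l.
  - exact: pair_sum_bound.
have hM : M%:R <= 3 * (D%:R / N%:R) :> R.
  rewrite mulrA ler_pdivlMr// -natrM -natrM ler_nat; exact: quotient_mul_le.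
have hG : G%:R <= 4 * (L%:R * N%:R / Q).
  rewrite /G -natr1.
  have h1 : (Num.truncn (2 * (L * N)%:R / Q))%:R <= 2 * (L%:R * N%:R / Q) :> R.
    have -> : 2 * (L%:R * N%:R / Q) = 2 * (L * N)%:R / Q by rewrite natrM; ring.
    by rewrite truncn_le divr_ge0 ?mulr_ge0// ltW.
  have h2 : 1 <= 2 * (L%:R * N%:R / Q).
    by rewrite mulrA ler_pdivlMr// mul1r; apply: (le_trans QN); nra.
  lra.
have hK : (2 * K0 + 1)%:R <= 9 * Q.
  rewrite natrD natrM.
  have : K0%:R <= 4 * Q by rewrite truncn_le mulr_ge0// ltW.
  by have := Q1; lra.
have -> : A ^+ 5 * L%:R ^+ 2 * (36 * (D%:R ^+ 2 / Q) + 108 * (D%:R * N%:R * B1)) =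
   (4 * (L%:R * N%:R / Q) * (3 * (D%:R / N%:R) * A ^+ 2)) *
   (A ^+ 3 * (L * N)%:R * (3 * (D%:R / N%:R) + 9 * Q * B1)).
  by rewrite natrM; field; rewrite !gt_eqF.
have MDN : 0 <= 3 * (D%:R / N%:R) :> R by rewrite mulr_ge0 ?divr_ge0.
apply: ler_pM; rewrite ?mulr_ge0 ?addr_ge0 ?exprn_ge0 ?mulr_ge0//.
  by apply: ler_pM => //; rewrite ?mulr_ge0 ?sqr_ge0// ler_wpM2r ?sqr_ge0.
apply: ler_wpM2l; first by rewrite mulr_ge0 ?exprn_ge0.
by rewrite lerD// ler_wpM2r.
Qed.

End block.
End type_two.

Section type_two_sums.
Context {R : realType}.

(* [A] stands for a small power of [x]. *)
Definition subpoly_bound (x A : R) :=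
  [/\ 1 <= A, forall v : nat, (0 < v)%N -> v%:R <= x -> (tau v)%:R <= A,
      forall v : nat, (0 < v)%N -> v%:R <= x -> ln v%:R <= A &
      forall J : nat, 2 ^+ J <= x -> J.+3%:R <= A].

Lemma close_bound_le : exists2 C : R, 0 <= C &
  forall (y D : R) (N : nat), 1 <= y -> y ^+ 9 <= D <= y ^+ 10 -> (0 < N)%N -> N%:R <= 2 * y ^+ 5 ->
  D * N%:R * close_bound (y ^+ 19) D (D ^+ 2 / y ^+ 18) N <= C * y ^+ 18.
Proof.
pose C0 : R := 16 * (24 * 4 ^+ 4).
have C00 : 0 <= C0 by rewrite !mulr_ge0// exprn_ge0.
exists (C0 + 16 * 32); first by rewrite addr_ge0// mulr_ge0.
move=> y D N y1 /andP[yD Dy] N0 Ny.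
have y0 : 0 < y by lra.
have D0 : 0 < D by apply: lt_le_trans yD; rewrite exprn_gt0.
have Nr : 0 < N%:R :> R by rewrite ltr0n.
have sq (z w : R) : 0 <= w -> z <= w ^+ 2 -> Num.sqrt z <= w.
  by move=> w0 zw; rewrite -(ger0_norm w0) -sqrtr_sqr; exact: ler_wsqrtr.
rewrite /close_bound -/C0.
set l1 := y ^+ 19 * N%:R / _.
have l10 : 0 < l1 by rewrite divr_gt0 ?mulr_gt0 ?exprn_gt0.
have s0 : 0 < Num.sqrt l1 by rewrite sqrtr_gt0.
have D3 : D ^+ 3 <= (y ^+ 10) ^+ 3 by rewrite lerXn2r ?nnegrE ?exprn_ge0 ?(ltW D0) ?(ltW y0).
have D5 : D ^+ 5 <= (y ^+ 10) ^+ 5 by rewrite lerXn2r ?nnegrE ?exprn_ge0 ?(ltW D0) ?(ltW y0).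
have e1 : D ^+ 2 * Num.sqrt (4 * (D ^+ 2 / y ^+ 18) * l1) <= y ^+ 18.
  rewrite -[D ^+ 2]ger0_norm ?sqr_ge0// -sqrtr_sqr -sqrtrM ?sqr_ge0//.
  apply: sq; first by rewrite exprn_ge0// ltW.
  rewrite sqrtr_sqr ger0_norm ?sqr_ge0//.
  have -> : (D ^+ 2) ^+ 2 * (4 * (D ^+ 2 / y ^+ 18) * l1) = D ^+ 3 * (y * N%:R) * 4 ^- 3.
    by rewrite /l1; field; rewrite !gt_eqF.
  apply: (@le_trans _ _ ((y ^+ 10) ^+ 3 * (y * (2 * y ^+ 5)) * 4 ^- 3)).
    rewrite ler_wpM2r ?invr_ge0 ?exprn_ge0//.
    apply: ler_pM; rewrite ?mulr_ge0 ?exprn_ge0 ?(ltW D0) ?(ltW y0)//.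
    by rewrite ler_wpM2l// ltW.
  have -> : (y ^+ 10) ^+ 3 * (y * (2 * y ^+ 5)) * 4 ^- 3 = (y ^+ 18) ^+ 2 / 32 by field.
  by rewrite ler_pdivrMr// ler_peMr ?sqr_ge0// ler1n.
have e2 : D * N%:R / Num.sqrt l1 <= 32 * y ^+ 18.
  rewrite ler_pdivrMr// -(ler_pXn2r (ltn0Sn 1))
    ?nnegrE ?mulr_ge0 ?exprn_ge0 ?(ltW D0) ?(ltW Nr) ?(ltW s0) ?(ltW y0)//.
  rewrite [leRHS]exprMn sqr_sqrtr ?(ltW l10)//.
  have -> : (32 * y ^+ 18) ^+ 2 * l1 = 4 * (y ^+ 10) ^+ 5 * (y ^+ 5 * N%:R) / D ^+ 3.
    by rewrite /l1; field; rewrite !gt_eqF.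
  rewrite ler_pdivlMr ?exprn_gt0//.
  have -> : (D * N%:R) ^+ 2 * D ^+ 3 = D ^+ 5 * (N%:R * N%:R) by ring.
  have NN : N%:R * N%:R <= 2 * (y ^+ 5 * N%:R) :> R by rewrite mulrA; apply: ler_wpM2r.
  have X0 : 0 <= (y ^+ 10) ^+ 5 * (y ^+ 5 * N%:R).
    by rewrite !mulr_ge0 ?exprn_ge0 ?(ltW y0).
  apply: (@le_trans _ _ ((y ^+ 10) ^+ 5 * (2 * (y ^+ 5 * N%:R)))).
    by apply: ler_pM; rewrite ?mulr_ge0 ?exprn_ge0 ?(ltW D0).
  have -> : 4 * (y ^+ 10) ^+ 5 * (y ^+ 5 * N%:R) = 4 * ((y ^+ 10) ^+ 5 * (y ^+ 5 * N%:R)).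
    by rewrite [RHS]mulrA.
  rewrite mulrCA; move: (_ * _) X0 => X X0; lra.
have -> : D * N%:R * (C0 * (D / N%:R) * Num.sqrt (4 * (D ^+ 2 / y ^+ 18) * l1) + 16 / Num.sqrt l1) =
  C0 * (D ^+ 2 * Num.sqrt (4 * (D ^+ 2 / y ^+ 18) * l1)) + 16 * (D * N%:R / Num.sqrt l1).
  by field; rewrite !gt_eqF.
rewrite [leRHS]mulrDl; apply: lerD; first by rewrite ler_wpM2l.
by rewrite -[leRHS]mulrA ler_wpM2l.
Qed.

Lemma sum_dyadic (V : nmodType) (f : nat -> V) J :
  \sum_(1 <= n < 2 ^ J) f n = \sum_(j < J) \sum_(2 ^ j <= n < 2 * 2 ^ j) f n.
Proof.
elim: J => [|J IH]; first by rewrite big_geq// big_ord0.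
rewrite big_ord_recr/= -IH -expnS (@big_cat_nat _ _ _ (2 ^ J))//= ?expn_gt0//.
by rewrite leq_exp2l.
Qed.

(* The long variable [m] runs over [n + i <= m] and [D <= n * m < E]; the offsets [i = 0] and
   [i = 1] separate the two orderings of a factorization. *)
Definition long_lo (D i n : nat) := maxn (n + i) (D.-1 %/ n).+1.
Definition long_hi (E n : nat) := (E.-1 %/ n).+1.

Lemma long_segment (D E i n m : nat) : (0 < n)%N -> (0 < D)%N ->
  (long_lo D i n <= m < long_hi E n)%N = (n + i <= m)%N && (D <= n * m < E)%N.
Proof.
move=> n0 D0; rewrite /long_lo /long_hi geq_max -andbA.
rewrite ltn_divLR// (mulnC m) prednK//; congr (_ && _).
have [mE|] := boolP (D <= n * m)%N; rewrite /= ?mE ?(negPf _)//.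
case: E => [|E]; last by rewrite ltnS leq_divRL// mulnC.
rewrite div0n ltn0 ltnS leqn0; apply/negbTE; rewrite -lt0n.
by move: (leq_trans D0 mE); rewrite muln_gt0 => /andP[].
Qed.

(* With [n <= m] and [n * m < 2 * D] the short variable [n] is at most [2 * y ^+ 5], and
   the long variable dominates the frequencies [h < 2 * L]. *)
Lemma type_two_block_y : exists2 C : R, 0 <= C &
  forall (y A dl : R) (D E L N i : nat) (al sg a b : nat -> R),
  2 ^+ 12 <= y -> subpoly_bound (y ^+ 19) A -> 0 <= dl <= 1 ->
  y ^+ 9 <= D%:R <= y ^+ 10 -> (E <= 2 * D)%N -> (0 < L)%N -> L%:R <= y ^+ 4 ->
  y ^+ 2 <= 2 * N%:R ->
  (forall h, `|sg h| <= 1) -> (forall n, (N <= n < 2 * N)%N -> `|b n| <= A) ->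
  (forall m, (0 < m < 2 * D)%N -> `|a m| <= A) ->
  `|\sum_(L <= h < 2 * L) sg h * \sum_(N <= n < 2 * N) b n *
    \sum_(long_lo D i n <= m < long_hi E n) a m *
       cos (2 * pi * (y ^+ 19 * h%:R / (n%:R * m%:R + dl)) + al h)| <=
  C * A ^+ 3 * L%:R * y ^+ 9.
Proof.
have [C0 C00 hC0] := close_bound_le.
pose C : R := 36 + 108 * C0.
have C1 : 1 <= C by rewrite /C; lra.
exists C; first by lra.
move=> y A dl D E L N i al sg a b y9 [A1 tauA _ _] dl01 hD ED L0 Ly yN sg1 bA aA.
have y1 : 1 <= y by apply: le_trans y9; apply: exprn_ege1; rewrite ler1n.
have y0 : 0 < y by lra.
have N0 : (0 < N)%N.
  by rewrite -(ltr0n R) -(@pmulr_rgt0 _ 2)//; apply: lt_le_trans yN; rewrite exprn_gt0.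
have D0 : (0 < D)%N.
  by rewrite -(ltr0n R); case/andP: hD => h _; apply: lt_le_trans h; rewrite exprn_gt0.
have A0 : 0 <= A by lra.
have rhs0 : 0 <= C * A ^+ 3 * L%:R * y ^+ 9.
  by rewrite !mulr_ge0 ?exprn_ge0 ?(ltW y0)//; lra.
have [hNy|hNy] := lerP N%:R (2 * y ^+ 5); last first.
  rewrite big1 ?normr0// => h _; rewrite big_nat_cond big1 ?mulr0// => n /andP[/andP[n1 n2] _].
  rewrite big_nat_cond big1 ?mulr0// => m; rewrite andbT long_segment//; last exact: leq_trans n1.
  move=> /andP[h1 /andP[_ h2]]; exfalso.
  have : (N * N)%:R <= 2 * D%:R :> R.
    rewrite -natrM ler_nat; apply: leq_trans ED; apply: ltnW; apply: leq_ltn_trans h2.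
    by apply: leq_mul => //; apply: leq_trans n1 _; apply: leq_trans h1; exact: leq_addr.
  case/andP: hD => _ hD; apply/negP; rewrite -ltNge.
  apply: (@le_lt_trans _ _ (2 * y ^+ 10)); first by rewrite ler_pM2l.
  rewrite natrM; apply: (@lt_trans _ _ (2 * y ^+ 5 * (2 * y ^+ 5))).
    have -> : 2 * y ^+ 5 * (2 * y ^+ 5) = 4 * y ^+ 10 by ring.
    by rewrite ltr_pM2r ?exprn_gt0// ltr_nat.
  by apply: ltr_pM; rewrite ?mulr_ge0 ?exprn_ge0 ?(ltW y0).
have ND : (2 * N <= D)%N.
  rewrite -(ler_nat R) natrM; case/andP: hD => hD _; apply: le_trans hD.
  apply: (@le_trans _ _ (4 * y ^+ 5)); first by lra.
  have -> : y ^+ 9 = y ^+ 4 * y ^+ 5 by ring.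
  rewrite ler_wpM2r ?exprn_ge0 ?(ltW y0)//.
  apply: (@le_trans _ _ y); last by rewrite ler_eXnr.
  by apply: le_trans y9; rewrite -natrX ler_nat.
have LD : ((48 * L) ^ 2 <= D)%N.
  apply: (@leq_trans ((64 * L) ^ 2)); first by rewrite leq_exp2r// leq_mul2r orbT.
  rewrite -(ler_nat R) natrX natrM; case/andP: hD => hD _; apply: le_trans hD.
  apply: (@le_trans _ _ ((64 * y ^+ 4) ^+ 2)).
    by rewrite lerXn2r ?nnegrE ?mulr_ge0 ?exprn_ge0 ?(ltW y0)// ler_wpM2l.
  have -> : (64 * y ^+ 4) ^+ 2 = 2 ^+ 12 * y ^+ 8 by ring.
  have -> : y ^+ 9 = y * y ^+ 8 by ring.
  by rewrite ler_wpM2r ?exprn_ge0 ?(ltW y0).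
have seg n m : (N <= n < 2 * N)%N -> (long_lo D i n <= m < long_hi E n)%N ->
    (D <= n * m < 2 * D)%N /\ (48 * L <= m)%N.
  move=> /andP[n1 _]; rewrite long_segment//; last exact: leq_trans n1.
  move=> /andP[h1 /andP[h2 h3]]; rewrite h2 (leq_trans h3)//; split=> //.
  rewrite -(@leq_exp2r _ _ 2)//; apply: (leq_trans LD); apply: (leq_trans h2).
  by rewrite -mulnn leq_mul2r (leq_trans _ h1) ?orbT// leq_addr.
have tauA' v : (0 < v < 4 * (L * N))%N -> (tau v)%:R <= A.
  move=> /andP[v0 v1]; apply: tauA => //.
  apply: (@le_trans _ _ (4 * (L * N))%:R); first by rewrite ler_nat ltnW.
  rewrite !natrM; apply: (@le_trans _ _ (4 * (y ^+ 4 * (2 * y ^+ 5)))).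
    by rewrite ler_wpM2l//; apply: ler_pM.
  have -> : 4 * (y ^+ 4 * (2 * y ^+ 5)) = 2 ^+ 3 * y ^+ 9 by ring.
  have -> : y ^+ 19 = y ^+ 10 * y ^+ 9 by ring.
  rewrite ler_wpM2r ?exprn_ge0 ?(ltW y0)//.
  apply: (@le_trans _ _ (2 ^+ 12)); first by apply: ler_weXn2l; rewrite ?ler1n.
  by apply: (le_trans y9); rewrite ler_eXnr.
pose Q : R := D%:R ^+ 2 / y ^+ 18.
have Dr0 : 0 < D%:R :> R by rewrite ltr0n.
have Q1 : 1 <= Q.
  rewrite ler_pdivlMr ?exprn_gt0// mul1r.
  have -> : y ^+ 18 = (y ^+ 9) ^+ 2 by ring.
  by rewrite lerXn2r ?nnegrE ?exprn_ge0 ?(ltW y0)//; case/andP: hD.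
have QN : Q <= 2 * N%:R.
  apply: le_trans yN; rewrite ler_pdivrMr ?exprn_gt0//.
  have -> : y ^+ 2 * y ^+ 18 = (y ^+ 10) ^+ 2 by ring.
  by rewrite lerXn2r ?nnegrE ?exprn_ge0 ?(ltW y0)//; case/andP: hD.
have x0 : 0 < y ^+ 19 by rewrite exprn_gt0.
have h2 := type_two_block al x0 D0 dl01 L0 N0 ND A1 Q1 QN seg sg1 bA aA tauA'.
rewrite -(ler_pXn2r (ltn0Sn 1)) ?nnegrE// real_normK ?num_real//.
apply: (le_trans h2).
have h3 := hC0 y D%:R N y1 hD N0 hNy; rewrite -/Q in h3.
have -> : D%:R ^+ 2 / Q = y ^+ 18.
  by rewrite /Q; field; rewrite !gt_eqF.
have -> : (C * A ^+ 3 * L%:R * y ^+ 9) ^+ 2 = A ^+ 6 * L%:R ^+ 2 * (C ^+ 2 * y ^+ 18) by ring.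
apply: ler_pM; rewrite ?mulr_ge0 ?exprn_ge0//.
- by rewrite addr_ge0 ?mulr_ge0 ?exprn_ge0 ?(ltW y0)// close_bound_ge0.
- by rewrite ler_wpM2r ?exprn_ge0//; apply: ler_weXn2l.
- apply: (@le_trans _ _ (C * y ^+ 18)).
    by rewrite /C; lra.
  by rewrite ler_wpM2r ?exprn_ge0 ?(ltW y0)// expr2 ler_peMr//; lra.
Qed.

End type_two_sums.

Section type_two_total.
Context {R : realType}.

Lemma sum_phase_long (T dl al : R) (D E i n : nat) (a : nat -> R) : (0 < n)%N -> (0 < D)%N ->
  \sum_(1 <= m < E) (if (n + i <= m)%N then a m * phase T dl al D E (n * m) else 0) =
  \sum_(long_lo D i n <= m < long_hi E n) a m * cos (2 * pi * (T / (n%:R * m%:R + dl)) + al).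
Proof.
move=> n0 D0.
transitivity (\sum_(m < E | (long_lo D i n <= m < long_hi E n)%N)
    a m * cos (2 * pi * (T / (n%:R * m%:R + dl)) + al)).
  rewrite -(big_mkord (fun m => (long_lo D i n <= m < long_hi E n)%N)
    (fun m => a m * cos (2 * pi * (T / (n%:R * m%:R + dl)) + al))).
  rewrite [RHS]big_mkcond/=; case: (E) => [|e]; first by rewrite !big_geq.
  rewrite [RHS]big_ltn// [X in X + _]ifF ?add0r; last first.
    by rewrite long_segment// muln0 [(D <= 0)%N]leqNgt D0 andbF.
  apply: eq_bigr => m _; rewrite long_segment// /phase natrM.
  by case: (n + i <= m)%N => //=; case: ifP; rewrite ?mulr0.
rewrite (big_ord_interval (fun m => a m * cos (2 * pi * (T / (n%:R * m%:R + dl)) + al))).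
case: (posnP E) => [->|E0].
  by rewrite minn0 !big_geq// /long_hi div0n /long_lo leq_max orbT.
rewrite (minn_idPl _)// /long_hi; apply: leq_ltn_trans (leq_div _ _) _.
by rewrite prednK.
Qed.

Lemma type_two_dyadic_sum : exists2 C : R, 0 <= C &
  forall (y A dl : R) (D E U L J i : nat) (al sg a b : nat -> R),
  2 ^+ 12 <= y -> subpoly_bound (y ^+ 19) A -> 0 <= dl <= 1 ->
  y ^+ 9 <= D%:R <= y ^+ 10 -> (E <= 2 * D)%N -> (0 < L)%N -> L%:R <= y ^+ 4 ->
  y ^+ 2 <= U.+1%:R -> (E <= 2 ^ J)%N -> J%:R <= A ->
  (forall h, `|sg h| <= 1) -> (forall n, (n <= U)%N -> b n = 0) ->
  (forall n, (0 < n < 2 * D)%N -> `|b n| <= A) ->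
  (forall m, (0 < m < 2 * D)%N -> `|a m| <= A) ->
  `|\sum_(L <= h < 2 * L) sg h * \sum_(1 <= n < E) b n *
     \sum_(1 <= m < E) (if (n + i <= m)%N
       then a m * phase (y ^+ 19 * h%:R) dl (al h) D E (n * m) else 0)| <=
  C * A ^+ 4 * L%:R * y ^+ 9.
Proof.
have [C C0 hC] := type_two_block_y (R := R); exists C => //.
move=> y A dl D E U L J i al sg a b y9 hA dl01 hD ED L0 Ly yU EJ JA sg1 bU bA aA.
have D0 : (0 < D)%N.
  rewrite -(ltr0n R); case/andP: hD => h _; apply: lt_le_trans h; rewrite exprn_gt0//.
  by apply: lt_le_trans y9; rewrite exprn_gt0.
have A0 : 0 <= A by case: hA => A1 _ _ _; apply: le_trans A1.
have y0 : 0 <= y by apply: le_trans y9; rewrite exprn_ge0.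
pose b' n := if (n < E)%N then b n else 0.
pose Bk h n := b' n * \sum_(long_lo D i n <= m < long_hi E n) a m *
   cos (2 * pi * (y ^+ 19 * h%:R / (n%:R * m%:R + dl)) + al h).
have -> : \sum_(L <= h < 2 * L) sg h * \sum_(1 <= n < E) b n *
     \sum_(1 <= m < E) (if (n + i <= m)%N
       then a m * phase (y ^+ 19 * h%:R) dl (al h) D E (n * m) else 0) =
   \sum_(j < J) \sum_(L <= h < 2 * L) sg h * \sum_(2 ^ j <= n < 2 * 2 ^ j) Bk h n.
  rewrite exchange_big/=; apply: eq_bigr => h _; rewrite -mulr_sumr; congr (_ * _).
  rewrite -sum_dyadic.
  transitivity (\sum_(1 <= n < E) Bk h n).
    apply: eq_big_nat => n /andP[n0 nE]; rewrite /Bk /b' nE; congr (_ * _).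
    exact: sum_phase_long.
  have [E1|E1] := leqP E 1.
    rewrite big_geq// big_nat_cond big1// => n /andP[/andP[n1 _] _].
    by rewrite /Bk /b' ltnNge (leq_trans E1 n1) mul0r.
  rewrite [RHS](@big_cat_nat _ _ _ E)//=; last exact: ltnW.
  rewrite [X in _ + X]big_nat_cond [X in _ + X]big1 ?addr0// => n /andP[/andP[n1 _] _].
  by rewrite /Bk /b' ltnNge n1 mul0r.
apply: (le_trans (ler_norm_sum _ _ _)).
apply: (@le_trans _ _ (\sum_(j < J) C * A ^+ 3 * L%:R * y ^+ 9)); last first.
  rewrite sumr_const card_ord -[leLHS]mulr_natr.
  have -> : C * A ^+ 4 * L%:R * y ^+ 9 = C * A ^+ 3 * L%:R * y ^+ 9 * A by ring.
  by rewrite ler_wpM2l// !mulr_ge0// exprn_ge0.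
apply: ler_sum => j _.
have [hj|hj] := leqP (2 * 2 ^ j) U.
  rewrite big1 ?normr0; first by rewrite !mulr_ge0// exprn_ge0.
  move=> h _; rewrite big_nat_cond big1 ?mulr0// => n /andP[/andP[_ n2] _].
  by rewrite /Bk /b' bU ?if_same ?mul0r// ltnW// (leq_trans n2).
apply: hC => //.
- by apply: (le_trans yU); rewrite -natrM ler_nat.
- move=> n /andP[n1 _]; rewrite /b'; case: ifP => nE; last by rewrite normr0.
  apply: bA; rewrite (leq_trans nE)// andbT; apply: leq_trans n1.
  by rewrite expn_gt0.
Qed.

Lemma moebius_tail_eq0 V m : (0 < m)%N -> (m <= V)%N -> moebius_tail V m = 0 :> R.
Proof.
move=> m0 mV; rewrite /moebius_tail big_seq big1// => d; rewrite -dvdn_divisors// => dm.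
by rewrite /moebius_gt ltnNge (leq_trans (dvdn_leq m0 dm) mV).
Qed.

Lemma type_two_split (F : nat -> R) (U E : nat) :
  \sum_(1 <= c < E | (U < c)%N) vonMangoldt R c *
    (\sum_(1 <= m < E) moebius_tail U m * F (c * m)%N) =
  \sum_(1 <= n < E) (if (U < n)%N then vonMangoldt R n else 0) *
    (\sum_(1 <= m < E) (if (n + 0 <= m)%N then (moebius_tail U m) * F (n * m)%N else 0)) +
  \sum_(1 <= n < E) moebius_tail U n *
    (\sum_(1 <= m < E) (if (n + 1 <= m)%N then
       (if (U < m)%N then vonMangoldt R m else 0) * F (n * m)%N else 0)).
Proof.
under [X in _ + X]eq_bigr do rewrite mulr_sumr.
rewrite [X in _ + X]exchange_big/= -big_split/= big_mkcond/=; apply: eq_bigr => c _.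
case: ifPn => Uc; last first.
  rewrite mul0r add0r big1// => m _; case: ifP => _; rewrite ?mul0r ?mulr0//.
rewrite mulr_sumr -[RHS]/(_ + _) mulr_sumr -big_split/=; apply: eq_bigr => m _.
rewrite addn0 addn1 (mulnC m c); case: ltnP => _; rewrite ?mulr0 ?addr0 ?add0r//.
by ring.
Qed.

End type_two_total.

(** * The sawtooth function weighted by the von Mangoldt function *)

Section sawtooth_sum.
Context {R : realType}.

(* The frequencies [h] with [eta * h > 1] are damped by [saw_weight], whence the factor
   [1 + eta * h]. *)
Lemma type_one_size : exists2 C : R, 0 <= C &
  forall (y A dl al : R) (D E U h : nat),
  2 ^+ 12 <= y -> subpoly_bound (y ^+ 19) A -> 0 <= dl <= 1 ->
  y ^+ 9 <= D%:R <= y ^+ 10 -> (E <= 2 * D)%N -> (0 < U)%N -> U%:R <= y ^+ 2 -> (0 < h)%N ->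
  `|\sum_(1 <= a < E) moebius_le U a *
      (\sum_(1 <= b < E) ln b%:R * phase (y ^+ 19 * h%:R) dl al D E (a * b))| +
  `|\sum_(1 <= c < E | (c <= U)%N) vonMangoldt R c *
      (\sum_(1 <= a < E) moebius_le U a *
         \sum_(1 <= b < E) phase (y ^+ 19 * h%:R) dl al D E (c * (a * b)))| <=
  C * A ^+ 3 * y ^+ 9 * (1 + y ^+ 9 / D%:R * h%:R).
Proof.
pose K : R := 16 * 5 ^+ 3.
have K0 : 0 <= K by rewrite mulr_ge0// exprn_ge0.
exists (5 * K + 24 * 8 * 8).
  by apply: addr_ge0; rewrite !mulr_ge0.
move=> y A dl al D E U h y9 [A1 _ lnA _] dl01 /andP[yD Dy] ED U0 Uy h0.
have y1 : 1 <= y by apply: le_trans y9; apply: exprn_ege1; rewrite ler1n.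
have y0 : 0 < y by lra.
have Dr0 : 0 < D%:R :> R by apply: lt_le_trans yD; rewrite exprn_gt0.
have D0 : (0 < D)%N by rewrite -(ltr0n R).
have hr1 : 1 <= h%:R :> R by rewrite ler1n.
have hr0 : 0 < h%:R :> R by lra.
have T0 : 0 < y ^+ 19 * h%:R by rewrite mulr_gt0// exprn_gt0.
have UUy : (U * U)%:R <= y ^+ 4.
  have -> : y ^+ 4 = y ^+ 2 * y ^+ 2 by ring.
  by rewrite natrM; apply: ler_pM.
have UUD : (U * U <= D)%N.
  rewrite -(ler_nat R); apply: (le_trans UUy); apply: le_trans yD.
  by apply: ler_weXn2l.
have lnA' b : (0 < b < 2 * D)%N -> ln b%:R <= A.
  move=> /andP[b0 b1]; apply: lnA => //; apply: (@le_trans _ _ (2 * D%:R)).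
    by rewrite -natrM ler_nat ltnW.
  have -> : y ^+ 19 = y ^+ 9 * y ^+ 10 by ring.
  apply: ler_pM => //; apply: (@le_trans _ _ (2 ^+ 12)).
    by rewrite -[leLHS]expr1; apply: ler_weXn2l; rewrite ?ler1n.
  by apply: (le_trans y9); rewrite ler_eXnr.
have A0 : 0 <= A by lra.
have b1 := @type_one_log_sum R _ dl al A D E U U T0 dl01 D0 ED U0 U0 UUD A1 lnA'.
have b2 := @type_one_mangoldt_sum R _ dl al A D E U U T0 dl01 D0 ED U0 U0 UUD A1 lnA'.
move: b1 b2; rewrite -/K; set s := Num.sqrt _ => b1 b2.
set z := y ^+ 9 / D%:R * h%:R.
have z0 : 0 < z by rewrite mulr_gt0// divr_gt0// exprn_gt0.
have s2 : s ^+ 2 = 2 * (y ^+ 19 * h%:R) / (5 ^+ 3 * D%:R ^+ 3).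
  by rewrite sqr_sqrtr// divr_ge0 ?mulr_ge0 ?exprn_ge0 ?(ltW T0)// ltW.
have s0 : 0 < s by rewrite sqrtr_gt0 divr_gt0 ?mulr_gt0 ?exprn_gt0.
have Ds : D%:R * s <= y ^+ 5 * (1 + z).
  have rhs0 : 0 <= y ^+ 5 * (1 + z) by rewrite mulr_ge0 ?exprn_ge0 ?(ltW y0)//; lra.
  have lhs0 : 0 <= D%:R * s by rewrite mulr_ge0// ltW.
  rewrite -(ler_pXn2r (ltn0Sn 1)) ?nnegrE//.
  rewrite exprMn s2.
  have -> : D%:R ^+ 2 * (2 * (y ^+ 19 * h%:R) / (5 ^+ 3 * D%:R ^+ 3)) =
    y ^+ 10 * (z * (2 / 5 ^+ 3)).
    by rewrite /z; field; rewrite gt_eqF.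
  have -> : (y ^+ 5 * (1 + z)) ^+ 2 = y ^+ 10 * (1 + z) ^+ 2 by ring.
  apply: ler_wpM2l; first by rewrite exprn_ge0// ltW.
  apply: (@le_trans _ _ (z * 1)); last by rewrite mulr1; nra.
  apply: ler_wpM2l; first exact: ltW.
  rewrite ler_pdivrMr ?exprn_gt0// mul1r.
  by apply: (@le_trans _ _ 5); rewrite ?ler_nat// ler_eXnr// ler1n.
have sV : s^-1 <= 8 * y ^+ 9.
  have q0 : 0 < 8 * y ^+ 9 by rewrite mulr_gt0// exprn_gt0.
  rewrite -[leRHS]invrK lef_pV2 ?posrE ?invr_gt0//.
  rewrite -(ler_pXn2r (ltn0Sn 1)) ?nnegrE ?invr_ge0 ?(ltW q0) ?(ltW s0)//.
  rewrite s2 exprVn ler_pdivlMr ?mulr_gt0 ?exprn_gt0// mulrC ler_pdivrMr ?exprn_gt0//.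
  have D3 : D%:R ^+ 3 <= (y ^+ 10) ^+ 3.
    by rewrite lerXn2r ?nnegrE ?exprn_ge0 ?(ltW y0).
  apply: (@le_trans _ _ (5 ^+ 3 * (y ^+ 10) ^+ 3)); first by rewrite ler_wpM2l ?exprn_ge0.
  have -> : 2 * (y ^+ 19 * h%:R) * (8 * y ^+ 9) ^+ 2 =
      (2 * 8 ^+ 2 * (y ^+ 7 * h%:R)) * (y ^+ 10) ^+ 3 by ring.
  rewrite ler_wpM2r ?exprn_ge0 ?(ltW y0)//.
  apply: (@le_trans _ _ (2 * 8 ^+ 2)); first by rewrite -!natrX -natrM ler_nat.
  rewrite ler_peMr ?mulr_ge0 ?exprn_ge0//.
  by rewrite -[leLHS]mulr1; apply: ler_pM => //; apply: exprn_ege1.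
pose X : R := y ^+ 9 * (1 + z).
have X0 : y ^+ 9 <= X by rewrite /X ler_peMr ?exprn_ge0 ?(ltW y0)//; lra.
have X00 : 0 <= X by apply: le_trans X0; rewrite exprn_ge0// ltW.
have Ds0 : 0 <= D%:R * s by rewrite mulr_ge0// ltW.
have w2 : (U * U)%:R * (D%:R * s) <= X.
  apply: (le_trans (ler_pM _ Ds0 UUy Ds)) => //.
  by rewrite /X mulrA -exprD.
have w1 : U%:R * (D%:R * s) <= X.
  apply: le_trans w2; rewrite ler_wpM2r// ler_nat; exact: leq_pmulr.
have w3 : s^-1 <= 8 * X by apply: (le_trans sV); rewrite ler_wpM2l.
apply: (le_trans (lerD b1 b2)).
have A2 : 1 <= A ^+ 2 by apply: exprn_ege1.
have -> : (5 * K + 24 * 8 * 8) * A ^+ 3 * y ^+ 9 * (1 + z) =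
  A * (A ^+ 2 * (4 * (K * X + 32 * (8 * X))) + A ^+ 2 * (K * X + 64 * (8 * X))).
  by rewrite /X; ring.
have -> : 4 * A * (K * (U%:R * (D%:R * s)) + 32 * A / s) +
    A * (K * ((U * U)%:R * (D%:R * s)) + 64 * A ^+ 2 / s) =
  A * (4 * (K * (U%:R * (D%:R * s)) + 32 * (A * s^-1)) +
    (K * ((U * U)%:R * (D%:R * s)) + 64 * (A ^+ 2 * s^-1))).
  by ring.
have A12 : A <= A ^+ 2 by rewrite expr2 ler_peMr.
have KX : K * X <= A ^+ 2 * (K * X) by rewrite ler_peMl// mulr_ge0.
have Kw1 : K * (U%:R * (D%:R * s)) <= A ^+ 2 * (K * X).
  by apply: le_trans KX; rewrite ler_wpM2l.
have Kw2 : K * ((U * U)%:R * (D%:R * s)) <= A ^+ 2 * (K * X).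
  by apply: le_trans KX; rewrite ler_wpM2l.
have sV0 : 0 <= s^-1 by rewrite invr_ge0 ltW.
have As1 : A * s^-1 <= A ^+ 2 * (8 * X) by apply: ler_pM.
have As2 : A ^+ 2 * s^-1 <= A ^+ 2 * (8 * X) by apply: ler_wpM2l => //; rewrite sqr_ge0.
rewrite ler_wpM2l//.
have -> : A ^+ 2 * (4 * (K * X + 32 * (8 * X))) + A ^+ 2 * (K * X + 64 * (8 * X)) =
  4 * (A ^+ 2 * (K * X) + 32 * (A ^+ 2 * (8 * X))) +
    (A ^+ 2 * (K * X) + 64 * (A ^+ 2 * (8 * X))) by ring.
by apply: lerD; [rewrite ler_wpM2l// lerD// ler_wpM2l | rewrite lerD// ler_wpM2l].
Qed.

Lemma saw_weight_le (eta : R) h : 0 < eta -> (0 < h)%N ->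
  saw_weight eta h <= h%:R^-1 /\ saw_weight eta h * (1 + eta * h%:R) <= 2 * h%:R^-1.
Proof.
move=> e0 h0; have hr : 0 < h%:R :> R by rewrite ltr0n.
have w1 : saw_weight eta h <= h%:R^-1 by rewrite /saw_weight ge_min lexx.
have w2 : saw_weight eta h <= (eta * h%:R ^+ 2)^-1 by rewrite /saw_weight ge_min lexx orbT.
split=> //; rewrite mulrDr mulr1 mulr2n mulrDl mul1r; apply: lerD => //.
rewrite -ler_pdivlMr ?mulr_gt0//; apply: (le_trans w2).
by rewrite le_eqVlt; apply/orP; left; apply/eqP; field; rewrite !gt_eqF.
Qed.

Lemma saw_weight_ge0 (eta : R) h : 0 < eta -> 0 <= saw_weight eta h.
Proof.
by move=> e0; rewrite /saw_weight le_min !invr_ge0 mulr_ge0 ?exprn_ge0 ?ler0n// ltW.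
Qed.

End sawtooth_sum.

Section saw_mangoldt.
Context {R : realType}.

Lemma log2_bracket (z : R) : 1 <= z -> exists2 k : nat, 2 ^+ k <= z & z < 2 ^+ k.+1.
Proof.
move=> z1; exists (trunc_log 2 (Num.truncn z)).
  have t0 : (0 < Num.truncn z)%N by rewrite truncn_gt0.
  apply: (@le_trans _ _ (Num.truncn z)%:R); last by rewrite truncn_le; lra.
  by rewrite -natrX ler_nat trunc_logP.
apply: (lt_le_trans (truncnS_gt z)).
by rewrite -natrX ler_nat trunc_log_ltn.
Qed.

Definition type_two_term (T dl al : R) (D E U : nat) : R :=
  \sum_(1 <= c < E | (U < c)%N) vonMangoldt R c *
      (\sum_(1 <= m < E) moebius_tail U m * phase T dl al D E (c * m)).

Lemma type_two_abs_sum : exists2 C : R, 0 <= C &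
  forall (y A dl : R) (D E U J L : nat) (al : nat -> R),
  2 ^+ 12 <= y -> subpoly_bound (y ^+ 19) A -> 0 <= dl <= 1 ->
  y ^+ 9 <= D%:R <= y ^+ 10 -> (E <= 2 * D)%N -> (2 * D)%:R <= y ^+ 19 -> (0 < L)%N ->
  L%:R <= y ^+ 4 -> y ^+ 2 <= U.+1%:R -> (E <= 2 ^ J)%N -> J%:R <= A ->
  \sum_(L <= h < 2 * L) `|type_two_term (y ^+ 19 * h%:R) dl (al h) D E U| <=
  C * A ^+ 4 * L%:R * y ^+ 9.
Proof.
have [C C0 hC] := type_two_dyadic_sum (R := R); exists (C + C); first exact: addr_ge0.
move=> y A dl D E U J L al y9 hA dl01 hD ED Dy L0 Ly yU EJ JA.
have [A1 tauA lnA _] := hA.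
pose sg h := Num.sg (type_two_term (y ^+ 19 * h%:R) dl (al h) D E U).
have sg1 h : `|sg h| <= 1 by rewrite normr_sg; case: (_ != 0).
pose La n : R := if (U < n)%N then vonMangoldt R n else 0.
pose Mt n : R := if (n == 0)%N then 0 else moebius_tail U n.
have small n : (0 < n < 2 * D)%N -> (0 < n)%N /\ n%:R <= y ^+ 19 :> R.
  by move=> /andP[n0 n1]; split=> //; apply: le_trans Dy; rewrite ler_nat ltnW.
have LaA n : (0 < n < 2 * D)%N -> `|La n| <= A.
  move=> /small[n0 ny]; rewrite /La; case: ifP => _; last by rewrite normr0; lra.
  rewrite ger0_norm ?vonMangoldt_ge0//.
  by apply: (le_trans (vonMangoldt_le n0)); exact: lnA.
have MtA n : (0 < n < 2 * D)%N -> `|Mt n| <= A.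
  move=> /small[n0 ny]; rewrite /Mt; case: eqP => _; first by rewrite normr0; lra.
  by apply: (le_trans (norm_moebius_tail _ _)); exact: tauA.
have La0 n : (n <= U)%N -> La n = 0 by rewrite /La ltnNge => ->.
have Mt0 n : (n <= U)%N -> Mt n = 0.
  by rewrite /Mt; case: posnP => // n0 nU; exact: moebius_tail_eq0.
have h1 := hC y A dl D E U L J 0%N al sg Mt La y9 hA dl01 hD ED L0 Ly yU EJ JA sg1 La0 LaA MtA.
have h2 := hC y A dl D E U L J 1%N al sg La Mt y9 hA dl01 hD ED L0 Ly yU EJ JA sg1 Mt0 MtA LaA.
have -> : (C + C) * A ^+ 4 * L%:R * y ^+ 9 =
    C * A ^+ 4 * L%:R * y ^+ 9 + C * A ^+ 4 * L%:R * y ^+ 9 by ring.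
apply: le_trans (lerD h1 h2); apply: le_trans (ler_normD _ _).
rewrite -big_split/=; apply: le_trans (ler_norm _).
apply: ler_sum => h _; rewrite -mulrDr normrEsg -/(sg h).
rewrite le_eqVlt; apply/orP; left; apply/eqP; congr (_ * _).
rewrite {1}/type_two_term type_two_split; congr (_ + _).
  apply: eq_bigr => n _; rewrite -/(La n); congr (_ * _); apply: eq_big_nat => m /andP[m0 _].
  by rewrite /Mt (gtn_eqF m0).
by apply: eq_big_nat => n /andP[n0 _]; rewrite /Mt (gtn_eqF n0).
Qed.

Lemma big_nat_shift1 (f : nat -> R) n :
  \sum_(i < n) f i.+1 = \sum_(1 <= h < n.+1) f h.
Proof. by rewrite big_add1/= big_mkord. Qed.

Lemma saw_mangoldt : exists2 C : R, 0 <= C &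
  forall (y A dl : R) (D E : nat),
  2 ^+ 12 <= y -> subpoly_bound (y ^+ 19) A -> 0 <= dl <= 1 ->
  y ^+ 9 <= D%:R <= y ^+ 10 -> (E <= 2 * D)%N ->
  `|\sum_(D <= d < E) vonMangoldt R d * saw (y ^+ 19 / (d%:R + dl))| <= C * A ^+ 5 * y ^+ 9.
Proof.
have [C1 C10 h1] := type_one_size (R := R).
have [C2 C20 h2] := type_two_abs_sum.
exists (4 + (C1 * 4 + C2)); first by rewrite !addr_ge0 ?mulr_ge0.
move=> y A dl D E y9 hA dl01 hD ED.
have [A1 tauA lnA JA] := hA; have /andP[yD Dy] := hD.
have y1 : 1 <= y by apply: le_trans y9; apply: exprn_ege1; rewrite ler1n.
have y0 : 0 < y by lra.
have Dr0 : 0 < D%:R :> R by apply: lt_le_trans yD; rewrite exprn_gt0.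
have D0 : (0 < D)%N by rewrite -(ltr0n R).
have A0 : 0 <= A by lra.
have y9_0 : 0 <= y ^+ 9 by rewrite exprn_ge0// ltW.
have D19 : (2 * D)%:R <= y ^+ 19 :> R.
  rewrite natrM; have -> : y ^+ 19 = y ^+ 9 * y ^+ 10 by ring.
  apply: ler_pM => //; apply: (@le_trans _ _ (2 ^+ 12)).
    by rewrite -[leLHS]expr1; apply: ler_weXn2l; rewrite ?ler1n.
  by apply: (le_trans y9); rewrite ler_eXnr.
pose U := Num.truncn (y ^+ 2).
have U0 : (0 < U)%N by rewrite truncn_gt0 exprn_ege1.
have Uy : U%:R <= y ^+ 2 by rewrite truncn_le exprn_ge0// ltW.
have yU : y ^+ 2 <= U.+1%:R by rewrite ltW// truncnS_gt.
have UD : (U < D)%N.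
  rewrite -(ltr_nat R); apply: (le_lt_trans Uy); apply: lt_le_trans yD.
  rewrite ltr_eXn2l//; apply: lt_le_trans y9; rewrite exprn_egt1// ltr1n//.
have [j0 j1 j2] := log2_bracket (exprn_ege1 4 y1).
have D1 : 1 <= (2 * D)%:R :> R by rewrite ler1n muln_gt0.
have [J0 J1 J2] := log2_bracket D1.
have J0A : J0.+1%:R <= A.
  by apply: le_trans (JA J0 (le_trans J1 D19)); rewrite ler_nat; exact: leqW (leqW (leqnn _)).
have j0A : j0.+1%:R <= A.
  have j3 : 2 ^+ j0 <= y ^+ 19 by apply: (le_trans j1); apply: ler_weXn2l.
  by apply: le_trans (JA j0 j3); rewrite ler_nat; exact: leqW (leqW (leqnn _)).
have EJ : (E <= 2 ^ J0.+1)%N.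
  by apply: (leq_trans ED); rewrite ltnW// -(ltr_nat R) natrX.
pose n := (2 ^ j0.+1).-1.
have nE : n.+1 = (2 ^ j0.+1)%N by rewrite prednK// expn_gt0.
pose eta := y ^+ 9 / D%:R.
have eta0 : 0 < eta by rewrite divr_gt0// exprn_gt0.
have eta1 : 0 < eta <= 1 by rewrite eta0 ler_pdivrMr// mul1r.
have A3 : 0 <= C1 * A ^+ 3 * y ^+ 9.
  by apply: mulr_ge0 => //; apply: mulr_ge0 => //; exact: exprn_ge0.
have A4 : 0 <= C2 * A ^+ 4 * y ^+ 9.
  by apply: mulr_ge0 => //; apply: mulr_ge0 => //; exact: exprn_ge0.
pose B := (C1 * 4 + C2) * A ^+ 5 * y ^+ 9.
have hB al : \sum_(i < n) saw_weight eta i.+1 *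
    `|\sum_(D <= d < E) vonMangoldt R d *
      cos (2 * pi * i.+1%:R * (y ^+ 19 / (d%:R + dl)) + al i.+1)| <= B.
  rewrite (big_nat_shift1 (fun h => saw_weight eta h *
    `|\sum_(D <= d < E) vonMangoldt R d * cos (2 * pi * h%:R * (y ^+ 19 / (d%:R + dl)) + al h)|)).
  pose II h := type_two_term (y ^+ 19 * h%:R) dl (al h) D E U.
  apply: (@le_trans _ _ (\sum_(1 <= h < n.+1)
     (2 * h%:R^-1 * (C1 * A ^+ 3 * y ^+ 9) + h%:R^-1 * `|II h|))).
    apply: ler_sum_nat => h /andP[h0 _].
    pose F := phase (y ^+ 19 * h%:R) dl (al h) D E.
    have -> : \sum_(D <= d < E) vonMangoldt R d *
          cos (2 * pi * h%:R * (y ^+ 19 / (d%:R + dl)) + al h) =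
       \sum_(1 <= d < E) vonMangoldt R d * F d.
      rewrite [LHS](big_nat_widenl _ 1)//= [LHS]big_mkcond/=.
      apply: eq_big_nat => d /andP[_ dE]; rewrite /F /phase dE andbT.
      case: ifP => _; rewrite ?mulr0//; congr (_ * cos (_ + _)); ring.
    have FE d : (E <= d)%N -> F d = 0 by rewrite /F /phase leqNgt => /negPf ->; rewrite andbF.
    have FU d : (d <= U)%N -> F d = 0.
      by move=> dU; rewrite /F /phase leqNgt (leq_ltn_trans dU UD).
    rewrite (vaughan U FE FU).
    have := h1 y A dl (al h) D E U h y9 hA dl01 hD ED U0 Uy h0; rewrite -/F -/eta.
    set X1 := \sum_(1 <= a < E) _; set X2 := \sum_(1 <= c < E | (c <= U)%N) _.
    rewrite -/(II h) => hX.
    have [w1 w2] := saw_weight_le eta0 h0.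
    have w0 := saw_weight_ge0 h eta0.
    apply: (@le_trans _ _ (saw_weight eta h * ((`|X1| + `|X2|) + `|II h|))).
      rewrite ler_wpM2l//; apply: (le_trans (ler_normD _ _)); rewrite lerD2r.
      exact: ler_normB.
    rewrite mulrDr; apply: lerD; last by rewrite ler_wpM2r.
    apply: (@le_trans _ _ (saw_weight eta h * (C1 * A ^+ 3 * y ^+ 9 * (1 + eta * h%:R)))).
      by rewrite ler_wpM2l.
    by rewrite mulrCA [leRHS]mulrC; apply: ler_wpM2l.
  rewrite big_split/= -mulr_suml -mulr_sumr.
  have -> : B = 4 * A * (C1 * A ^+ 3 * y ^+ 9) * A + C2 * A ^+ 4 * y ^+ 9 * A by rewrite /B; ring.
  apply: lerD.
    apply: (@le_trans _ _ (4 * A * (C1 * A ^+ 3 * y ^+ 9))).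
      rewrite ler_wpM2r//.
      have -> : 4 * A = 2 * (2 * A) by ring.
      rewrite ler_wpM2l//.
      have n0 : (0 < n)%N by rewrite -ltnS nE (@leq_pexp2l 2 1).
      apply: (le_trans (harmonic_le n0)).
      have ny : n%:R <= y ^+ 19 :> R.
        apply: (@le_trans _ _ n.+1%:R); first by rewrite ler_nat.
        rewrite nE natrX exprS; have -> : y ^+ 19 = y ^+ 15 * y ^+ 4 by ring.
        apply: ler_pM; rewrite ?exprn_ge0//.
        apply: (@le_trans _ _ (2 ^+ 12)).
          by rewrite -[leLHS]expr1; apply: ler_weXn2l; rewrite ?ler1n.
        by apply: (le_trans y9); rewrite ler_eXnr.
      by have := lnA n n0 ny; lra.
    by rewrite ler_peMr// mulr_ge0// mulr_ge0.
  rewrite nE sum_dyadic.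
  apply: (@le_trans _ _ (\sum_(j < j0.+1) C2 * A ^+ 4 * y ^+ 9)); last first.
    rewrite sumr_const card_ord -[leLHS]mulr_natr ler_wpM2l//.
  apply: ler_sum => j _.
  have Lj : (0 < 2 ^ j)%N by rewrite expn_gt0.
  have Ljr : 0 < (2 ^ j)%:R :> R by rewrite ltr0n.
  apply: (@le_trans _ _ ((2 ^ j)%:R^-1 * \sum_(2 ^ j <= h < 2 * 2 ^ j) `|II h|)).
    rewrite mulr_sumr; apply: ler_sum_nat => h /andP[hh _].
    by rewrite ler_wpM2r// lef_pV2 ?posrE ?ler_nat// ltr0n (leq_trans Lj).
  have Ly : (2 ^ j)%:R <= y ^+ 4 :> R.
    apply: le_trans j1; rewrite natrX; apply: ler_weXn2l; rewrite ?ler1n//.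
    by rewrite -ltnS.
  have := h2 y A dl D E U J0.+1 (2 ^ j)%N al y9 hA dl01 hD ED D19 Lj Ly yU EJ J0A.
  move=> /(ler_wpM2l (ltW (_ : 0 < (2 ^ j)%:R^-1))); rewrite invr_gt0 => /(_ Ljr)/le_trans; apply.
  by rewrite le_eqVlt; apply/orP; left; apply/eqP; field; rewrite gt_eqF.
have := @saw_sum R (vonMangoldt R) (fun d => y ^+ 19 / (d%:R + dl)) (index_iota D E) n eta B
  eta1 (@vonMangoldt_ge0 R) hB.
move=> /le_trans; apply.
have -> : (4 + (C1 * 4 + C2)) * A ^+ 5 * y ^+ 9 = 4 * (A ^+ 5 * y ^+ 9) + B by rewrite /B; ring.
rewrite lerD2r.
have W : \sum_(D <= d < E) vonMangoldt R d <= D%:R * A.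
  apply: (@le_trans _ _ (\sum_(D <= d < E) A)).
    apply: ler_sum_nat => d /andP[d1 d2].
    have d0 : (0 < d)%N by apply: leq_trans d1.
    apply: (le_trans (vonMangoldt_le d0)); apply: lnA => //; apply: le_trans D19.
    by rewrite ler_nat ltnW// (leq_trans d2).
  rewrite sumr_const_nat -[leLHS]mulr_natl ler_wpM2r// ler_nat leq_subLR.
  by rewrite addnn -mul2n.
have W0 : 0 <= \sum_(D <= d < E) vonMangoldt R d.
  by apply: sumr_ge0 => d _; exact: vonMangoldt_ge0.
have sq : y ^+ 2 <= Num.sqrt n.+1%:R.
  rewrite -[leLHS]ger0_norm ?sqr_ge0// -sqrtr_sqr; apply: ler_wsqrtr.
  by rewrite nE natrX -exprM ltW.
have y20 : 0 < y ^+ 2 by rewrite exprn_gt0.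
have sq0 : 0 < Num.sqrt n.+1%:R :> R by apply: lt_le_trans sq.
apply: (@le_trans _ _ ((eta / 2 + 3 / (eta * y ^+ 2)) * (D%:R * A))).
  apply: ler_pM => //.
    apply: addr_ge0; first by apply: divr_ge0 => //; exact: ltW.
    by apply: divr_ge0 => //; apply: mulr_ge0; exact: ltW.
  rewrite lerD2l; apply: ler_wpM2l => //.
  have e1 := mulr_gt0 eta0 sq0; have e2 := mulr_gt0 eta0 y20.
  by rewrite lef_pV2 ?posrE//; apply: ler_wpM2l => //; exact: ltW.
have -> : (eta / 2 + 3 / (eta * y ^+ 2)) * (D%:R * A) =
   A * (y ^+ 9 / 2 + 3 * (D%:R ^+ 2 / y ^+ 11)).
  by rewrite /eta; field; rewrite !gt_eqF ?exprn_gt0.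
have D2 : D%:R ^+ 2 / y ^+ 11 <= y ^+ 9.
  rewrite ler_pdivrMr ?exprn_gt0//; have -> : y ^+ 9 * y ^+ 11 = (y ^+ 10) ^+ 2 by ring.
  by rewrite lerXn2r ?nnegrE ?exprn_ge0 ?(ltW y0).
have -> : 4 * (A ^+ 5 * y ^+ 9) = A ^+ 5 * (4 * y ^+ 9) by ring.
apply: ler_pM => //.
- apply: addr_ge0; first exact: divr_ge0.
  by apply: mulr_ge0 => //; apply: divr_ge0; apply: exprn_ge0 => //; exact: ltW.
- by rewrite ler_eXnr.
- by lra.
Qed.

End saw_mangoldt.

(** * Conclusion *)

Section assembly.
Context {R : realType}.

Definition mangoldt_term (d : nat) : R := vonMangoldt R d / (d%:R * (d%:R + 1)).
Definition mangoldt_psum (N : nat) : R := \sum_(1 <= d < N) mangoldt_term d.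
Definition tail_majorant (d : nat) : R := (ln d%:R + 2) / d%:R.

Let term_ge0 d : 0 <= mangoldt_term d.
Proof. by rewrite /mangoldt_term divr_ge0 ?vonMangoldt_ge0// mulr_ge0// addr_ge0. Qed.

Let term_le d : (0 < d)%N -> mangoldt_term d <= tail_majorant d - tail_majorant d.+1.
Proof.
move=> d0; have dr : 0 < d%:R :> R by rewrite ltr0n.
have dr1 : 0 < d%:R + 1 :> R by rewrite addr_gt0.
rewrite /mangoldt_term /tail_majorant (_ : d.+1%:R = d%:R + 1 :> R); last by rewrite natr1.
have -> : (ln d%:R + 2) / d%:R - (ln (d%:R + 1) + 2) / (d%:R + 1) =
  ((d%:R + 1) * (ln d%:R + 2) - d%:R * (ln (d%:R + 1) + 2)) / (d%:R * (d%:R + 1)) :> R.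
  by field; rewrite !gt_eqF.
rewrite ler_pM2r ?invr_gt0 ?mulr_gt0//; apply: (le_trans (vonMangoldt_le d0)).
have : ln (1 + d%:R^-1) <= d%:R^-1 :> R.
  by apply: le_ln1Dx; apply: (@lt_trans _ _ 0); rewrite ?invr_gt0// ltrN10.
have -> : 1 + d%:R^-1 = (d%:R + 1) / d%:R :> R by field; rewrite gt_eqF.
rewrite ln_div ?posrE// => h.
have : d%:R * (ln (d%:R + 1) - ln d%:R) <= 1 :> R.
  by rewrite -[leRHS](divff (lt0r_neq0 dr)) ler_wpM2l// ltW.
by rewrite mulrBr mulrDl mul1r !mulrDr; lra.
Qed.

Let majorant_ge0 d : 0 <= tail_majorant d.
Proof.
rewrite /tail_majorant divr_ge0// addr_ge0//; case: d => [|d]; first by rewrite ln0.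
by rewrite ln_ge0// ler1n.
Qed.

Let tail_le B N : (0 < B)%N -> \sum_(B <= d < N) mangoldt_term d <= tail_majorant B.
Proof.
move=> B0; have [NB|BN] := leqP N B; first by rewrite big_geq.
apply: (@le_trans _ _ (tail_majorant B - tail_majorant N)); last by rewrite gerBl.
rewrite -opprB -(telescope_sumr tail_majorant (ltnW BN)) -sumrN.
apply: ler_sum_nat => d /andP[Bd _]; rewrite opprB.
by apply: term_le; exact: leq_trans Bd.
Qed.

Let psum_nd : nondecreasing_seq mangoldt_psum.
Proof.
move=> m n mn; rewrite /mangoldt_psum; have [m1|m1] := leqP 1 m; last first.
  by rewrite [leLHS]big_geq; [exact: sumr_ge0|rewrite ltnW].
by rewrite [leRHS](big_cat_nat m1 mn)/= lerDl sumr_ge0.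
Qed.

Lemma mangoldt_series_cvg : cvgn mangoldt_psum.
Proof.
apply: nondecreasing_is_cvgn; first exact: psum_nd.
exists (tail_majorant 1) => _ [N _ <-]; exact: tail_le.
Qed.

Lemma mangoldt_series_tail B : (0 < B)%N ->
  `|mangoldt_psum B - limn mangoldt_psum| <= (ln B%:R + 2) / B%:R.
Proof.
move=> B0; have h1 : mangoldt_psum B <= limn mangoldt_psum.
  exact: nondecreasing_cvgn_le psum_nd mangoldt_series_cvg B.
have h2 : limn mangoldt_psum <= mangoldt_psum B + tail_majorant B.
  apply: limr_le; first exact: mangoldt_series_cvg.
  near=> N; have BN : (B <= N)%N by near: N; exact: nbhs_infty_ge.
  by rewrite /mangoldt_psum (big_cat_nat B0 BN)/= lerD2l tail_le.
rewrite distrC ger0_norm ?subr_ge0// -/(tail_majorant B); lra.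
Unshelve. all: by end_near.
Qed.

Lemma truncn_saw (z : R) : 0 <= z -> (Num.truncn z)%:R = z - saw z - 1 / 2.
Proof.
move=> z0; rewrite /saw /frac truncn_floor z0 natr_absz ger0_norm ?floor_ge0//; ring.
Qed.

Lemma floor_quotient_count (x : R) (X d : nat) : 0 <= x -> X = Num.truncn x -> (0 < d)%N ->
  \sum_(1 <= n < X.+1 | Num.truncn (x / n%:R) == d) 1 =
  x / (d%:R * (d%:R + 1)) - saw (x / (d%:R + 0)) + saw (x / (d%:R + 1)).
Proof.
move=> x0 XE d0.
have dr : 0 < d%:R :> R by rewrite ltr0n.
have dr1 : 0 < d%:R + 1 :> R by rewrite addr_gt0.
have x1 : 0 <= x / d%:R by rewrite divr_ge0.
have x2 : 0 <= x / (d%:R + 1) by rewrite divr_ge0// ltW.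
set t1 := Num.truncn (x / d%:R); set t2 := Num.truncn (x / (d%:R + 1)).
have t21 : (t2 <= t1)%N.
  by apply: le_truncn; rewrite ler_wpM2l// lef_pV2 ?posrE// lerDl.
have t1X : (t1 <= X)%N.
  rewrite XE; apply: le_truncn; rewrite ler_pdivrMr// ler_peMr// ler1n//.
have -> : \sum_(1 <= n < X.+1 | Num.truncn (x / n%:R) == d) 1 = \sum_(t2.+1 <= n < t1.+1) 1 :> R.
  rewrite [RHS](big_nat_widen _ _ X.+1)// [RHS](big_nat_widenl _ 1)//=.
  rewrite big_nat_cond [RHS]big_nat_cond; apply: eq_bigl => n.
  case: (boolP (1 <= n < X.+1)%N) => //= /andP[n0 nX].
  have nr : 0 < n%:R :> R by rewrite ltr0n.
  rewrite truncn_eq ?divr_ge0// ltnS truncn_ge_nat// truncn_lt_nat//.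
  rewrite ler_pdivlMr// ler_pdivlMr// mulrC; congr (_ && _).
  by rewrite ltr_pdivrMr// ltr_pdivrMr// -natr1 mulrC.
rewrite sumr_const_nat subSS natrB// (truncn_saw x1) (truncn_saw x2) addr0.
have -> : x / (d%:R * (d%:R + 1)) = x / d%:R - x / (d%:R + 1) by field; rewrite !gt_eqF.
ring.
Qed.

Lemma norm_saw_le1 (z : R) : `|saw z| <= 1.
Proof.
by rewrite /saw; have /andP[h1 h2] := frac_itv z; rewrite ler_norml; apply/andP; split; lra.
Qed.

Lemma saw_mangoldt_full : exists2 C : R, 0 <= C &
  forall (y A dl : R) (B : nat), 2 ^+ 12 <= y -> subpoly_bound (y ^+ 19) A -> 0 <= dl <= 1 ->
  B%:R <= y ^+ 10 ->
  `|\sum_(1 <= d < B.+1) vonMangoldt R d * saw (y ^+ 19 / (d%:R + dl))| <= C * A ^+ 6 * y ^+ 9.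
Proof.
have [C C0 hC] := saw_mangoldt (R := R); exists (C + 1); first by rewrite addr_ge0.
move=> y A dl B y9 hA dl01 By; have [A1 _ lnA JA] := hA.
have y1 : 1 <= y by apply: le_trans y9; apply: exprn_ege1; rewrite ler1n.
have y0 : 0 < y by lra.
have A0 : 0 <= A by lra.
have y90 : 0 <= y ^+ 9 by rewrite exprn_ge0// ltW.
have [j0 j1 j2] := log2_bracket (exprn_ege1 10 y1).
have BJ : (B.+1 <= 2 ^ j0.+1)%N.
  by rewrite -(ltr_nat R) natrX; apply: le_lt_trans j2.
have j0A : j0.+1%:R <= A.
  have j3 : 2 ^+ j0 <= y ^+ 19 by apply: (le_trans j1); apply: ler_weXn2l.
  by apply: le_trans (JA j0 j3); rewrite ler_nat; exact: leqW (leqW (leqnn _)).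
pose f d : R := if (d <= B)%N then vonMangoldt R d * saw (y ^+ 19 / (d%:R + dl)) else 0.
have -> : \sum_(1 <= d < B.+1) vonMangoldt R d * saw (y ^+ 19 / (d%:R + dl)) =
   \sum_(1 <= d < 2 ^ j0.+1) f d.
  by rewrite [LHS](big_nat_widen _ _ (2 ^ j0.+1))// [LHS]big_mkcond.
rewrite sum_dyadic; apply: (le_trans (ler_norm_sum _ _ _)).
have A5 : 0 <= A ^+ 5 * y ^+ 9 by apply: mulr_ge0 => //; exact: exprn_ge0.
apply: (@le_trans _ _ (\sum_(j < j0.+1) (C + 1) * (A ^+ 5 * y ^+ 9))); last first.
  rewrite sumr_const card_ord -[leLHS]mulr_natr.
  have -> : (C + 1) * A ^+ 6 * y ^+ 9 = (C + 1) * (A ^+ 5 * y ^+ 9) * A by ring.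
  by apply: ler_wpM2l => //; apply: mulr_ge0 => //; rewrite addr_ge0.
apply: ler_sum => j _; set D := (2 ^ j)%N.
have fA d : (D <= d)%N -> `|f d| <= A.
  move=> Dd; rewrite /f; case: ifP => dB; last by rewrite normr0.
  have d0 : (0 < d)%N by apply: leq_trans Dd; rewrite expn_gt0.
  rewrite normrM -[leRHS]mulr1; apply: ler_pM => //; last exact: norm_saw_le1.
  rewrite ger0_norm ?vonMangoldt_ge0//; apply: (le_trans (vonMangoldt_le d0)); apply: lnA => //.
  apply: (@le_trans _ _ B%:R); first by rewrite ler_nat.
  by apply: (le_trans By); apply: ler_weXn2l.
have [Dy|Dy] := ltrP D%:R (y ^+ 9).
  apply: (le_trans (ler_norm_sum _ _ _)).
  apply: (@le_trans _ _ (\sum_(D <= d < 2 * D) A)).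
    by apply: ler_sum_nat => d /andP[Dd _]; exact: fA.
  rewrite sumr_const_nat mul2n -addnn addnK -[leLHS]mulr_natl.
  apply: (@le_trans _ _ (A ^+ 5 * y ^+ 9)).
    rewrite [leLHS]mulrC; apply: ler_pM => //; last exact: ltW.
    by rewrite ler_eXnr.
  by rewrite ler_peMl// lerDr.
have [Dy2|Dy2] := lerP D%:R (y ^+ 10); last first.
  rewrite big_nat_cond big1 ?normr0; first by apply: mulr_ge0 => //; rewrite addr_ge0.
  move=> d /andP[/andP[Dd _] _]; rewrite /f ifF//; apply/negP => dB.
  have : D%:R <= B%:R :> R by rewrite ler_nat (leq_trans Dd).
  by move/le_trans => /(_ _ By); rewrite leNgt Dy2.
have -> : \sum_(D <= d < 2 * D) f d = \sum_(D <= d < minn (2 * D) B.+1)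
    vonMangoldt R d * saw (y ^+ 19 / (d%:R + dl)).
  rewrite [RHS](big_nat_widen _ _ (2 * D)) ?geq_minl// [RHS]big_mkcond/=.
  by apply: eq_big_nat => d /andP[_ d2]; rewrite /f leq_min d2.
have := hC y A dl D (minn (2 * D) B.+1) y9 hA dl01.
rewrite Dy Dy2 geq_minl => /(_ isT isT)/le_trans; apply.
by rewrite -mulrA; apply: ler_wpM2r => //; rewrite lerDl.
Qed.

End assembly.

Section subpolynomial_bounds.
Context {R : realType}.

Lemma ln_le_powR (x e : R) : 1 <= x -> 0 < e -> ln x <= e^-1 * x `^ e.
Proof.
move=> x1 e0; have x0 : 0 < x by lra.
rewrite mulrC ler_pdivlMr// mulrC -ln_powR.
by apply: ltW; apply: ln_sublinear; rewrite powR_gt0.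
Qed.

Lemma exponent_le_ln (x : R) J : 1 <= x -> 2 ^+ J <= x -> J%:R <= 2 * ln x.
Proof.
move=> x1 hJ; have x0 : 0 < x by lra.
have l2 : 1 / 2 <= ln 2 :> R.
  have : ln (1 + - (1 / 2)) <= - (1 / 2) :> R by apply: le_ln1Dx; lra.
  have -> : 1 + - (1 / 2) = 2^-1 :> R by field.
  by rewrite lnV ?posrE//; lra.
have : ln (2 ^+ J) <= ln x by rewrite ler_ln ?posrE ?exprn_gt0.
rewrite lnXn// -[ln 2 *+ J]mulr_natr => h.
have h2 : J%:R * (1 / 2) <= J%:R * ln 2 :> R by rewrite ler_wpM2l.
have : J%:R * (1 / 2) <= ln x by apply: (le_trans h2); rewrite mulrC.
lra.
Qed.

Lemma tau_le_powR (e : R) : 0 < e -> exists2 M : R, 0 <= M &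
  forall (x : R) (v : nat), (0 < v)%N -> v%:R <= x -> (tau v)%:R <= M * x `^ e.
Proof.
move=> e0.
pose k := (Num.truncn (2 / e)).+1.
have k0 : (0 < k)%N by [].
have kr : 0 < k%:R :> R by rewrite ltr0n.
have ke : k%:R^-1 <= e / 2.
  have -> : e / 2 = (2 / e)^-1 by field; rewrite gt_eqF.
  by rewrite lef_pV2 ?posrE ?divr_gt0// ltW// truncnS_gt.
pose P := (2 ^ k)%N.
have P0 : 0 < P%:R :> R by rewrite ltr0n expn_gt0.
pose e' := e / 2 / P%:R.
have e'0 : 0 < e' by rewrite !divr_gt0.
pose M1 := 2 * e'^-1 + 1.
have M10 : 0 <= M1 by rewrite addr_ge0// mulr_ge0// invr_ge0 ltW.
exists (M1 ^+ P); first exact: exprn_ge0.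
move=> x v v0 vx.
have x1 : 1 <= x by apply: le_trans vx; rewrite ler1n.
have x0 : 0 < x by lra.
pose L := (trunc_log 2 v).+1.
have vL : (v < 2 ^ L)%N by apply: trunc_log_ltn.
have LM : L%:R <= M1 * x `^ e'.
  rewrite /L -natr1 /M1 mulrDl mul1r; apply: lerD; last first.
    by rewrite -[leLHS](powRr0 x); apply: ler_powR => //; exact: ltW.
  rewrite -mulrA; apply: le_trans (ler_wpM2l _ (ln_le_powR x1 e'0)) => //.
  apply: exponent_le_ln => //; apply: le_trans vx.
  by rewrite -natrX ler_nat trunc_logP.
have root : x = (x `^ k%:R^-1) ^+ k.
  by rewrite -powR_mulrn ?powR_ge0// -powRrM mulVf ?gt_eqF// powRr1// ltW.
have h : (tau v)%:R <= (L ^ P)%:R * x `^ k%:R^-1.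
  rewrite -(ler_pXn2r k0) ?nnegrE ?mulr_ge0 ?powR_ge0// exprMn -root.
  apply: (@le_trans _ _ ((L ^ P) ^ k * v)%:R).
    by rewrite -natrX ler_nat tau_bound.
  by rewrite natrM natrX ler_wpM2l// exprn_ge0.
apply: (le_trans h); rewrite natrX.
have LP : L%:R ^+ P <= M1 ^+ P * x `^ (e / 2).
  have -> : x `^ (e / 2) = (x `^ e') ^+ P.
    by rewrite -powR_mulrn ?powR_ge0// -powRrM /e' divfK ?gt_eqF.
  by rewrite -exprMn lerXn2r ?nnegrE ?mulr_ge0 ?powR_ge0.
have -> : x `^ e = x `^ (e / 2) * x `^ (e / 2).
  rewrite -powRD; first by congr powR; field.
  by rewrite (gt_eqF x0) implybT.
rewrite mulrA; apply: ler_pM; rewrite ?exprn_ge0 ?powR_ge0//.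
by apply: ler_powR => //.
Qed.

Lemma subpoly_bound_powR (e : R) : 0 < e -> exists2 M : R, 0 <= M &
  forall x, 1 <= x -> subpoly_bound x (M * x `^ e).
Proof.
move=> e0; have [M1 M10 hM] := tau_le_powR e0.
have i0 : 0 < e^-1 by rewrite invr_gt0.
exists (M1 + (3 * e^-1 + 3)); first by rewrite !addr_ge0 ?mulr_ge0// ltW.
move=> x x1; have x0 : 0 < x by lra.
have xe : 1 <= x `^ e.
  by rewrite -[leLHS](powRr0 x); apply: ler_powR => //; exact: ltW.
have lnx := ln_le_powR x1 e0.
set z := x `^ e in xe lnx *.
have z0 : 0 <= M1 * z by rewrite mulr_ge0//; lra.
have z1 : 0 <= e^-1 * z by rewrite mulr_ge0//; lra.
have zE : (M1 + (3 * e^-1 + 3)) * z = M1 * z + (3 * (e^-1 * z) + 3 * z) by ring.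
split; rewrite zE.
- lra.
- move=> v v0 vx; apply: (le_trans (hM x v v0 vx)); rewrite -/z; lra.
- move=> v v0 vx; apply: (@le_trans _ _ (ln x)); last by lra.
  by rewrite ler_ln ?posrE// ltr0n.
- move=> J hJ; have := exponent_le_ln x1 hJ.
  have -> : J.+3%:R = J%:R + 3 :> R by rewrite -addn3 natrD.
  lra.
Qed.

Lemma sum_fibers (t : nat -> nat) (f : nat -> R) (X B : nat) : f 0%N = 0 ->
  \sum_(1 <= n < X | (t n <= B)%N) f (t n) =
  \sum_(1 <= d < B.+1) f d * \sum_(1 <= n < X | t n == d) 1.
Proof.
move=> f0.
have -> : \sum_(1 <= d < B.+1) f d * \sum_(1 <= n < X | t n == d) 1 =
   \sum_(1 <= d < B.+1) \sum_(1 <= n < X) (if t n == d then f d else 0).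
  apply: eq_bigr => d _; rewrite mulr_sumr [LHS]big_mkcond/=; apply: eq_bigr => n _.
  by case: ifP; rewrite ?mulr1.
rewrite exchange_big/= [LHS]big_mkcond/=; apply: eq_bigr => n _.
rewrite -big_mkcond/=.
have -> : \sum_(1 <= d < B.+1 | t n == d) f d = \sum_(1 <= d < B.+1 | d == t n) f (t n).
  by apply: eq_big => [d|d /eqP ->//]; rewrite eq_sym.
rewrite big_const_seq count_uniq_mem ?iota_uniq// mem_index_iota ltnS.
case: posnP => [t0|t0] /=; first by rewrite t0 f0.
by case: leqP => //=; rewrite addr0.
Qed.

End subpolynomial_bounds.

Theorem theorem1p1 (R : realType) (eps : R) (heps : 0 < eps) :
  cvgn (fun N : nat =>
    \sum_(1 <= d < N) vonMangoldt R d / (d%:R * (d%:R + 1))) /\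
  exists C : R, \forall x \near +oo,
    `| \sum_(1 <= n < (Num.truncn x).+1) vonMangoldt R (Num.truncn (x / n%:R))
       - x * limn (fun N : nat =>
               \sum_(1 <= d < N) vonMangoldt R d / (d%:R * (d%:R + 1))) |
    <= C * x `^ (9 / 19 + eps).
Proof.
split; first exact: mangoldt_series_cvg.
have [C C0 hC] := saw_mangoldt_full (R := R).
have e0 : 0 < eps / 6 by rewrite divr_gt0.
have [M M0 hM] := subpoly_bound_powR e0.
exists ((2 * C + 4) * M ^+ 6); exists ((2 ^+ 12) ^+ 19); split; first exact: num_real.
move=> x /ltW hx.
have x1 : 1 <= x by apply: le_trans hx; do 2 (apply: exprn_ege1); rewrite ler1n.
have x0 : 0 < x by lra.
set A := M * x `^ (eps / 6).
have hA : subpoly_bound x A := hM x x1.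
pose y := x `^ 19^-1.
have y0 : 0 < y by rewrite powR_gt0.
have yx : y ^+ 19 = x.
  by rewrite -powR_mulrn ?(ltW y0)// -powRrM mulVf ?powRr1 ?(ltW x0)// pnatr_eq0.
have y9 : 2 ^+ 12 <= y.
  by rewrite -(@ler_pXn2r _ 19)// ?nnegrE ?exprn_ge0 ?(ltW y0)// yx.
have y1 : 1 <= y by apply: le_trans y9; apply: exprn_ege1; rewrite ler1n.
have [A1 tauA lnA _] := hA.
have A0 : 0 <= A by lra.
have rhsE : (2 * C + 4) * M ^+ 6 * x `^ (9 / 19 + eps) = (2 * C + 4) * A ^+ 6 * y ^+ 9.
  have -> : x `^ (9 / 19 + eps) = y ^+ 9 * (x `^ (eps / 6)) ^+ 6.
    rewrite -!powR_mulrn ?powR_ge0// -!powRrM -powRD; last by rewrite (gt_eqF x0) implybT.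
    by congr powR; field.
  by rewrite /A; ring.
rewrite rhsE.
set l := limn _.
pose B := Num.truncn (y ^+ 10).
have y10 : 0 <= y ^+ 10 by rewrite exprn_ge0// ltW.
have By : B%:R <= y ^+ 10 by rewrite truncn_le.
have yB : y ^+ 10 < B.+1%:R := truncnS_gt _.
rewrite (bigID (fun n => Num.truncn (x / n%:R) <= B)%N)/=.
rewrite (sum_fibers (fun n => Num.truncn (x / n%:R)) (f := vonMangoldt R))//.
set S2 := \sum_(1 <= n < _ | ~~ _) _.
pose S (dl : R) := \sum_(1 <= d < B.+1) vonMangoldt R d * saw (y ^+ 19 / (d%:R + dl)).
have -> : \sum_(1 <= d < B.+1) vonMangoldt R d *
    (\sum_(1 <= n < (Num.truncn x).+1 | Num.truncn (x / n%:R) == d) 1) =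
    x * mangoldt_psum B.+1 - S 0 + S 1.
  rewrite /mangoldt_psum mulr_sumr -sumrB -big_split/=.
  apply: eq_big_nat => d /andP[d0 _].
  rewrite (floor_quotient_count (ltW x0) erefl d0) yx /mangoldt_term; ring.
have hS0 : `|S 0| <= C * A ^+ 6 * y ^+ 9 by apply: hC => //; rewrite ?yx ?lexx ?ler01.
have hS1 : `|S 1| <= C * A ^+ 6 * y ^+ 9 by apply: hC => //; rewrite ?yx ?lexx ?ler01.
have A6 : A <= A ^+ 6 by rewrite ler_eXnr.
have y90 : 0 <= y ^+ 9 by rewrite exprn_ge0// ltW.
have y9x : y ^+ 9 <= x by rewrite -yx; apply: ler_weXn2l.
have hS2 : `|S2| <= A ^+ 6 * y ^+ 9.
  apply: (le_trans (ler_norm_sum _ _ _)).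
  apply: (@le_trans _ _ (\sum_(1 <= n < (Num.truncn (y ^+ 9)).+1) A)).
    rewrite [leRHS](big_nat_widen _ _ (Num.truncn x).+1); last by rewrite ltnS le_truncn.
    rewrite [leLHS]big_mkcond [leRHS]big_mkcond/=; apply: ler_sum_nat => n /andP[n0 nX].
    have nr : 0 < n%:R :> R by rewrite ltr0n.
    rewrite -ltnNge; case: ifPn => Bt; last by case: ifP.
    have t0 : (0 < Num.truncn (x / n%:R))%N by apply: leq_trans Bt.
    have tx : (Num.truncn (x / n%:R))%:R <= x / n%:R by rewrite truncn_le divr_ge0// ltW.
    rewrite ifT.
      rewrite ger0_norm ?vonMangoldt_ge0//; apply: (le_trans (vonMangoldt_le t0)); apply: lnA => //.
      by apply: (le_trans tx); rewrite ler_pdivrMr// ler_peMr ?ler1n// ltW.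
    rewrite ltnS truncn_ge_nat//.
    have h : y ^+ 10 <= x / n%:R.
      by apply: (le_trans (ltW yB)); apply: le_trans tx; rewrite ler_nat.
    rewrite ler_pdivlMr// -yx (_ : y ^+ 19 = y ^+ 10 * y ^+ 9) in h; last by ring.
    by rewrite ler_pM2l ?exprn_gt0// in h.
  rewrite sumr_const_nat subn1/= -[leLHS]mulr_natl mulrC; apply: ler_pM => //.
  by rewrite truncn_le.
have tailB : `|x * (mangoldt_psum B.+1 - l)| <= 3 * (A ^+ 6 * y ^+ 9).
  rewrite normrM (gtr0_norm x0).
  have h := @mangoldt_series_tail R B.+1 isT.
  have lnB : ln B.+1%:R <= A.
    apply: lnA => //; rewrite -natr1 -yx.
    have -> : y ^+ 19 = y ^+ 9 * y ^+ 10 by ring.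
    have e1 : 1 <= y ^+ 10 by apply: exprn_ege1.
    have e2 : 2 <= y ^+ 9.
      apply: (@le_trans _ _ y); last by rewrite ler_eXnr.
      by apply: le_trans y9; rewrite -[leLHS]expr1; apply: ler_weXn2l; rewrite ?ler1n.
    by nra.
  apply: (@le_trans _ _ (x * ((A + 2) / y ^+ 10))).
    rewrite ler_wpM2l ?(ltW x0)//; apply: (le_trans h).
    apply: ler_pM; rewrite ?invr_ge0 ?addr_ge0 ?ln_ge0 ?ler1n//; first by rewrite lerD2r.
    by rewrite lef_pV2 ?posrE ?exprn_gt0// ltW.
  have -> : x * ((A + 2) / y ^+ 10) = (A + 2) * y ^+ 9.
    by rewrite -yx; field; rewrite gt_eqF.
  by rewrite mulrA ler_wpM2r//; lra.
have -> : x * mangoldt_psum B.+1 - S 0 + S 1 + S2 - x * l =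
  x * (mangoldt_psum B.+1 - l) - S 0 + S 1 + S2 by ring.
apply: (le_trans (ler_normD _ _)).
have q1 := ler_normD (x * (mangoldt_psum B.+1 - l) - S 0) (S 1).
have q2 := ler_normB (x * (mangoldt_psum B.+1 - l)) (S 0).
have -> : (2 * C + 4) * A ^+ 6 * y ^+ 9 = 2 * (C * A ^+ 6 * y ^+ 9) + 4 * (A ^+ 6 * y ^+ 9) by ring.
lra.
Qed.
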